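(* Let $n\ge 2$, let $M\ge0$ be real, $x_0\in\mathbb R^n$, $t_0\in\mathbb R$, and $\mathcal S=\partial_t^2-e^{-2t}\Delta+M^2$ on $\mathbb R^n_x\times\mathbb R_t$. Write $$G(r,t,t_0):=(4e^{-t_0-t})^{iM}\big((e^{-t_0}+e^{-t})^2-r^2\big)^{-\frac12-iM}F\Big(\tfrac12+iM,\tfrac12+iM;1;\frac{(e^{-t_0}-e^{-t})^2-r^2}{(e^{-t_0}+e^{-t})^2-r^2}\Big).$$ The fundamental solution $\mathcal E_{+,n}(x,t;x_0,t_0)=\mathcal E_{+,n}(x-x_0,t;0,t_0)$ of $\mathcal S$ relative to $(x_0,t_0)$ (i.e. $\mathcal S\,\mathcal E_{+,n}=\delta(x-x_0,t-t_0)$) with support in the forward cone $D_+(x_0,t_0)$ is given, for $t>t_0$, by $$\mathcal E_{+,n}(x-x_0,t;0,t_0)=2\int_0^{e^{-t_0}-e^{-t}}\mathcal E^w(x-x_0,r)\,G(r,t,t_0)\,dr .$$ The fundamental solution $\mathcal E_{-,n}(x,t;x_0,t_0)=\mathcal E_{-,n}(x-x_0,t;0,t_0)$ of $\mathcal S$ relative to $(x_0,t_0)$ with support in the backward cone $D_-(x_0,t_0)$ is given, for $t<t_0$, by $$\mathcal E_{-,n}(x-x_0,t;0,t_0)=2\int_{e^{-t_0}-e^{-t}}^{0}\mathcal E^w(x-x_0,r)\,G(r,t,t_0)\,dr .$$ Here $\mathcal E^w(x,t)$ is the fundamental solution of the Cauchy problem for the wave equation: $$\mathcal E^w_{tt}-\Delta\mathcal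 E^w=0,\qquad \mathcal E^w(x,0)=\delta(x),\qquad \mathcal E^w_t(x,0)=0 .$$
   Context: $F(a,b;c;\zeta)$ is the Gauss hypergeometric function; $\Delta$ is the Laplace operator in $x\in\mathbb R^n$. For $(x_0,t_0)\in\mathbb R^n\times\mathbb R$, $$D_\pm(x_0,t_0):=\{(x,t)\in\mathbb R^{n+1}:\ |x-x_0|\le\pm(e^{-t_0}-e^{-t})\}.$$ The integrals are taken in the sense of distributions in $x$: $r\mapsto\mathcal E^w(\cdot,r)$, $r\in\mathbb R$, is a smooth family of compactly supported distributions. $\mathcal E_{+,n}$ is zero for $t<t_0$ and $\mathcal E_{-,n}$ is zero for $t>t_0$. *)

(* Defs.v *)
From Stdlib Require Import Reals.
From Coquelicot Require Import Coquelicot.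
From mathcomp Require Import all_boot.
Set Implicit Arguments.
Unset Strict Implicit.
Unset Printing Implicit Defensive.
Open Scope R_scope.

(* Points of R^n are functions 'I_n -> R.  Coquelicot's uniform structure on
   this type is that of the sup norm, i.e. the usual topology of R^n. *)
Notation vec n := ('I_n -> R).

Definition enorm (n : nat) (x : vec n) : R :=
  sqrt (\big[Rplus/0]_(i < n) (x i) ^ 2).

Definition vzero (n : nat) : vec n := fun _ => 0.

Definition upd (n : nat) (x : vec n) (i : 'I_n) (s : R) : vec n :=
  fun j => if j == i then s else x j.

(* Space-time R^n_x * R_t is R^(n+1), the last coordinate being time. *)
Definition st (n : nat) (x : vec n) (t : R) : vec n.+1 :=
  fun j => oapp x t (unlift ord_max j).

Definition space (n : nat) (z : vec n.+1) : vec n :=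
  fun i => z (lift ord_max i).

Definition time (n : nat) (z : vec n.+1) : R := z ord_max.

(* Derivative of a complex-valued function of a real variable; meaningful where
   [ex_derive f x]. *)
Definition derivC (f : R -> C) (x : R) : C :=
  (Derive (fun s => Re (f s)) x, Derive (fun s => Im (f s)) x).

Definition smooth1 (f : R -> C) : Prop :=
  forall (k : nat) (x : R), ex_derive (iter k derivC f) x.

Definition pd (n : nat) (i : 'I_n) (f : vec n -> C) (x : vec n) : C :=
  derivC (fun s => f (upd x i s)) (x i).

Definition pds (n : nat) (l : seq 'I_n) (f : vec n -> C) : vec n -> C :=
  foldr (@pd n) f l.

Definition smooth (n : nat) (f : vec n -> C) : Prop :=
  forall (l : seq 'I_n) (x : vec n),
    continuous (pds l f) x /\
    forall i : 'I_n, ex_derive (fun s => pds l f (upd x i s)) (x i).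

Definition support (n : nat) (f : vec n -> C) (x : vec n) : Prop :=
  forall eps : posreal, exists y : vec n, ball x eps y /\ f y <> 0.

Definition supported_in_ball (n : nat) (A : R) (f : vec n -> C) : Prop :=
  forall x : vec n, support f x -> enorm x <= A.

(* The space of test functions C_c^oo(R^n; C); supports are closed, so compact
   means bounded. *)
Definition test_fun (n : nat) (f : vec n -> C) : Prop :=
  smooth f /\ exists A : R, supported_in_ball A f.

(* A distribution is represented by a functional on all functions R^n -> C, of
   which only the values on test functions are relevant; see [dist_eq]. *)
Notation functional n := ((vec n -> C) -> C).

(* Continuity on C_c^oo: on each ball, T is bounded by finitely many sup norms
   of partial derivatives. *)
Definition distribution (n : nat) (T : functional n) : Prop :=
  (forall f g : vec n -> C, test_fun f -> test_fun g ->
     T (fun x => (f x + g x)%C) = (T f + T g)%C) /\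
  (forall (a : C) (f : vec n -> C), test_fun f ->
     T (fun x => (a * f x)%C) = (a * T f)%C) /\
  (forall A : R, exists (K : R) (N : nat),
     forall f : vec n -> C, test_fun f -> supported_in_ball A f ->
     forall B : R,
       (forall l : seq 'I_n, (size l <= N)%N ->
          forall x : vec n, Cmod (pds l f x) <= B) ->
       Cmod (T f) <= K * B).

Definition dist_eq (n : nat) (S T : functional n) : Prop :=
  forall f : vec n -> C, test_fun f -> S f = T f.

Definition dist_vanishes_on (n : nat) (T : functional n) (U : vec n -> Prop)
  : Prop :=
  forall f : vec n -> C, test_fun f -> (forall x, support f x -> U x) ->
    T f = 0.

Definition dist_support (n : nat) (T : functional n) (x : vec n) : Prop :=
  ~ exists U : vec n -> Prop, open U /\ U x /\ dist_vanishes_on T U.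

Definition compactly_supported (n : nat) (T : functional n) : Prop :=
  exists A : R, forall x : vec n, dist_support T x -> enorm x <= A.

Definition dirac (n : nat) (a : vec n) : functional n := fun f => f a.

Definition dist_diff (n : nat) (i : 'I_n) (T : functional n) : functional n :=
  fun f => (- T (pd i f))%C.

Definition dist_mul (n : nat) (a : vec n -> R) (T : functional n)
  : functional n :=
  fun f => T (fun x => (RtoC (a x) * f x)%C).

(* The translate T(x - a). *)
Definition dist_translate (n : nat) (a : vec n) (T : functional n)
  : functional n :=
  fun f => T (fun x => f (fun i => x i + a i)).

Definition dist_laplacian (n : nat) (T : functional n) : functional n :=
  fun f => \big[Cplus/RtoC 0]_(i < n) dist_diff i (dist_diff i T) f.

(* The Laplace operator in x on distributions on space-time. *)
Definition dist_laplacian_x (n : nat) (T : functional n.+1)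
  : functional n.+1 :=
  fun f => \big[Cplus/RtoC 0]_(i < n)
    dist_diff (lift ord_max i) (dist_diff (lift ord_max i) T) f.

(* S = d_t^2 - e^(-2t) Delta + M^2. *)
Definition KG_op (n : nat) (M : R) (T : functional n.+1) : functional n.+1 :=
  fun f =>
    (dist_diff ord_max (dist_diff ord_max T) f
     - dist_mul (fun z => exp (- 2 * time z)) (dist_laplacian_x T) f
     + RtoC (M ^ 2) * T f)%C.

Definition forward_cone (n : nat) (x0 : vec n) (t0 : R) (z : vec n.+1)
  : Prop :=
  enorm (fun i => space z i - x0 i) <= exp (- t0) - exp (- time z).

Definition backward_cone (n : nat) (x0 : vec n) (t0 : R) (z : vec n.+1)
  : Prop :=
  enorm (fun i => space z i - x0 i) <= - (exp (- t0) - exp (- time z)).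

Definition fundamental_solution (n : nat) (M : R) (x0 : vec n) (t0 : R)
  (D : vec n.+1 -> Prop) (E : functional n.+1) : Prop :=
  distribution E /\
  dist_eq (KG_op M E) (dirac (st x0 t0)) /\
  (forall z : vec n.+1, dist_support E z -> D z).

Definition the_fundamental_solution (n : nat) (M : R) (x0 : vec n) (t0 : R)
  (D : vec n.+1 -> Prop) (E : functional n.+1) : Prop :=
  fundamental_solution M x0 t0 D E /\
  forall E' : functional n.+1,
    fundamental_solution M x0 t0 D E' -> dist_eq E' E.

Definition smooth_family (n : nat) (T : R -> functional n) : Prop :=
  forall f : vec n -> C, test_fun f -> smooth1 (fun r => T r f).

Definition wave_fundamental_solution (n : nat) (Ew : R -> functional n)
  : Prop :=
  (forall r : R, distribution (Ew r) /\ compactly_supported (Ew r)) /\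
  smooth_family Ew /\
  (forall f : vec n -> C, test_fun f ->
     forall r : R,
       (derivC (derivC (fun s => Ew s f)) r - dist_laplacian (Ew r) f)%C = 0) /\
  dist_eq (Ew 0) (dirac (@vzero n)) /\
  (forall f : vec n -> C, test_fun f -> derivC (fun s => Ew s f) 0 = 0).

(* U = \int_a^b T(r) dr in the sense of distributions. *)
Definition is_dist_RInt (n : nat) (T : R -> functional n) (a b : R)
  (U : functional n) : Prop :=
  forall f : vec n -> C, test_fun f -> is_RInt (fun r => T r f) a b (U f).

(* E is the distribution on space-time defined by the family t |-> U(t) of
   distributions in x:  E(f) = \int_R U(t)(f(.,t)) dt. *)
Definition is_dist_of_family (n : nat) (U : R -> functional n)
  (E : functional n.+1) : Prop :=
  forall f : vec n.+1 -> C, test_fun f ->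
    is_RInt_gen (fun t => U t (fun x => f (st x t)))
      (Rbar_locally m_infty) (Rbar_locally p_infty) (E f).

(* x^w for x > 0. *)
Definition RpowC (x : R) (w : C) : C :=
  (RtoC (exp (Re w * ln x)) * (cos (Im w * ln x), sin (Im w * ln x)))%C.

Fixpoint pochhammer (a : C) (k : nat) : C :=
  if k is k'.+1 then (pochhammer a k' * (a + RtoC (INR k')))%C else RtoC 1.

(* The Gauss series, which defines F(a,b;c;z) for |z| < 1 and c not a
   nonpositive integer.  In [Gkernel] below z lies in [0,1) whenever
   |r| <= |e^(-t0) - e^(-t)|. *)
Definition hyp2F1_term (a b c z : C) (k : nat) : C :=
  (pochhammer a k * pochhammer b k /
     (pochhammer c k * RtoC (INR (Factorial.fact k))) * Cpow z k)%C.

Definition hyp2F1 (a b c z : C) : C :=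
  (Series (fun k => Re (hyp2F1_term a b c z k)),
   Series (fun k => Im (hyp2F1_term a b c z k))).

Definition Gkernel (M r t t0 : R) : C :=
  let iM := (Ci * RtoC M)%C in
  let half := RtoC (1 / 2) in
  (RpowC (4 * exp (- t0 - t)) iM
   * RpowC ((exp (- t0) + exp (- t)) ^ 2 - r ^ 2) (- half - iM)
   * hyp2F1 (half + iM) (half + iM) (RtoC 1)
       (RtoC (((exp (- t0) - exp (- t)) ^ 2 - r ^ 2) /
              ((exp (- t0) + exp (- t)) ^ 2 - r ^ 2))))%C.

(* The family r |-> 2 Ew(x - x0, r) G(r,t,t0) of distributions in x. *)
Definition integrand (n : nat) (M : R) (Ew : R -> functional n) (x0 : vec n)
  (t t0 : R) : R -> functional n :=
  fun r f => (RtoC 2 * (dist_translate x0 (Ew r) f * Gkernel M r t t0))%C.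

(* Main.v *)
(** In the variables [tau = t - t0], [r = e^(-t0) s (1 - e^(-tau))] the asserted
    formula applies to a test function [f] on space-time the operator
      [K f (x0, t0) = int_0^T int_0^1 kap tau s * Ew(r) (f (x0 + ., t0 + tau)) ds dtau]
    with [T = +-oo] according to the cone.  By the hypergeometric equation the
    kernel [kap] is the Riemann function of the one-dimensional operator
    [d_tau^2 - e^(-2 tau) d_r^2 + M^2], and [Ew(r)] turns [d_r^2] into the Laplacian;
    integrating by parts over the triangle [|s| <= 1] gives [K S' = S' K = 1] on test
    functions, [S'] being the transpose of the Klein-Gordon operator.  [K S' = 1] says
    that [f |-> K f (x0, t0)] is a fundamental solution; finite propagation speed, from
    an energy estimate in shrinking balls, confines it to the cone.  If [E'] is another
    one and [chi] is 1 near the part of the cone where [K f] does not vanish, then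
    [f - S' (chi K f)] vanishes near the cone by [S' K = 1], so [E' f = (K f) (x0, t0)].
    Differentiation under the integral sign needs bounds for [Ew(r)] uniform in [r],
    which follow from pointwise boundedness by the Banach-Steinhaus theorem. *)
Require Import Defs.
From Stdlib Require Import Reals Lra Lia Psatz FunctionalExtensionality Classical ClassicalEpsilon PropExtensionality.
From Coquelicot Require Import Coquelicot.
From mathcomp Require Import all_boot.
Open Scope R_scope.
Set Implicit Arguments.
Unset Strict Implicit.
Unset Printing Implicit Defensive.

(** * Derivatives of complex-valued functions of a real variable *)

(** Every derivative is certified by a quadratic remainder, |f(x+h) - f(x) - h l| <= D h^2. Bounds
    of this form survive limits of series, application of a distribution of known order and
    integration over compact sets, so differentiation under a distribution or an integral reduces to
    one Taylor estimate. Smoothness of what is built is then read off from classes of locally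
    bounded functions closed under partial derivatives; the wave family fits because d_r exchanges
    Ew(r) f with its own r-derivative, up to a Laplacian applied to f. Scaling r by the radius of
    the cone replaces the moving triangle by a fixed rectangle of (tau, s), whose limits do not
    depend on (x0, t0); for compactly supported f a finite T suffices. Both K S' = 1 and S' K = 1
    come from one identity because moving the apex of the cone amounts to reversing tau, under which
    the kernel is odd. Uniqueness rests on the fact that the cone, cut off at the times where f
    lives, is bounded: this is why a cutoff turns K f into a test function without changing it where
    it matters. *)

Lemma C_eq (a b : C) : Re a = Re b -> Im a = Im b -> a = b.
Proof. by case: a => a1 a2; case: b => b1 b2 /= -> ->. Qed.

Lemma Cmod_le_ReIm (z : C) : Cmod z <= Rabs (Re z) + Rabs (Im z).
Proof.
case: z => x y; rewrite /Cmod /=.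
have hx := Rabs_pos x; have hy := Rabs_pos y.
apply: Rsqr_incr_0_var; last by lra.
rewrite Rsqr_sqrt; last by nra.
rewrite /Rsqr; have := pow2_abs x; have := pow2_abs y; rewrite /= => h1 h2; nra.
Qed.

Lemma Re_le_Cmod (z : C) : Rabs (Re z) <= Cmod z.
Proof. exact: re_le_Cmod. Qed.

Lemma Im_le_Cmod (z : C) : Rabs (Im z) <= Cmod z.
Proof. by apply: Rle_trans (Rmax_Cmod z); apply: Rmax_r. Qed.

(** Componentwise, like [derivC]; [isD_ex] and [ex_isD] pass to and from [ex_derive] for the product
    structure on C. *)
Definition isD (f : R -> C) (x : R) (l : C) : Prop :=
  is_derive (fun s => Re (f s)) x (Re l) /\
  is_derive (fun s => Im (f s)) x (Im l).

Lemma isD_derivC f x l : isD f x l -> derivC f x = l.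
Proof.
by case=> h1 h2; apply: C_eq; rewrite /derivC /=; apply: is_derive_unique.
Qed.

Lemma isD_ex f x l : isD f x l -> ex_derive f x.
Proof.
case=> h1 h2; exists l; rewrite /is_derive.
have h3 := @filterdiff_comp'_2 _ _ _ _ (prod_NormedModule R_AbsRing R_NormedModule R_NormedModule)
  _ _ (fun a b => (a, b)) _ _ _ (fun a b => (a, b)) h1 h2.
have h4 : filterdiff (fun t : prod_NormedModule R_AbsRing R_NormedModule R_NormedModule => (t.1, t.2))
  (locally (Re (f x), Im (f x))) (fun t => (t.1, t.2)).
  apply: filterdiff_linear.
  apply: (is_linear_ext (fun t : prod_NormedModule R_AbsRing R_NormedModule R_NormedModule => t)); first by case.
  exact: is_linear_id.
move: (h3 h4) => h5.
apply: (filterdiff_ext_lin (fun y => f y) (fun y => (scal y (Re l), scal y (Im l)))) => //.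
Qed.

Lemma ex_isD f x : ex_derive f x -> isD f x (derivC f x).
Proof.
case=> l hl; split; apply: Derive_correct.
  exists (Re l).
  have := filterdiff_comp' f (fun z : prod_NormedModule R_AbsRing R_NormedModule R_NormedModule => fst z) x _ (fun z => fst z) hl.
  by apply; apply: filterdiff_linear; apply: is_linear_fst.
exists (Im l).
have := filterdiff_comp' f (fun z : prod_NormedModule R_AbsRing R_NormedModule R_NormedModule => snd z) x _ (fun z => snd z) hl.
by apply; apply: filterdiff_linear; apply: is_linear_snd.
Qed.

Lemma isD_unique f x l l' : isD f x l -> isD f x l' -> l = l'.
Proof. by move=> /isD_derivC <- /isD_derivC <-. Qed.

Lemma isD_ext f g x l : (forall s, f s = g s) -> isD f x l -> isD g x l.
Proof. by move=> /functional_extensionality ->. Qed.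

Lemma isD_const c x : isD (fun _ => c) x 0.
Proof. by split; apply: is_derive_const. Qed.

Lemma isD_plus f g x l m : isD f x l -> isD g x m -> isD (fun s => f s + g s)%C x (l + m)%C.
Proof. by case=> a b [c d]; split; apply: @is_derive_plus. Qed.

Lemma isD_mult f g x l m : isD f x l -> isD g x m ->
  isD (fun s => f s * g s)%C x (l * g x + f x * m)%C.
Proof.
case=> a b [c d]; split.
  apply: (is_derive_ext (fun s => Re (f s) * Re (g s) - Im (f s) * Im (g s))) => //.
  have -> : Re (l * g x + f x * m) = minus (plus (Re l * Re (g x)) (Re (f x) * Re m))
     (plus (Im l * Im (g x)) (Im (f x) * Im m)).
    by rewrite /minus /plus /opp /Re /Im /=; ring.
  by apply: @is_derive_minus; apply: is_derive_mult => //; move=> *; apply: Rmult_comm.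
apply: (is_derive_ext (fun s => Re (f s) * Im (g s) + Im (f s) * Re (g s))) => //.
have -> : Im (l * g x + f x * m) = plus (plus (Re l * Im (g x)) (Re (f x) * Im m))
     (plus (Im l * Re (g x)) (Im (f x) * Re m)).
  by rewrite /minus /plus /opp /Re /Im /=; ring.
by apply: @is_derive_plus; apply: is_derive_mult => //; move=> *; apply: Rmult_comm.
Qed.

Lemma isD_scal c f x l : isD f x l -> isD (fun s => c * f s)%C x (c * l)%C.
Proof.
move=> h; have := isD_mult (isD_const c x) h.
by have -> : (0 * f x + c * l = c * l)%C by ring.
Qed.

Lemma isD_opp f x l : isD f x l -> isD (fun s => - f s)%C x (- l)%C.
Proof. by case=> a b; split; apply: @is_derive_opp. Qed.

Lemma isD_minus f g x l m : isD f x l -> isD g x m -> isD (fun s => f s - g s)%C x (l - m)%C.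
Proof. by move=> a b; apply: isD_plus => //; apply: isD_opp. Qed.

Lemma isD_RtoC (f : R -> R) x l : is_derive f x l -> isD (fun s => RtoC (f s)) x (RtoC l).
Proof. by move=> h; split => //=; apply: is_derive_const. Qed.

Lemma isD_comp (f : R -> C) (g : R -> R) x l m :
  isD f (g x) l -> is_derive g x m -> isD (fun s => f (g s)) x (RtoC m * l)%C.
Proof.
case=> a b c; split.
  have -> : Re (RtoC m * l) = scal m (Re l) by rewrite /scal /= /mult /Re /Im /=; ring.
  exact: (is_derive_comp (fun s => Re (f s)) g).
have -> : Im (RtoC m * l) = scal m (Im l) by rewrite /scal /= /mult /Re /Im /=; ring.
exact: (is_derive_comp (fun s => Im (f s)) g).
Qed.

Lemma isD_shift (f : R -> C) a x l : isD f (a + x) l -> isD (fun s => f (a + s)) x l.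
Proof.
move=> h; have := @isD_comp f (fun s => a + s) x l 1 h.
have -> : (RtoC 1 * l = l)%C by ring.
by apply; auto_derive => //; ring.
Qed.

Lemma is_derive_quad (f : R -> R) x l D d : 0 < d ->
  (forall h, Rabs h < d -> Rabs (f (x + h) - f x - h * l) <= D * h ^ 2) ->
  is_derive f x l.
Proof.
move=> d0 hf; apply/is_derive_Reals => eps eps0.
have D0 : 0 < Rabs D + 1 by have := Rabs_pos D; lra.
have m0 : 0 < Rmin d (eps / (Rabs D + 1)).
  by apply: Rmin_pos => //; apply: Rdiv_lt_0_compat.
exists (mkposreal _ m0) => h h0 /= hm.
have h1 : Rabs h < d by apply: Rlt_le_trans hm (Rmin_l _ _).
have h2 : Rabs h < eps / (Rabs D + 1) by apply: Rlt_le_trans hm (Rmin_r _ _).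
have ha : 0 < Rabs h by apply: Rabs_pos_lt.
have -> : (f (x + h) - f x) / h - l = (f (x + h) - f x - h * l) / h by field.
rewrite Rabs_div //; apply: (Rmult_lt_reg_r (Rabs h)) => //.
rewrite /Rdiv Rmult_assoc Rinv_l ?Rmult_1_r; last by lra.
apply: Rle_lt_trans (hf h h1) _; rewrite -(pow2_abs h).
have h3 : Rabs h * (Rabs D + 1) < eps.
  by apply: (Rmult_lt_reg_r (/ (Rabs D + 1))); [exact: Rinv_0_lt_compat
   | rewrite Rmult_assoc Rinv_r ?Rmult_1_r; lra].
have := Rle_abs D; nra.
Qed.

Lemma isD_quad (f : R -> C) (x : R) l D d : 0 < d ->
  (forall h, Rabs h < d -> Cmod (f (Rplus x h) - f x - RtoC h * l)%C <= D * h ^ 2) ->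
  isD f x l.
Proof.
move=> d0 hf; split; apply: (is_derive_quad (D := D) d0) => h /hf.
  apply: Rle_trans; apply: Rle_trans (Re_le_Cmod _).
  by apply: Req_le; congr Rabs; rewrite /Re /Im /=; ring.
apply: Rle_trans; apply: Rle_trans (Im_le_Cmod _).
by apply: Req_le; congr Rabs; rewrite /Re /Im /=; ring.
Qed.

(** The mean value theorem for [f] and then for [f1]: the first intermediate point lies within
    [Rabs h] of [x], so the bound carries no factor 1/2. *)
Lemma taylor_quad (f f1 f2 : R -> R) x d B :
  (forall s, Rabs (s - x) < d -> is_derive f s (f1 s)) ->
  (forall s, Rabs (s - x) < d -> is_derive f1 s (f2 s)) ->
  (forall s, Rabs (s - x) < d -> Rabs (f2 s) <= B) ->
  forall h, Rabs h < d -> Rabs (f (x + h) - f x - h * f1 x) <= B * h ^ 2.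
Proof.
move=> h1 h2 hB h hh.
have [c [e1 hc]] : exists c, f (x + h) - f x = f1 c * (x + h - x) /\ Rabs (c - x) <= Rabs (x + h - x).
  apply: (@MVT_cor4 f f1 x (Rabs h)) => [c hc|]; first by apply: h1; lra.
  by apply: Req_le; congr Rabs; ring.
have xh : x + h - x = h by ring.
rewrite xh in e1 hc.
have [e [e2 he]] : exists e, f1 c - f1 x = f2 e * (c - x) /\ Rabs (e - x) <= Rabs (c - x).
  by apply: (@MVT_cor4 f1 f2 x (Rabs h)) => // e he; apply: h2; lra.
rewrite e1; have -> : f1 c * h - h * f1 x = f2 e * (c - x) * h by rewrite -e2; ring.
rewrite !Rabs_mult -(pow2_abs h).
have := hB e ltac:(lra); have := Rabs_pos (f2 e); have := Rabs_pos h; have := Rabs_pos (c - x).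
move=> p1 p2 p3 p4.
have : Rabs (f2 e) * (Rabs (c - x) * Rabs h) <= B * (Rabs h * Rabs h).
  by apply: Rmult_le_compat => //; nra.
by rewrite /=; nra.
Qed.

(** The mean value theorem fails for complex values; real and imaginary parts are treated
    separately, whence the factor 2. *)
Lemma taylor_quadC (f f1 f2 : R -> C) (x d B : R) :
  (forall s, Rabs (s - x) < d -> isD f s (f1 s)) ->
  (forall s, Rabs (s - x) < d -> isD f1 s (f2 s)) ->
  (forall s, Rabs (s - x) < d -> Cmod (f2 s) <= B) ->
  forall h, Rabs h < d -> Cmod (f (Rplus x h) - f x - RtoC h * f1 x)%C <= 2 * B * h ^ 2.
Proof.
move=> h1 h2 hB h hh; apply: Rle_trans (Cmod_le_ReIm _) _.
have -> : 2 * B * h ^ 2 = B * h ^ 2 + B * h ^ 2 by ring.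
apply: Rplus_le_compat.
  have := @taylor_quad (fun s => Re (f s)) (fun s => Re (f1 s)) (fun s => Re (f2 s)) x d B.
  move=> /(_ (fun s hs => proj1 (h1 s hs)) (fun s hs => proj1 (h2 s hs))).
  move=> /(_ (fun s hs => Rle_trans _ _ _ (Re_le_Cmod _) (hB s hs)) h hh).
  by apply: Rle_trans; apply: Req_le; congr Rabs; rewrite /Re /Im /=; ring.
have := @taylor_quad (fun s => Im (f s)) (fun s => Im (f1 s)) (fun s => Im (f2 s)) x d B.
move=> /(_ (fun s hs => proj2 (h1 s hs)) (fun s hs => proj2 (h2 s hs))).
move=> /(_ (fun s hs => Rle_trans _ _ _ (Im_le_Cmod _) (hB s hs)) h hh).
by apply: Rle_trans; apply: Req_le; congr Rabs; rewrite /Re /Im /=; ring.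
Qed.

Lemma lip_of_isD (f f1 : R -> C) x d B :
  (forall s, Rabs (s - x) <= d -> isD f s (f1 s)) ->
  (forall s, Rabs (s - x) <= d -> Cmod (f1 s) <= B) ->
  forall y, Rabs (y - x) <= d -> Cmod (f y - f x)%C <= 2 * B * Rabs (y - x).
Proof.
move=> h1 hB y hy; apply: Rle_trans (Cmod_le_ReIm _) _.
have -> : 2 * B * Rabs (y - x) = B * Rabs (y - x) + B * Rabs (y - x) by ring.
apply: Rplus_le_compat.
  have [c [e hc]] := @MVT_cor4 (fun s => Re (f s)) (fun s => Re (f1 s)) x d
    (fun s hs => proj1 (h1 s hs)) y hy.
  have -> : Re (f y - f x) = Re (f1 c) * (y - x) by rewrite -e.
  rewrite Rabs_mult; apply: Rmult_le_compat_r; first exact: Rabs_pos.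
  by apply: Rle_trans (Re_le_Cmod _) _; apply: hB; lra.
have [c [e hc]] := @MVT_cor4 (fun s => Im (f s)) (fun s => Im (f1 s)) x d
  (fun s hs => proj2 (h1 s hs)) y hy.
have -> : Im (f y - f x) = Im (f1 c) * (y - x) by rewrite -e.
rewrite Rabs_mult; apply: Rmult_le_compat_r; first exact: Rabs_pos.
by apply: Rle_trans (Im_le_Cmod _) _; apply: hB; lra.
Qed.

(** * Smooth functions on R^n *)

Definition near_vec n (x : vec n) (d : R) (y : vec n) : Prop :=
  forall i, Rabs (y i - x i) < d.

Lemma upd_same n (x : vec n) i s : upd x i s i = s.
Proof. by rewrite /upd eqxx. Qed.

Lemma upd_neq n (x : vec n) i j s : j != i -> upd x i s j = x j.
Proof. by rewrite /upd => /negbTE ->. Qed.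

Lemma upd_id n (x : vec n) i : upd x i (x i) = x.
Proof. by apply: functional_extensionality => j; rewrite /upd; case: eqP => // ->. Qed.

Lemma upd_upd n (x : vec n) i s t : upd (upd x i s) i t = upd x i t.
Proof. by apply: functional_extensionality => j; rewrite /upd; case: eqP. Qed.

Lemma upd_comm n (x : vec n) i j s t : i != j ->
  upd (upd x i s) j t = upd (upd x j t) i s.
Proof.
move=> ij; apply: functional_extensionality => k; rewrite /upd.
by case: (eqVneq k j) => // ->; rewrite eq_sym (negbTE ij).
Qed.

Lemma near_vec_upd n (x : vec n) d y i s : near_vec x d y -> Rabs (s - x i) < d ->
  near_vec x d (upd y i s).
Proof. by move=> h hs j; rewrite /upd; case: eqP => [->|]. Qed.

Lemma near_vec_refl n (x : vec n) d : 0 < d -> near_vec x d x.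
Proof. by move=> d0 i; rewrite Rminus_diag Rabs_R0. Qed.

Lemma near_vec_le n (x y : vec n) d e : d <= e -> near_vec x d y -> near_vec x e y.
Proof. by move=> de h i; apply: Rlt_le_trans (h i) de. Qed.

Lemma continuousC_P n (f : vec n -> C) x :
  continuous f x <->
  forall eps, 0 < eps -> exists2 d, 0 < d & forall y, near_vec x d y -> Cmod (f y - f x)%C < eps.
Proof.
split=> [h eps e0|h P [eps hP]].
  have e2 : 0 < eps / 2 by lra.
  have [d hd] := h _ (locally_ball (f x) (mkposreal _ e2)).
  exists d; first exact: cond_pos.
  move=> y hy; have [/= h1 h2] := hd y hy.
  by apply: Rle_lt_trans (Cmod_le_ReIm _) _; rewrite (_ : eps = eps / 2 + eps / 2);
    [apply: Rplus_lt_compat; [exact: h1 | exact: h2] | field].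
have [d d0 hd] := h _ (cond_pos eps).
exists (mkposreal _ d0) => y hy; apply: hP; have := hd y hy => h1.
by split; apply: Rle_lt_trans h1; [exact: (Re_le_Cmod (f y - f x)) | exact: (Im_le_Cmod (f y - f x))].
Qed.

Definition locb n (f : vec n -> C) : Prop :=
  forall x, exists d B, 0 < d /\ forall y, near_vec x d y -> Cmod (f y) <= B.

Lemma continuous_locb n (f : vec n -> C) : (forall x, continuous f x) -> locb f.
Proof.
move=> h x; have /continuousC_P /(_ 1 Rlt_0_1) [d d0 hd] := h x.
exists d, (Cmod (f x) + 1); split => // y /hd h1.
have -> : (f y = f x + (f y - f x))%C by ring.
by apply: Rle_trans (Cmod_triangle _ _) _; lra.
Qed.

Definition is_pd n (i : 'I_n) (f : vec n -> C) (x : vec n) (l : C) : Prop :=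
  isD (fun s => f (upd x i s)) (x i) l.

Lemma is_pd_pd n i (f : vec n -> C) x l : is_pd i f x l -> pd i f x = l.
Proof. exact: isD_derivC. Qed.

Lemma is_pd_line n i (f g : vec n -> C) y s :
  (forall x, is_pd i f x (g x)) -> isD (fun s => f (upd y i s)) s (g (upd y i s)).
Proof.
move=> h; have := h (upd y i s); rewrite /is_pd upd_same.
by apply: isD_ext => t; rewrite upd_upd.
Qed.

(** * From partial derivatives to continuity *)

Lemma telescope (g : nat -> C) D k :
  (forall j, (j < k)%N -> Cmod (g j.+1 - g j)%C <= D) -> Cmod (g k - g 0%N)%C <= INR k * D.
Proof.
elim: k => [|k IH] h.
  have -> : (g 0%N - g 0%N = 0)%C by ring.
  by rewrite Cmod_0 /=; lra.
have -> : (g k.+1 - g 0%N = (g k.+1 - g k) + (g k - g 0%N))%C by ring.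
apply: Rle_trans (Cmod_triangle _ _) _; rewrite S_INR.
have := h k (ltnSn k); have := IH (fun j hj => h j (leqW hj)); lra.
Qed.

(** The staircase path from [x] to [y], one coordinate moved at a time; it turns bounds on partial
    derivatives into a Lipschitz bound. *)
Definition mix n (x y : vec n) (k : nat) : vec n := fun j => if (j < k)%N then y j else x j.

Lemma mix0 n (x y : vec n) : mix x y 0 = x.
Proof. by apply: functional_extensionality => j. Qed.

Lemma mixn n (x y : vec n) : mix x y n = y.
Proof. by apply: functional_extensionality => j; rewrite /mix ltn_ord. Qed.

Lemma mixS n (x y : vec n) (i : 'I_n) : mix x y i.+1 = upd (mix x y i) i (y i).
Proof.
apply: functional_extensionality => j; rewrite /mix /upd ltnS.
case: (eqVneq j i) => [->|ne]; first by rewrite leqnn.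
by rewrite leq_eqVlt (_ : (nat_of_ord j == i) = false) //; apply/negbTE.
Qed.

Lemma mix_upd n (x y : vec n) (i : 'I_n) : mix x y i = upd (mix x y i) i (x i).
Proof.
apply: functional_extensionality => j; rewrite /mix /upd.
by case: (eqVneq j i) => [->|//]; rewrite ltnn.
Qed.

Lemma near_mix n (x y : vec n) d k : 0 < d -> near_vec x d y -> near_vec x d (mix x y k).
Proof.
by move=> d0 h j; rewrite /mix; case: ifP => // _; rewrite Rminus_diag Rabs_R0.
Qed.

Lemma lip_of_pd n (f : vec n -> C) (g : 'I_n -> vec n -> C) x d B :
  (forall i y, is_pd i f y (g i y)) ->
  0 < d -> (forall i y, near_vec x d y -> Cmod (g i y) <= B) ->
  forall r y, r < d -> (forall i, Rabs (y i - x i) <= r) -> Cmod (f y - f x)%C <= INR n * (2 * B * r).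
Proof.
move=> hpd d0 hB r y rd hy.
have hn : near_vec x d y by move=> i; apply: Rle_lt_trans (hy i) rd.
rewrite -{1}(mixn x y) -{1}(mix0 x y).
apply: (@telescope (fun k => f (mix x y k))) => j hj.
pose i := Ordinal hj; rewrite -[j]/(nat_of_ord i) mixS.
rewrite [X in (_ - f X)%C]mix_upd.
have B0 : 0 <= B by apply: Rle_trans (Cmod_ge_0 (g i x)) _; apply: hB; apply: near_vec_refl.
apply: Rle_trans (_ : 2 * B * Rabs (y i - x i) <= _); last first.
  by apply: Rmult_le_compat_l; [lra | exact: hy].
apply: (@lip_of_isD (fun s => f (upd (mix x y i) i s)) (fun s => g i (upd (mix x y i) i s)) (x i) (Rabs (y i - x i)) B).
- by move=> s _; apply: is_pd_line.
- move=> s hs; apply: hB; apply: near_vec_upd; first exact: near_mix.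
  by apply: Rle_lt_trans hs _; apply: hn.
- exact: Rle_refl.
Qed.

Lemma common_nbhd n m (P : 'I_m -> vec n -> R -> Prop) (x : vec n) :
  (forall i y B B', B <= B' -> P i y B -> P i y B') ->
  (forall i, exists d B, 0 < d /\ forall y, near_vec x d y -> P i y B) ->
  exists d B, 0 < d /\ forall i y, near_vec x d y -> P i y B.
Proof.
move=> mono h.
suff H : forall s : seq 'I_m, exists d B, 0 < d /\ forall i y, i \in s -> near_vec x d y -> P i y B.
  have [d [B [d0 hd]]] := H (enum 'I_m).
  by exists d, B; split => // i y; apply: hd; rewrite mem_enum.
elim=> [|j s [d [B [d0 hd]]]]; first by exists 1, 0; split => //; exact: Rlt_0_1.
have [d' [B' [d'0 hd']]] := h j.
exists (Rmin d d'), (Rmax B B'); split; first exact: Rmin_pos.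
move=> i y; rewrite inE => /orP [/eqP ->|hi] hy.
  apply: mono (Rmax_r B B') _; apply: hd'; exact: near_vec_le (Rmin_r _ _) hy.
apply: mono (Rmax_l B B') _; apply: hd => //; exact: near_vec_le (Rmin_l _ _) hy.
Qed.

Lemma continuous_of_pd n (f : vec n -> C) (g : 'I_n -> vec n -> C) :
  (forall i y, is_pd i f y (g i y)) -> (forall i, locb (g i)) -> forall x, continuous f x.
Proof.
move=> hpd hb x; apply/continuousC_P => eps e0.
have [d [B [d0 hB]]] : exists d B, 0 < d /\ forall i y, near_vec x d y -> Cmod (g i y) <= B.
  apply: (@common_nbhd n n (fun i y B => Cmod (g i y) <= B)) => [i y B B' h1 h2|i]; first lra.
  exact: hb.
(* The [+ 1] keeps [K] positive when [n] or [B] is 0. *)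
pose K := INR n * (2 * Rabs B) + 1.
have K0 : 0 < K by rewrite /K; have := pos_INR n; have := Rabs_pos B; nra.
have r0 : 0 < Rmin (d / 2) (eps / (2 * K)).
  by apply: Rmin_pos; [lra | apply: Rdiv_lt_0_compat; lra].
exists (Rmin (d / 2) (eps / (2 * K))) => // y hy.
have h1 := Rmin_l (d / 2) (eps / (2 * K)); have h2 := Rmin_r (d / 2) (eps / (2 * K)).
set r := Rmin _ _ in r0 hy h1 h2.
apply: Rle_lt_trans (_ : INR n * (2 * Rabs B * r) < _).
  apply: (@lip_of_pd n f g x d (Rabs B) hpd d0 _ r y); [|lra|].
    by move=> i z hz; apply: Rle_trans (hB i z hz) _; apply: Rle_abs.
  by move=> i; apply: Rlt_le.
have h3 : r * K <= eps / 2.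
  apply: Rle_trans (_ : eps / (2 * K) * K <= _); first by apply: Rmult_le_compat_r; lra.
  by apply: Req_le; field; lra.
rewrite /K in h3; lra.
Qed.

Lemma smooth_is_pd n (f : vec n -> C) l i x : smooth f -> is_pd i (pds l f) x (pds (i :: l) f x).
Proof. by move=> /(_ l x) [_ /(_ i) /ex_isD]. Qed.

Lemma smooth_is_pd1 n (f : vec n -> C) i x : smooth f -> is_pd i f x (pd i f x).
Proof. exact: (@smooth_is_pd n f [::]). Qed.

Lemma smooth_cont n (f : vec n -> C) l x : smooth f -> continuous (pds l f) x.
Proof. by move=> /(_ l x) []. Qed.

Lemma smooth_locb n (f : vec n -> C) l : smooth f -> locb (pds l f).
Proof. by move=> h; apply: continuous_locb => x; apply: smooth_cont. Qed.

(** Continuity of a derivative comes from local boundedness of the derivatives of the next order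
    ([continuous_of_pd]), and these are again in the class. Used below for products, limits of
    series, slices, wave solutions and parameter integrals. *)
Lemma smooth_class n (P : (vec n -> C) -> Prop) :
  (forall f, P f -> locb f) ->
  (forall f i, P f -> exists2 g, P g & forall x, is_pd i f x (g x)) ->
  forall f, P f -> smooth f.
Proof.
move=> hb hpd f hf.
have hP l : P (pds l f).
  elim: l => [//|i l IH] /=; have [g hg h] := hpd _ i IH.
  suff -> : pd i (pds l f) = g by [].
  by apply: functional_extensionality => x; apply: is_pd_pd.
have hd l i x : is_pd i (pds l f) x (pds (i :: l) f x).
  by have [g _ h] := hpd _ i (hP l); rewrite /= (is_pd_pd (h x)).
move=> l x; split; last by move=> i; apply: isD_ex (hd l i x).
by apply: (@continuous_of_pd n _ (fun i => pds (i :: l) f)) => // i; apply: hb; exact: hP.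
Qed.

Lemma pds_pd n l i (f : vec n -> C) : pds l (pd i f) = pds (rcons l i) f.
Proof. by elim: l => //= j l ->. Qed.

Lemma smooth_pd n i (f : vec n -> C) : smooth f -> smooth (pd i f).
Proof. by move=> h l x; rewrite pds_pd; apply: h. Qed.

Lemma smooth_pds n l (f : vec n -> C) : smooth f -> smooth (pds l f).
Proof. by move=> h; elim: l => // i l; apply: smooth_pd. Qed.

Lemma locb_plus n (f g : vec n -> C) : locb f -> locb g -> locb (fun x => f x + g x)%C.
Proof.
move=> hf hg x; have [d [B [d0 hB]]] := hf x; have [e [D [e0 hD]]] := hg x.
exists (Rmin d e), (B + D); split; first exact: Rmin_pos.
move=> y hy; apply: Rle_trans (Cmod_triangle _ _) _; apply: Rplus_le_compat.
  by apply: hB; apply: near_vec_le hy; apply: Rmin_l.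
by apply: hD; apply: near_vec_le hy; apply: Rmin_r.
Qed.

Lemma locb_mult n (f g : vec n -> C) : locb f -> locb g -> locb (fun x => f x * g x)%C.
Proof.
move=> hf hg x; have [d [B [d0 hB]]] := hf x; have [e [D [e0 hD]]] := hg x.
exists (Rmin d e), (B * D); split; first exact: Rmin_pos.
move=> y hy; rewrite Cmod_mult; apply: Rmult_le_compat; try exact: Cmod_ge_0.
  by apply: hB; apply: near_vec_le hy; apply: Rmin_l.
by apply: hD; apply: near_vec_le hy; apply: Rmin_r.
Qed.

Lemma is_pd_plus n i (f g : vec n -> C) x l m : is_pd i f x l -> is_pd i g x m ->
  is_pd i (fun x => f x + g x)%C x (l + m)%C.
Proof. exact: isD_plus. Qed.

Lemma is_pd_mult n i (f g : vec n -> C) x l m : is_pd i f x l -> is_pd i g x m ->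
  is_pd i (fun x => f x * g x)%C x (l * g x + f x * m)%C.
Proof. by move=> h1 h2; have := isD_mult h1 h2; rewrite /is_pd upd_id. Qed.

(** Products alone are not closed under [pd]: Leibniz's rule leaves sums of products. *)
Inductive prod_class n : (vec n -> C) -> Prop :=
| prod_base f g : smooth f -> smooth g -> prod_class (fun x => f x * g x)%C
| prod_plus f g : prod_class f -> prod_class g -> prod_class (fun x => f x + g x)%C.

Lemma smooth_mult n (f g : vec n -> C) : smooth f -> smooth g -> smooth (fun x => f x * g x)%C.
Proof.
move=> hf hg; apply: (@smooth_class n (@prod_class n)); last exact: prod_base.
  move=> h; elim => [a b sa sb|a b _ ha _ hb]; last exact: locb_plus.
  by apply: locb_mult; [exact: (@smooth_locb n a [::]) | exact: (@smooth_locb n b [::])].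
move=> h i; elim => [a b sa sb|a b _ [a' ca ha] _ [b' cb hb]].
  exists (fun x => pd i a x * b x + a x * pd i b x)%C.
    by apply: prod_plus; apply: prod_base => //; apply: smooth_pd.
  by move=> x; apply: is_pd_mult; apply: smooth_is_pd1.
exists (fun x => a' x + b' x)%C; first exact: prod_plus.
by move=> x; apply: is_pd_plus.
Qed.

Lemma smooth_const n c : smooth (fun _ : vec n => c).
Proof.
apply: (@smooth_class n (fun f => exists c, f = fun _ => c)); last by exists c.
  by move=> f [d ->] x; exists 1, (Cmod d); split => [|_ _]; [lra | apply: Rle_refl].
move=> f i [d ->]; exists (fun _ => 0); first by exists 0.
by move=> x; apply: isD_const.
Qed.

Lemma smooth_plus n (f g : vec n -> C) : smooth f -> smooth g -> smooth (fun x => f x + g x)%C.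
Proof.
move=> hf hg; apply: (@smooth_class n (fun h => exists a b, [/\ smooth a, smooth b & h = fun x => a x + b x]%C)).
- by move=> h [a [b [ha hb ->]]]; apply: locb_plus; [exact: (@smooth_locb n a [::]) | exact: (@smooth_locb n b [::])].
- move=> h i [a [b [ha hb ->]]]; exists (fun x => pd i a x + pd i b x)%C.
    by exists (pd i a), (pd i b); split => //; apply: smooth_pd.
  by move=> x; apply: is_pd_plus; apply: smooth_is_pd1.
- by exists f, g.
Qed.

Lemma smooth_scal n c (f : vec n -> C) : smooth f -> smooth (fun x => c * f x)%C.
Proof. by move=> h; apply: smooth_mult => //; apply: smooth_const. Qed.

Lemma pd_plus n i (f g : vec n -> C) : smooth f -> smooth g ->
  pd i (fun x => f x + g x)%C = fun x => (pd i f x + pd i g x)%C.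
Proof.
by move=> hf hg; apply: functional_extensionality => x; apply: is_pd_pd; apply: is_pd_plus; apply: smooth_is_pd1.
Qed.

Lemma pd_scal n i c (f : vec n -> C) : smooth f -> pd i (fun x => c * f x)%C = fun x => (c * pd i f x)%C.
Proof.
by move=> hf; apply: functional_extensionality => x; apply: is_pd_pd; apply: isD_scal; apply: smooth_is_pd1.
Qed.

Lemma pds_plus n l (f g : vec n -> C) : smooth f -> smooth g ->
  pds l (fun x => f x + g x)%C = fun x => (pds l f x + pds l g x)%C.
Proof.
by move=> hf hg; elim: l => //= i l ->; rewrite pd_plus //; apply: smooth_pds.
Qed.

Lemma pds_scal n l c (f : vec n -> C) : smooth f -> pds l (fun x => c * f x)%C = fun x => (c * pds l f x)%C.
Proof. by move=> hf; elim: l => //= i l ->; rewrite pd_scal //; apply: smooth_pds. Qed.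

Lemma smooth_coord n (i : 'I_n) (h : nat -> R -> R) :
  (forall k x, is_derive (h k) x (h k.+1 x)) -> smooth (fun x : vec n => RtoC (h 0%N (x i))).
Proof.
(* The scalar [c] lets the zero derivatives in the other directions belong to the class. *)
move=> hh; apply: (@smooth_class n (fun f => exists k c, f = fun x => (c * RtoC (h k (x i)))%C)).
- move=> f [k [c ->]] x.
  have hc : continuous (h k) (x i) by apply: ex_derive_continuous; exists (h k.+1 (x i)); apply: hh.
  have [d hd] := hc _ (locally_ball (h k (x i)) (mkposreal _ Rlt_0_1)).
  exists d, (Cmod c * (Rabs (h k (x i)) + 1)); split; first exact: cond_pos.
  move=> y hy; rewrite Cmod_mult Cmod_R; apply: Rmult_le_compat_l; first exact: Cmod_ge_0.
  have h1 : Rabs (h k (y i) - h k (x i)) < 1 := hd (y i) (hy i).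
  have -> : h k (y i) = h k (x i) + (h k (y i) - h k (x i)) by ring.
  by apply: Rle_trans (Rabs_triang _ _) _; lra.
- move=> f j [k [c ->]]; case: (eqVneq i j) => [->|ne].
    exists (fun x => c * RtoC (h k.+1 (x j)))%C; first by exists k.+1, c.
    move=> x; apply: isD_scal.
    apply: (@isD_ext (fun s => RtoC (h k s))); first by move=> s; rewrite upd_same.
    exact: isD_RtoC.
  exists (fun x => 0 * RtoC (h k.+1 (x i)))%C; first by exists k.+1, 0.
  move=> x; have -> : (0 * RtoC (h k.+1 (x i)) = 0)%C by ring.
  apply: (@isD_ext (fun s => c * RtoC (h k (x i)))%C); last exact: isD_const.
  by move=> s; rewrite upd_neq.
- by exists 0%N, 1; apply: functional_extensionality => x; ring.
Qed.

(** * Bisection, supports and test functions *)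

Ltac rlra :=
  repeat (let v := fresh "v" in set v := (bigop _ _ _); clearbody v);
  repeat (let v := fresh "v" in set v := (INR _); clearbody v); intros; lra.

Lemma finite_bound n (w : 'I_n -> R) : exists W, 0 < W /\ forall j, w j <= W.
Proof.
suff [W [W0 hW]] : exists W, 0 < W /\ forall j, j \in enum 'I_n -> w j <= W.
  by exists W; split => // j; apply: hW; rewrite mem_enum.
elim: (enum 'I_n) => [|i s [W [W0 hW]]]; first by exists 1; split => //; lra.
exists (Rmax W (w i)); split; first exact: Rlt_le_trans W0 (Rmax_l _ _).
move=> j; rewrite inE => /orP [/eqP ->|/hW h]; first exact: Rmax_r.
exact: Rle_trans h (Rmax_l _ _).
Qed.

(** * Bisection of boxes *)

Section BoxInduction.
Variables (m : nat) (P : vec m -> vec m -> Prop).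

Let nested (lo hi lo' hi' : vec m) := forall j, lo j <= lo' j < hi' j /\ hi' j <= hi j.

Hypothesis P_split : forall lo hi i, (forall j, lo j < hi j) ->
  P lo (upd hi i (lo i + 2 / 3 * (hi i - lo i))) ->
  P (upd lo i (lo i + 1 / 3 * (hi i - lo i))) hi -> P lo hi.
Hypothesis P_local : forall x, exists2 d, 0 < d &
  forall lo hi, (forall j, x j - d < lo j < hi j /\ hi j < x j + d) -> P lo hi.

Let bad_step1 lo hi i : (forall j, lo j < hi j) -> ~ P lo hi ->
  exists lo' hi', [/\ nested lo hi lo' hi', ~ P lo' hi' & hi' i - lo' i <= 2 / 3 * (hi i - lo i)].
Proof.
move=> hlt nP; have hi0 := hlt i.
case: (classic (P lo (upd hi i (lo i + 2 / 3 * (hi i - lo i))))) => h1; last first.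
  exists lo, (upd hi i (lo i + 2 / 3 * (hi i - lo i))); split => //; last by rewrite upd_same; lra.
  move=> j; have := hlt j; rewrite /upd; case: eqP => [->|_]; lra.
exists (upd lo i (lo i + 1 / 3 * (hi i - lo i))), hi; split; last by rewrite upd_same; lra.
  move=> j; have := hlt j; rewrite /upd; case: eqP => [->|_]; lra.
by move=> h2; apply: nP; apply: P_split h1 h2.
Qed.

Let bad_step lo hi : (forall j, lo j < hi j) -> ~ P lo hi ->
  exists lo' hi', [/\ nested lo hi lo' hi', ~ P lo' hi' & forall j, hi' j - lo' j <= 2 / 3 * (hi j - lo j)].
Proof.
move=> hlt nP.
suff [lo' [hi' [h1 h2 h3]]] : exists lo' hi', [/\ nested lo hi lo' hi', ~ P lo' hi' &
    forall j, j \in enum 'I_m -> hi' j - lo' j <= 2 / 3 * (hi j - lo j)].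
  by exists lo', hi'; split => // j; apply: h3; rewrite mem_enum.
elim: (enum 'I_m) => [|i s [lo' [hi' [h1 h2 h3]]]].
  by exists lo, hi; split => // j; have := hlt j; lra.
have hlt' j : lo' j < hi' j by have := h1 j; lra.
have [lo2 [hi2 [k1 k2 k3]]] := @bad_step1 lo' hi' i hlt' h2.
exists lo2, hi2; split => //.
  by move=> j; have := h1 j; have := k1 j; lra.
move=> j; rewrite inE => /orP [/eqP ->|hj].
  by have := h1 i; lra.
by have := h3 j hj; have := k1 j; lra.
Qed.

(** If [P] failed on a box, it would fail on one of two overlapping pieces, cut in each coordinate
    in turn; the resulting nested boxes shrink to a point, where [P_local] gives a contradiction.
    The pieces have two thirds of the side, instead of one half, so that a smooth cutoff has room to
    vary in their intersection. *)
Lemma box_ind lo hi : (forall j, lo j < hi j) -> P lo hi.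
Proof.
move=> hlt; case: (classic (P lo hi)) => // nP; exfalso.
pose T := {b : vec m * vec m | (forall j, b.1 j < b.2 j) /\ ~ P b.1 b.2}.
have step (b : T) : {c : T | nested (sval b).1 (sval b).2 (sval c).1 (sval c).2 /\
    forall j, (sval c).2 j - (sval c).1 j <= 2 / 3 * ((sval b).2 j - (sval b).1 j)}.
  apply: constructive_indefinite_description.
  case: b => [[l h] [h1 h2]] /=.
  have [l' [h' [k1 k2 k3]]] := bad_step h1 h2.
  have hb : (forall j, (l', h').1 j < (l', h').2 j) /\ ~ P (l', h').1 (l', h').2.
    by split => //= j; have := k1 j; lra.
  by exists (exist _ (l', h') hb).
have b0 : (forall j, (lo, hi).1 j < (lo, hi).2 j) /\ ~ P (lo, hi).1 (lo, hi).2 by [].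
pose b := fix b k := if k is k'.+1 then sval (step (b k')) else exist _ (lo, hi) b0 : T.
pose l k := (sval (b k)).1; pose h k := (sval (b k)).2.
have hS k : nested (l k) (h k) (l k.+1) (h k.+1) /\
    forall j, h k.+1 j - l k.+1 j <= 2 / 3 * (h k j - l k j).
  by rewrite /l /h /=; case: (step (b k)).
have hlk k j : l k j < h k j by rewrite /l /h; case: (b k) => c [].
have hmono k d j : l k j <= l (d + k)%N j /\ h (d + k)%N j <= h k j.
  elim: d => [|d IH]; first by rewrite add0n; lra.
  by rewrite addSn; have := (hS (d + k)%N).1 j; lra.
have hlh k k' j : l k j <= h k' j.
  have := hmono k k' j; have := hmono k' k j; rewrite addnC.
  by have := hlk (k' + k)%N j; lra.
(* The common point of the nested boxes: in each coordinate, the supremum of the lower corners. *)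
have hsup j : {x | is_lub (fun y => exists k, y = l k j) x}.
  apply: completeness; last by exists (l 0%N j), 0%N.
  by exists (h 0%N j) => y [k ->].
pose x : vec m := fun j => sval (hsup j).
have hx k j : l k j <= x j <= h k j.
  rewrite /x; case: (hsup j) => y [h1 h2] /=; split; first by apply: h1; exists k.
  by apply: h2 => z [k' ->].
have [d d0 hd] := P_local x.
have [W [W0 hW]] := finite_bound (fun j => hi j - lo j).
have hside k j : h k j - l k j <= (2 / 3) ^ k * W.
  elim: k => [|k IH]; first by rewrite /= Rmult_1_l; exact: hW.
  have := (hS k).2 j; rewrite [_ ^ k.+1]/=; lra.
have [N hN] := pow_lt_1_zero (2 / 3) ltac:(rewrite Rabs_pos_eq; lra) (d / W) ltac:(apply: Rdiv_lt_0_compat; lra).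
have hN' : (2 / 3) ^ N * W < d.
  have := hN N (PeanoNat.Nat.le_refl N); rewrite Rabs_pos_eq; last by apply: pow_le; lra.
  move=> /(Rmult_lt_compat_r W _ _ W0).
  by rewrite /Rdiv Rmult_assoc Rinv_l ?Rmult_1_r; lra.
have : P (l N) (h N).
  by apply: hd => j; have := hx N j; have := hside N j; have := hlk N j; lra.
by rewrite /l /h; case: (b N) => c [].
Qed.
End BoxInduction.

(** Compactness of a cube by bisection, boundedness being inherited from two covering pieces. *)
Lemma locb_bounded n (f : vec n -> C) : locb f ->
  forall r, exists B, forall x, (forall i, Rabs (x i) <= r) -> Cmod (f x) <= B.
Proof.
move=> hb r.
(* Half-side [Rabs r + 1] makes the box nondegenerate for every [r]. *)
have [B hB] : exists B, forall x : vec n, (forall j, - (Rabs r + 1) <= x j <= Rabs r + 1) -> Cmod (f x) <= B.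
  apply: (@box_ind n (fun lo hi => exists B, forall x, (forall j, lo j <= x j <= hi j) -> Cmod (f x) <= B)
    _ _ (fun _ => - (Rabs r + 1)) (fun _ => Rabs r + 1)) => [lo hi i hlt [B1 h1] [B2 h2]|x|j].
  - exists (Rmax B1 B2) => x hx; case: (Rle_dec (x i) (lo i + 2 / 3 * (hi i - lo i))) => hi1.
      apply: Rle_trans (Rmax_l _ _); apply: h1 => j; have := hx j; rewrite /upd.
      by case: eqP => [->|_]; lra.
    apply: Rle_trans (Rmax_r _ _); apply: h2 => j; have := hx j; have := hlt i; rewrite /upd.
    by case: eqP => [->|_]; lra.
  - have [d [B [d0 hd]]] := hb x; exists d => // lo hi hlh; exists B => y hy; apply: hd => j.
    by apply: Rabs_def1; have := hlh j; have := hy j; lra.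
  - by have := Rabs_pos r; lra.
exists B => x hx; apply: hB => j; have := hx j; have := Rle_abs r.
by move=> h1 h2; have := Rabs_le_between (x j) r; lra.
Qed.

Lemma enorm_ge n (x : vec n) i : Rabs (x i) <= enorm x.
Proof.
rewrite /enorm -sqrt_Rsqr_abs; apply: sqrt_le_1_alt.
rewrite /Rsqr.
have hs (s : seq 'I_n) : 0 <= \big[Rplus/0]_(j <- s) x j ^ 2.
  by elim: s => [|j s IH]; rewrite ?big_nil ?big_cons; [lra | have := pow2_ge_0 (x j); lra].
have : i \in index_enum 'I_n by rewrite mem_index_enum.
elim: (index_enum 'I_n) => [//|j s IH]; rewrite inE big_cons => /orP [/eqP <-|/IH].
  by have := hs s; rewrite /=; lra.
by have := pow2_ge_0 (x j); rlra.
Qed.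

Lemma sum_sq_le n (x : vec n) r : (forall i, Rabs (x i) <= r) ->
  \big[Rplus/0]_(i < n) (x i) ^ 2 <= INR n * r ^ 2.
Proof.
move=> h.
have : \big[Rplus/0]_(i < n) (x i) ^ 2 <= INR (size (index_enum 'I_n)) * r ^ 2.
  elim: (index_enum 'I_n) => [|j s IH]; first by rewrite big_nil /=; lra.
  rewrite big_cons [size _]/= S_INR.
  have : x j ^ 2 <= r ^ 2 by rewrite -pow2_abs; apply: pow_incr; split; [exact: Rabs_pos | exact: h].
  by move: IH; rlra.
by rewrite /index_enum -enumT -cardT card_ord.
Qed.

Lemma enorm_le n (x : vec n) r : (forall i, Rabs (x i) <= r) -> enorm x <= INR n * Rabs r.
Proof.
move=> h; rewrite /enorm.
have hn := pos_INR n; have hr := Rabs_pos r.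
apply: Rle_trans (sqrt_le_1_alt _ _ (sum_sq_le h)) _.
rewrite -[X in _ <= X]sqrt_Rsqr; last by nra.
apply: sqrt_le_1_alt; rewrite /Rsqr -pow2_abs.
case: n {x h} hn => [|n] hn; first by rewrite /=; lra.
have : 1 <= INR n.+1 by rewrite S_INR; have := pos_INR n; lra.
move: (INR n.+1) (Rabs r) hr => a b b0 a1; have : 0 <= a * b * b * (a - 1) by apply: Rmult_le_pos; [apply: Rmult_le_pos; nra | lra].
by rewrite /=; lra.
Qed.

Lemma enorm_ge0 n (x : vec n) : 0 <= enorm x.
Proof. exact: sqrt_pos. Qed.

Lemma continuous_sum_sq n (x : vec n) eps : 0 < eps ->
  exists2 d, 0 < d & forall y, near_vec x d y ->
    Rabs (\big[Rplus/0]_(i < n) (y i) ^ 2 - \big[Rplus/0]_(i < n) (x i) ^ 2) < eps.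
Proof.
elim: (index_enum 'I_n) eps => [|j s IH] eps e0.
  by exists 1; [lra | move=> y _; rewrite !big_nil Rminus_diag Rabs_R0].
have [d d0 hd] := IH (eps / 2) ltac:(lra).
have xj := Rabs_pos (x j).
pose e := Rmin 1 (eps / (4 * (Rabs (x j) + 1))).
have e1 : 0 < e by apply: Rmin_pos; [lra | apply: Rdiv_lt_0_compat; lra].
exists (Rmin d e); first exact: Rmin_pos.
move=> y hy; rewrite !big_cons.
have h1 := hd y (near_vec_le (Rmin_l _ _) hy).
have h2 : Rabs (y j - x j) < e by apply: Rlt_le_trans (hy j) (Rmin_r _ _).
have h3 : Rabs (y j ^ 2 - x j ^ 2) <= eps / 2.
  have -> : y j ^ 2 - x j ^ 2 = (y j - x j) * (2 * x j + (y j - x j)) by ring.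
  rewrite Rabs_mult.
  have h4 : Rabs (2 * x j + (y j - x j)) <= 2 * (Rabs (x j) + 1).
    apply: Rle_trans (Rabs_triang _ _) _; rewrite Rabs_mult (Rabs_pos_eq 2); last by lra.
    by have := Rmin_l 1 (eps / (4 * (Rabs (x j) + 1))); rewrite -/e; lra.
  apply: Rle_trans (_ : e * (2 * (Rabs (x j) + 1)) <= _).
    by apply: Rmult_le_compat; try exact: Rabs_pos; lra.
  have h5 := Rmin_r 1 (eps / (4 * (Rabs (x j) + 1))); rewrite -/e in h5.
  apply: Rle_trans (_ : eps / (4 * (Rabs (x j) + 1)) * (2 * (Rabs (x j) + 1)) <= _).
    by apply: Rmult_le_compat_r; lra.
  by apply: Req_le; field; lra.
set a := \big[Rplus/0]_(_ <- s) _ in h1 *; set b := \big[Rplus/0]_(_ <- s) _ in h1 *.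
have -> : y j ^ 2 + a - (x j ^ 2 + b) = (y j ^ 2 - x j ^ 2) + (a - b) by ring.
by apply: Rle_lt_trans (Rabs_triang _ _) _; lra.
Qed.

Lemma enorm_gt_open n (x : vec n) r : r < enorm x ->
  exists2 d, 0 < d & forall y, near_vec x d y -> r < enorm y.
Proof.
move=> h; case: (Rle_dec 0 r) => r0; last first.
  by exists 1; [lra | move=> y _; have := enorm_ge0 y; lra].
have h1 : r ^ 2 < \big[Rplus/0]_(i < n) (x i) ^ 2.
  apply: Rnot_le_lt => hle; have := sqrt_le_1_alt _ _ hle; rewrite sqrt_pow2 //.
  by move: h; rewrite /enorm; lra.
have [d d0 hd] := @continuous_sum_sq n x (\big[Rplus/0]_(i < n) (x i) ^ 2 - r ^ 2) ltac:(lra).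
exists d => // y /hd /Rabs_def2 hy.
rewrite -(sqrt_pow2 r) // /enorm; apply: sqrt_lt_1_alt; split; first by nra.
by move: hy; rlra.
Qed.

(** The working form of [supported_in_ball]: the complement of the closed ball is open, so vanishing
    there already keeps the closure of the nonzero set inside ([supp_ballE]). *)
Definition zero_out n (A : R) (f : vec n -> C) : Prop := forall x, A < enorm x -> f x = 0.

Lemma supp_ballE n A (f : vec n -> C) : supported_in_ball A f <-> zero_out A f.
Proof.
split=> h x.
  move=> hx; apply: NNPP => nz.
  have : enorm x <= A by apply: h => eps; exists x; split => //; apply: ball_center.
  by lra.
move=> hs; apply: Rnot_lt_le => /enorm_gt_open [d d0 hd].
have [y [hy nz]] := hs (mkposreal _ d0).
by apply: nz; apply: h; apply: hd => i; apply: hy.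
Qed.

Lemma support_zero n (f : vec n -> C) x d : 0 < d -> (forall y, near_vec x d y -> f y = 0) -> ~ Defs.support f x.
Proof.
by move=> d0 h hs; have [y [hy nz]] := hs (mkposreal _ d0); apply: nz; apply: h => i; apply: hy.
Qed.

Lemma not_support n (f : vec n -> C) x : ~ Defs.support f x ->
  exists2 d, 0 < d & forall y, near_vec x d y -> f y = 0.
Proof.
move=> /not_all_ex_not [eps h]; exists eps; first exact: cond_pos.
by move=> y hy; apply: NNPP => nz; apply: h; exists y; split => // i; apply: hy.
Qed.

Lemma pd_near n i (f g : vec n -> C) x d : 0 < d -> (forall y, near_vec x d y -> f y = g y) ->
  pd i f x = pd i g x.
Proof.
move=> d0 h; rewrite /pd /derivC.
have hl : locally (x i) (fun s => f (upd x i s) = g (upd x i s)).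
  by exists (mkposreal _ d0) => s hs; apply: h; apply: near_vec_upd => //; apply: near_vec_refl.
by congr (_, _); apply: Derive_ext_loc; apply: filter_imp hl => s ->.
Qed.

Lemma near_vec_shrink n (x y z : vec n) d : near_vec x (d / 2) y -> near_vec y (d / 2) z -> near_vec x d z.
Proof.
move=> h1 h2 i; have := h1 i; have := h2 i => a b.
have -> : z i - x i = (z i - y i) + (y i - x i) by ring.
by apply: Rle_lt_trans (Rabs_triang _ _) _; lra.
Qed.

Lemma pds_near n l (f g : vec n -> C) x d : 0 < d -> (forall y, near_vec x d y -> f y = g y) ->
  pds l f x = pds l g x.
Proof.
elim: l x d => [|i l IH] x d d0 h; first by apply: h; apply: near_vec_refl.
apply: (@pd_near n i _ _ x (d / 2)) => [|y hy]; first lra.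
apply: (IH y (d / 2)) => [|z hz]; first lra.
by apply: h; apply: near_vec_shrink hy hz.
Qed.

Lemma pds_0 n l : pds l (fun _ : vec n => RtoC 0) = fun _ => RtoC 0.
Proof.
by elim: l => //= i l ->; apply: functional_extensionality => x; apply: isD_derivC; apply: isD_const.
Qed.

Lemma pds_near0 n l (f : vec n -> C) x d : 0 < d -> (forall y, near_vec x d y -> f y = 0) -> pds l f x = 0.
Proof. by move=> d0 h; rewrite (@pds_near n l f (fun _ => RtoC 0) x d) // pds_0. Qed.

Lemma zero_out_pds n A l (f : vec n -> C) : zero_out A f -> zero_out A (pds l f).
Proof.
move=> h x /enorm_gt_open [d d0 hd]; apply: (@pds_near0 n l f x d) => // y /hd; exact: h.
Qed.

Definition testA n (A : R) (f : vec n -> C) : Prop := smooth f /\ zero_out A f.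

Lemma testA_test n A (f : vec n -> C) : testA A f -> test_fun f.
Proof. by case=> h1 /supp_ballE h2; split => //; exists A. Qed.

Lemma test_testA n (f : vec n -> C) : test_fun f -> exists2 A, 0 <= A & testA A f.
Proof.
case=> h1 [A /supp_ballE h2]; exists (Rmax 0 A); first exact: Rmax_l.
by split => // x hx; apply: h2; apply: Rle_lt_trans (Rmax_r 0 A) hx.
Qed.

Lemma testA_pds n A l (f : vec n -> C) : testA A f -> testA A (pds l f).
Proof. by case=> h1 h2; split; [exact: smooth_pds | exact: zero_out_pds]. Qed.

Lemma testA_plus n A (f g : vec n -> C) : testA A f -> testA A g -> testA A (fun x => f x + g x)%C.
Proof.
case=> h1 h2 [h3 h4]; split; first exact: smooth_plus.
by move=> x hx; rewrite h2 // h4 //; ring.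
Qed.

Lemma testA_scal n A c (f : vec n -> C) : testA A f -> testA A (fun x => c * f x)%C.
Proof.
case=> h1 h2; split; first exact: smooth_scal.
by move=> x hx; rewrite h2 //; ring.
Qed.

Lemma testA_le n A B (f : vec n -> C) : A <= B -> testA A f -> testA B f.
Proof. by move=> h [h1 h2]; split => // x hx; apply: h2; lra. Qed.

Lemma testA_bounded n A (f : vec n -> C) : testA A f -> exists2 B, 0 <= B & forall x, Cmod (f x) <= B.
Proof.
case=> h1 h2; have [B hB] := locb_bounded (@smooth_locb n f [::] h1) A.
exists (Rmax 0 B); first exact: Rmax_l.
move=> x; case: (Rle_dec (enorm x) A) => hx.
  apply: Rle_trans (Rmax_r _ _); apply: hB => i; exact: Rle_trans (enorm_ge x i) hx.
by rewrite h2; [rewrite Cmod_0; exact: Rmax_l | lra].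
Qed.

(** The [C^N] seminorm bound that occurs in [distribution]. *)
Definition pbd n (N : nat) (B : R) (f : vec n -> C) : Prop :=
  forall l : seq 'I_n, (size l <= N)%N -> forall x, Cmod (pds l f x) <= B.

Lemma pbd_exists n A N (f : vec n -> C) : testA A f -> exists2 B, 0 <= B & pbd N B f.
Proof.
move=> hf.
suff H k : exists2 B, 0 <= B & forall l : k.-tuple 'I_n, forall x, Cmod (pds l f x) <= B.
  elim: N => [|N [B B0 hB]].
    have [B B0 hB] := H 0%N; exists B => // l; rewrite leqn0 => /eqP h0 x.
    exact: (hB (@Tuple _ _ l (introT eqP h0))).
  have [D D0 hD] := H N.+1; exists (B + D); first lra.
  move=> l; rewrite leq_eqVlt => /orP [h0|h0] x.
    by have := hD (@Tuple _ _ l h0) x; rewrite /=; lra.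
  by have := hB l h0 x; lra.
suff [B B0 hB] : exists2 B, 0 <= B & forall l : k.-tuple 'I_n, l \in enum {: k.-tuple 'I_n} ->
    forall x, Cmod (pds l f x) <= B.
  by exists B => // l; apply: hB; rewrite mem_enum.
elim: (enum _) => [|l s [B B0 hB]]; first by exists 0; [lra | ].
have [D D0 hD] := testA_bounded (testA_pds l hf).
exists (B + D); first lra.
move=> l'; rewrite inE => /orP [/eqP ->|h0] x; first by apply: Rle_trans (hD x) _; lra.
by apply: Rle_trans (hB l' h0 x) _; lra.
Qed.

Lemma continuity_2d_upd n (f : vec n -> C) x (i j : 'I_n) u v : continuous f (upd (upd x i u) j v) ->
  continuity_2d_pt (fun u v => Re (f (upd (upd x i u) j v))) u v /\
  continuity_2d_pt (fun u v => Im (f (upd (upd x i u) j v))) u v.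
Proof.
move=> /continuousC_P hc.
have H eps : 0 < eps -> exists2 d, 0 < d & forall s t, Rabs (s - u) < d -> Rabs (t - v) < d ->
    Cmod (f (upd (upd x i s) j t) - f (upd (upd x i u) j v))%C < eps.
  move=> /hc [d d0 hd]; exists d => // s t hs ht; apply: hd => k; rewrite /upd.
  by case: eqP => // _; case: eqP => // _; rewrite Rminus_diag Rabs_R0.
by split => eps; have [d d0 hd] := H eps (cond_pos eps); exists (mkposreal _ d0) => s t hs ht;
  apply: Rle_lt_trans (hd s t hs ht); [exact: (Re_le_Cmod (_ - _)) | exact: (Im_le_Cmod (_ - _))].
Qed.

(** Schwarz's theorem in the coordinate plane through [x]; in the proof [p] stands for the real or
    the imaginary part. *)
Lemma pd_comm n (i j : 'I_n) (f : vec n -> C) : smooth f -> pd i (pd j f) = pd j (pd i f).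
Proof.
move=> hf; case: (eqVneq i j) => [->//|ij]; apply: functional_extensionality => x.
have ji : j != i by rewrite eq_sym.
pose X u v := upd (upd x i u) j v.
have Dj (g : vec n -> C) u v : smooth g -> isD (fun z => g (X u z)) v (pd j g (X u v)).
  by move=> hg; apply: is_pd_line => y; apply: smooth_is_pd1.
have Di (g : vec n -> C) u v : smooth g -> isD (fun z => g (X z v)) u (pd i g (X u v)).
  move=> hg; apply: (@isD_ext (fun z => g (upd (upd x j v) i z))).
    by move=> s; rewrite /X upd_comm.
  by rewrite /X upd_comm //; apply: is_pd_line => y; apply: smooth_is_pd1.
have hX : X (x i) (x j) = x by rewrite /X upd_id upd_id.
have si := smooth_pd i hf; have sj := smooth_pd j hf.
have cc (g : vec n -> C) : smooth g -> forall y, continuous g y.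
  by move=> hg y; apply: (@smooth_cont n g [::]).
have H (p : C -> R) : (forall g z l, isD g z l -> is_derive (fun s => p (g s)) z (p l)) ->
    (forall (g : vec n -> C) u v, continuous g (X u v) -> continuity_2d_pt (fun u v => p (g (X u v))) u v) ->
    p (pd i (pd j f) x) = p (pd j (pd i f) x).
  move=> hD hC; pose F u v := p (f (X u v)).
  have e1 u v : Derive (fun z => F u z) v = p (pd j f (X u v)) by apply: is_derive_unique; apply: hD (Dj f u v hf).
  have e2 u v : Derive (fun z => F z v) u = p (pd i f (X u v)).
    by apply: is_derive_unique; exact: (hD (fun z => f (X z v)) _ _ (Di f u v hf)).
  have d3 u v : is_derive (fun z => p (pd j f (X z v))) u (p (pd i (pd j f) (X u v))).
    exact: (hD (fun z => pd j f (X z v)) _ _ (Di _ u v sj)).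
  have d4 u v : is_derive (fun z => p (pd i f (X u z))) v (p (pd j (pd i f) (X u v))) by apply: hD (Dj _ u v si).
  have e3 u v : Derive (fun z => Derive (fun t => F z t) v) u = p (pd i (pd j f) (X u v)).
    by rewrite (Derive_ext _ _ _ (fun z => e1 z v)); exact: is_derive_unique.
  have e4 u v : Derive (fun z => Derive (fun t => F t z) u) v = p (pd j (pd i f) (X u v)).
    by rewrite (Derive_ext _ _ _ (fun z => e2 u z)); exact: is_derive_unique.
  have := @Schwarz F (x i) (x j); rewrite e3 e4 hX; apply.
  - exists (mkposreal _ Rlt_0_1) => u v _ _; split.
      by eexists; exact: (hD (fun z => f (X z v)) _ _ (Di f u v hf)).
    split; first by eexists; apply: hD (Dj f u v hf).
    split.
      by apply: (ex_derive_ext _ _ _ (fun z => esym (e1 z v))); eexists; exact: d3.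
    by apply: (ex_derive_ext _ _ _ (fun z => esym (e2 u z))); eexists; exact: d4.
  - apply: (continuity_2d_pt_ext (fun u v => p (pd i (pd j f) (X u v)))) => [u v|]; first by rewrite e3.
    by apply: hC; apply: cc; exact: smooth_pd.
  - apply: (continuity_2d_pt_ext (fun u v => p (pd j (pd i f) (X u v)))) => [u v|]; first by rewrite e4.
    by apply: hC; apply: cc; exact: smooth_pd.
by apply: C_eq; apply: H => [g z l []|g u v /continuity_2d_upd []].
Qed.

Lemma pds_pd_comm n l i (f : vec n -> C) : smooth f -> pds l (pd i f) = pd i (pds l f).
Proof. by move=> hf; elim: l => //= j l ->; rewrite pd_comm //; apply: smooth_pds. Qed.

(** * Uniform boundedness for distributions *)

Lemma half_pow_pos k : 0 < (1 / 2) ^ k.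
Proof. by apply: pow_lt; lra. Qed.

Lemma half_powS k : (1 / 2) ^ k.+1 = (1 / 2) ^ k / 2.
Proof. by rewrite /=; field. Qed.

Lemma half_pow_small eps : 0 < eps -> exists N, forall k, (N <= k)%N -> (1 / 2) ^ k < eps.
Proof.
move=> e0; have [N hN] := pow_lt_1_zero (1 / 2) ltac:(rewrite Rabs_pos_eq; lra) eps e0.
by exists N => k /leP /hN; rewrite Rabs_pos_eq //; apply: Rlt_le; apply: half_pow_pos.
Qed.

Lemma le_of_half_pow a b c N : (forall k, (N <= k)%N -> a <= b + c * (1 / 2) ^ k) -> a <= b.
Proof.
move=> h; apply: Rnot_lt_le => ab.
have c0 : 0 < Rabs c + 1 by have := Rabs_pos c; lra.
have [N' hN'] := @half_pow_small ((a - b) / (Rabs c + 1)) ltac:(apply: Rdiv_lt_0_compat; lra).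
have := hN' _ (leq_maxr N N'); have := h _ (leq_maxl N N'); set p := (1 / 2) ^ _ => h1 h2.
have p0 : 0 < p by apply: half_pow_pos.
have : p * (Rabs c + 1) < a - b.
  have := Rmult_lt_compat_r _ _ _ c0 h2.
  by rewrite /Rdiv Rmult_assoc Rinv_l ?Rmult_1_r; lra.
have := Rle_abs c; nra.
Qed.

Lemma telescope_half (u : nat -> C) N :
  (forall k, (N <= k)%N -> Cmod (u k.+1 - u k)%C <= (1 / 2) ^ k) ->
  forall k m, (N <= k)%N -> (k <= m)%N -> Cmod (u m - u k)%C <= 2 * (1 / 2) ^ k.
Proof.
move=> h k m Nk km.
suff H d : Cmod (u (d + k)%N - u k)%C <= 2 * (1 / 2) ^ k - 2 * (1 / 2) ^ (d + k)%N.
  by rewrite -(subnK km); have := H (m - k)%N; have := half_pow_pos (m - k + k)%N; lra.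
elim: d => [|d IH].
  by rewrite add0n (_ : u k - u k = 0)%C; [rewrite Cmod_0; lra | ring].
rewrite addSn half_powS.
have -> : (u (d + k).+1%N - u k = (u (d + k).+1%N - u (d + k)%N) + (u (d + k)%N - u k))%C by ring.
apply: Rle_trans (Cmod_triangle _ _) _.
have := h (d + k)%N (leq_trans Nk (leq_addl _ _)); lra.
Qed.

Lemma Cmod_sym (a b : C) : Cmod (a - b)%C = Cmod (b - a)%C.
Proof. by rewrite -Cmod_opp; congr Cmod; ring. Qed.

Lemma Cmod_sub_le (a b : C) : Cmod a <= Cmod b + Cmod (a - b)%C.
Proof. by have := Cmod_triangle b (a - b)%C; rewrite (_ : b + (a - b) = a)%C //; ring. Qed.

Lemma lim_half (u : nat -> C) N :
  (forall k m, (N <= k)%N -> (k <= m)%N -> Cmod (u m - u k)%C <= 2 * (1 / 2) ^ k) ->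
  exists L, forall k, (N <= k)%N -> Cmod (u k - L)%C <= 2 * (1 / 2) ^ k.
Proof.
move=> h.
have H (p : C -> R) : (forall a b, Rabs (p a - p b) <= Cmod (a - b)%C) ->
    exists l : R, is_lim_seq (fun k => p (u k)) l.
  move=> hp; apply: (ex_lim_seq_cauchy_corr _).2 => eps.
  have [M hM] := @half_pow_small (eps / 4) ltac:(have := cond_pos eps; lra).
  exists (maxn N M) => k m /leP hk /leP hm.
  have hN : (N <= maxn N M)%N := leq_maxl _ _.
  apply: Rle_lt_trans (hp _ _) _.
  have -> : (u k - u m = (u k - u (maxn N M)) + (u (maxn N M) - u m))%C by ring.
  apply: Rle_lt_trans (Cmod_triangle _ _) _.
  have := h _ _ hN hk; have := h _ _ hN hm; rewrite (Cmod_sym (u m)).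
  by have := hM _ (leq_maxr N M); have := cond_pos eps; lra.
have [a ha] : exists l : R, is_lim_seq (fun k => Re (u k)) l.
  by apply: H => x y; apply: (Re_le_Cmod (x - y)).
have [b hb] : exists l : R, is_lim_seq (fun k => Im (u k)) l.
  by apply: H => x y; apply: (Im_le_Cmod (x - y)).
exists (a, b) => k hk; apply: Rnot_lt_le => hlt.
pose D := Cmod (u k - (a, b))%C - 2 * (1 / 2) ^ k; have D0 : 0 < D by rewrite /D; lra.
have D2 : 0 < D / 2 by lra.
have [N1 h1] := (is_lim_seq_spec _ _).2 ha (mkposreal _ D2).
have [N2 h2] := (is_lim_seq_spec _ _).2 hb (mkposreal _ D2).
pose m := maxn k (maxn N1 N2).
have := h1 m ltac:(apply/leP; rewrite /m; apply: leq_trans (leq_maxr _ _); exact: leq_maxl).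
have := h2 m ltac:(apply/leP; rewrite /m; apply: leq_trans (leq_maxr _ _); exact: leq_maxr).
move=> /= k2 k1.
have k3 : Cmod (u m - (a, b))%C < D.
  by apply: Rle_lt_trans (Cmod_le_ReIm _) _; have e1 : Re (u m - (a, b))%C = Re (u m) - a by [];
  have e2 : Im (u m - (a, b))%C = Im (u m) - b by []; rewrite e1 e2; lra.
have := h k m hk (leq_maxl _ _).
have := Cmod_triangle (u k - u m)%C (u m - (a, b))%C.
rewrite (_ : (u k - u m + (u m - (a, b)) = u k - (a, b))%C); last by ring.
by rewrite (Cmod_sym (u k) (u m)); rewrite /D in k3; lra.
Qed.

(** * Series of test functions in a fixed ball *)

Fixpoint psum n (f : nat -> vec n -> C) k : vec n -> C :=
  if k is k'.+1 then fun x => (psum f k' x + f k' x)%C else fun _ => RtoC 0.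

Lemma testA_0 n A : testA A (fun _ : vec n => RtoC 0).
Proof. by split => //; apply: smooth_const. Qed.

Lemma testA_psum n A (f : nat -> vec n -> C) k : (forall k, testA A (f k)) -> testA A (psum f k).
Proof. by move=> h; elim: k => [|k IH]; [exact: testA_0 | exact: testA_plus]. Qed.

Section SeriesOfTestFunctions.
Variables (n : nat) (A : R) (f : nat -> vec n -> C).
Hypothesis ft : forall k, testA A (f k).
Hypothesis fb : forall k, pbd k ((1 / 2) ^ k) (f k).

Let S := psum f.
Let Ssm k : smooth (S k) := proj1 (testA_psum k ft).

Let Slim l x : exists L, forall k, (size l <= k)%N -> Cmod (pds l (S k) x - L)%C <= 2 * (1 / 2) ^ k.
Proof.
apply: lim_half; apply: telescope_half => k hk.
rewrite /S /= pds_plus; [|exact: Ssm|exact: (ft k).1].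
have -> : (pds l (psum f k) x + pds l (f k) x - pds l (psum f k) x = pds l (f k) x)%C by ring.
exact: fb.
Qed.

(** One limit for each derivative [l], chosen independently; [Gpd] shows that they are derivatives
    of one another. *)
Let G l x : C := proj1_sig (constructive_indefinite_description _ (Slim l x)).

Let Gb l x k : (size l <= k)%N -> Cmod (pds l (S k) x - G l x)%C <= 2 * (1 / 2) ^ k.
Proof. by rewrite /G; case: constructive_indefinite_description => L /=; apply. Qed.

(** The Taylor bound for the partial sums is uniform in [k], so it passes to the limit with an error
    that decays like [(1 / 2) ^ k]. *)
Let Gpd i l x : is_pd i (G l) x (G (i :: l) x).
Proof.
pose N := (size l).+2.
have [d [B [d0 hB]]] := @smooth_locb n _ [:: i, i & l] (Ssm N) x.
(* Second derivatives of the sums with index at least [N] exceed the bound [B] for index [N] by at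
   most 4, both sums being within 2 of the limit; the outer 2 is that of [taylor_quadC]. *)
apply: (@isD_quad _ (x i) _ (2 * (B + 4)) d d0) => h hh.
have near s : Rabs (s - x i) < d -> near_vec x d (upd x i s).
  by move=> hs; apply: near_vec_upd => //; apply: near_vec_refl.
apply: (@le_of_half_pow _ _ (2 + 2 + Rabs h * 2) N) => k hk.
have hk2 : (size l <= k)%N by apply: leq_trans hk; rewrite /N; do 2 apply: leqW.
have hk1 : (size (i :: l) <= k)%N by apply: leq_trans hk.
have := @taylor_quadC (fun s => pds l (S k) (upd x i s)) (fun s => pds (i :: l) (S k) (upd x i s))
   (fun s => pds [:: i, i & l] (S k) (upd x i s)) (x i) d (B + 4).
move=> /(_ (fun s _ => is_pd_line x s (fun y => smooth_is_pd l i y (Ssm k)))).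
move=> /(_ (fun s _ => is_pd_line x s (fun y => smooth_is_pd (i :: l) i y (Ssm k)))) hT.
have {hT} : Cmod (pds l (S k) (upd x i (Rplus (x i) h)) - pds l (S k) x
     - RtoC h * pds (i :: l) (S k) x)%C <= 2 * (B + 4) * h ^ 2.
  move: hT; rewrite !upd_id; apply => // s /near hs.
  have h1 := hB _ hs.
  have h2 := @Gb [:: i, i & l] (upd x i s) N (leqnn _).
  have h3 := @Gb [:: i, i & l] (upd x i s) k hk.
  have h4 : forall j, (1 / 2) ^ j <= 1.
    by elim=> [|j IH]; [rewrite /=; lra | rewrite half_powS; have := half_pow_pos j; lra].
  have := Cmod_sub_le (pds [:: i, i & l] (S k) (upd x i s)) (G [:: i, i & l] (upd x i s)).
  have := Cmod_sub_le (G [:: i, i & l] (upd x i s)) (pds [:: i, i & l] (S N) (upd x i s)).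
  rewrite (Cmod_sym (G _ _)); have := h4 k; have := h4 N; lra.
have e1 := @Gb l (upd x i (Rplus (x i) h)) k hk2.
have e2 := @Gb l x k hk2.
have e3 := @Gb (i :: l) x k hk1.
rewrite upd_id; move: e1 e2 e3.
set a := pds l _ _; set b := pds l _ _; set c := pds (i :: l) _ _.
set a' := G l _; set b' := G l _; set c' := G (i :: l) _ => e1 e2 e3 h1.
have -> : (a' - b' - RtoC h * c' = (a - b - RtoC h * c) + ((a' - a) + ((b - b') + RtoC h * (c - c'))))%C by ring.
apply: Rle_trans (Cmod_triangle _ _) _; apply: Rplus_le_compat h1 _.
apply: Rle_trans (Cmod_triangle _ _) _; rewrite (Cmod_sym a').
have := Cmod_triangle (b - b')%C (RtoC h * (c - c'))%C; rewrite Cmod_mult Cmod_R.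
have := Rmult_le_compat_l _ _ _ (Rabs_pos h) e3; lra.
Qed.

(** Completeness of the test functions supported in a fixed ball. The term of index [k] is
    controlled only in its derivatives of order at most [k], hence the restriction [size l <= k]. *)
Lemma series_test : exists2 F, testA A F &
  forall l k x, (size l <= k)%N -> Cmod (pds l (S k) x - pds l F x)%C <= 2 * (1 / 2) ^ k.
Proof.
have hpds l : pds l (G [::]) = G l.
  elim: l => //= i l ->; apply: functional_extensionality => x; exact: is_pd_pd (Gpd i l x).
exists (G [::]); last by move=> l k x; rewrite hpds; exact: Gb.
split.
  apply: (@smooth_class n (fun g => exists l, g = G l)); last by exists [::].
    move=> g [l ->] x; have [d [B [d0 hB]]] := @smooth_locb n _ l (Ssm (size l)) x.
    exists d, (B + 2 * (1 / 2) ^ (size l)); split => // y /hB hy.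
    have := Cmod_sub_le (G l y) (pds l (S (size l)) y); rewrite (Cmod_sym (G l y)).
    by have := @Gb l y _ (leqnn _); lra.
  move=> g i [l ->]; exists (G (i :: l)); first by exists (i :: l).
  by move=> x; apply: Gpd.
move=> x hx; apply: Cmod_eq_0; apply: Rle_antisym; last exact: Cmod_ge_0.
apply: (@le_of_half_pow _ _ 2 0%N) => k _.
have := @Gb [::] x k (leq0n _); rewrite /= /S (testA_psum k ft).2 //.
by rewrite Cmod_sym (_ : G [::] x - 0 = G [::] x)%C; [lra | ring].
Qed.
End SeriesOfTestFunctions.

Lemma dist_add n (T : functional n) f g : distribution T -> test_fun f -> test_fun g ->
  T (fun x => f x + g x)%C = (T f + T g)%C.
Proof. by case=> h _; apply: h. Qed.

Lemma dist_scal n (T : functional n) c f : distribution T -> test_fun f ->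
  T (fun x => c * f x)%C = (c * T f)%C.
Proof. by case=> _ [h _]; apply: h. Qed.

Lemma pbd_ge0 n N B (f : vec n -> C) : pbd N B f -> 0 <= B.
Proof.
by move=> h; apply: Rle_trans (Cmod_ge_0 (f (fun _ => 0))) _; apply: (h [::]).
Qed.

Lemma dist_bound n (T : functional n) A : distribution T -> exists K N, 0 <= K /\
  forall f B, testA A f -> pbd N B f -> Cmod (T f) <= K * B.
Proof.
case=> _ [_ /(_ A) [K [N h]]]; exists (Rabs K), N; split; first exact: Rabs_pos.
move=> f B hf hB; apply: Rle_trans (h f (testA_test hf) _ B hB) _.
  by apply/supp_ballE; case: hf.
by apply: Rmult_le_compat_r; [exact: pbd_ge0 hB | exact: Rle_abs].
Qed.

Lemma pbd_leq n N M B (f : vec n -> C) : (N <= M)%N -> pbd M B f -> pbd N B f.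
Proof. by move=> h hf l hl; apply: hf; apply: leq_trans h. Qed.

Lemma pbd_le n N B D (f : vec n -> C) : B <= D -> pbd N B f -> pbd N D f.
Proof. by move=> h hf l hl x; apply: Rle_trans h; apply: hf. Qed.

Lemma pbd_scal n N B c (f : vec n -> C) : smooth f -> pbd N B f -> pbd N (Cmod c * B) (fun x => c * f x)%C.
Proof.
move=> sf h l hl x; rewrite pds_scal // Cmod_mult; apply: Rmult_le_compat_l; first exact: Cmod_ge_0.
exact: h.
Qed.

(* Gliding hump. *)
Lemma banach_steinhaus n (I : Type) (T : I -> functional n) :
  (forall i, distribution (T i)) ->
  (forall f, test_fun f -> exists B, forall i, Cmod (T i f) <= B) ->
  forall A, exists K N, 0 <= K /\ forall i f B, testA A f -> pbd N B f -> Cmod (T i f) <= K * B.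
Proof.
move=> hT hpt A; apply: NNPP => hn.
(* A counterexample to the bound can be normalised to [B = 1]: the case [B = 0] forces [f], hence
   [T i f], to vanish. *)
have H K N : 0 <= K -> exists i f, [/\ testA A f, pbd N 1 f & K < Cmod (T i f)].
  move=> K0; apply: NNPP => hne; apply: hn; exists K, N; split => // i f B hf hB.
  apply: Rnot_lt_le => hlt; have B0 := pbd_ge0 hB.
  have Bnz : B <> 0.
    move=> eB; move: hlt; suff -> : T i f = 0 by rewrite Cmod_0 eB; lra.
    have -> : f = fun x => (0 * f x)%C.
      apply: functional_extensionality => x; have := hB [::] isT x; rewrite eB /=.
      by move=> h; rewrite (Cmod_eq_0 (f x)); [ring | have := Cmod_ge_0 (f x); lra].
    by rewrite dist_scal //; [ring | exact: testA_test hf].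
  have {}B0 : 0 < B by have := pbd_ge0 hB; lra.
  apply: hne; exists i, (fun x => RtoC (/ B) * f x)%C; split.
  - exact: testA_scal.
  - have := pbd_scal (RtoC (/ B)) hf.1 hB; rewrite Cmod_R Rabs_pos_eq; last by apply: Rlt_le; apply: Rinv_0_lt_compat.
    by rewrite Rinv_l; [ | lra].
  - rewrite dist_scal //; last exact: testA_test hf.
    rewrite Cmod_mult Cmod_R Rabs_pos_eq; last by apply: Rlt_le; apply: Rinv_0_lt_compat.
    apply: (Rmult_lt_reg_l B) => //; rewrite -Rmult_assoc Rinv_r; lra.
(* In the state [(N, K, M)], order [N] and constant [K] serve for all functionals chosen so far, and
   [M] bounds every functional of the family on the partial sum constructed so far. *)
pose St := (nat * R * R)%type.
pose good (k : nat) (s : St) (i : I) (f : vec n -> C) (s' : St) :=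
  let: (N, K, M) := s in let: (N', K', M') := s' in
  [/\ testA A f, pbd (maxn k N) ((1 / 2) ^ k / K) f, M + INR k + 1 < Cmod (T i f),
    (N <= N')%N /\ K <= K' & (forall g B, testA A g -> pbd N' B g -> Cmod (T i g) <= K' * B)
      /\ forall i', Cmod (T i' f) <= M' - M].
have stepx k (s : {s : St | 1 <= s.1.2 /\ 0 <= s.2}) :
    {p : I * (vec n -> C) * {s : St | 1 <= s.1.2 /\ 0 <= s.2} |
       good k (sval s) p.1.1 p.1.2 (sval p.2)}.
  apply: constructive_indefinite_description.
  case: s => [[[N K] M] /= [K1 M0]].
  (* The test function is scaled by [(1 / 2) ^ k / K] afterwards, which leaves a value above
     [M + INR k + 1]. *)
  have [i [f [hf hb hlt]]] := H ((M + INR k + 1) * (K * 2 ^ k)) (maxn k N)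
    ltac:(apply: Rmult_le_pos; [have := pos_INR k; lra | apply: Rmult_le_pos; [lra | apply: pow_le; lra]]).
  have p0 := half_pow_pos k.
  have c0 : 0 < (1 / 2) ^ k / K by apply: Rdiv_lt_0_compat; lra.
  pose f' := fun x => (RtoC ((1 / 2) ^ k / K) * f x)%C.
  have hf' : testA A f' by apply: testA_scal.
  have [K' [N' [K'0 hK']]] := @dist_bound n (T i) A (hT i).
  have [D hD] := hpt f' (testA_test hf').
  have hs : 1 <= (maxn N N', Rmax K K', M + Rabs D).1.2 /\ 0 <= (maxn N N', Rmax K K', M + Rabs D).2.
    by rewrite /=; split; [apply: Rle_trans K1 (Rmax_l _ _) | have := Rabs_pos D; lra].
  exists (i, f', exist _ (maxn N N', Rmax K K', M + Rabs D) hs) => /=; split => //.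
  - have := pbd_scal (RtoC ((1 / 2) ^ k / K)) hf.1 hb.
    by rewrite Cmod_R Rabs_pos_eq; [rewrite Rmult_1_r | lra].
  - rewrite dist_scal //; last exact: testA_test hf.
    rewrite Cmod_mult Cmod_R Rabs_pos_eq; last lra.
    have := Rmult_lt_compat_l _ _ _ c0 hlt; rewrite (_ : _ * (_ * _) = M + INR k + 1) //.
    have -> : (1 / 2) ^ k = / 2 ^ k by rewrite -pow_inv; congr pow; field.
    have : 2 ^ k <> 0 by apply: pow_nonzero; lra.
    by move: (2 ^ k) (INR k) => q v q0; field; split => //; lra.
  - by split; [exact: leq_maxl | exact: Rmax_l].
  - split.
      move=> g B hg hB; apply: Rle_trans (hK' g B hg (pbd_leq (leq_maxr _ _) hB)) _.
      by apply: Rmult_le_compat_r; [exact: pbd_ge0 hB | exact: Rmax_r].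
    by move=> i'; have := hD i'; have := Rle_abs D; lra.
have s0 : 1 <= (0%N, 1, 0).1.2 /\ 0 <= (0%N, 1, 0).2 by rewrite /=; lra.
pose st := fix st k : {s : St | 1 <= s.1.2 /\ 0 <= s.2} :=
  if k is k'.+1 then (sval (stepx k' (st k'))).2 else exist _ (0%N, 1, 0) s0.
pose i_ k := (sval (stepx k (st k))).1.1; pose f_ k := (sval (stepx k (st k))).1.2.
pose N_ k := (sval (st k)).1.1; pose K_ k := (sval (st k)).1.2; pose M_ k := (sval (st k)).2.
have hg k : good k (N_ k, K_ k, M_ k) (i_ k) (f_ k) (N_ k.+1, K_ k.+1, M_ k.+1).
  rewrite /N_ /K_ /M_ /i_ /f_ /=; case: (stepx k (st k)) => [[[i f] s']] /=.
  by case: (sval (st k)) => [[a b] c]; case: (sval s') => [[a' b'] c'].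
have K1 k : 1 <= K_ k by rewrite /K_; case: (st k) => s [].
have ft k : testA A (f_ k) by case: (hg k).
have fb k : pbd k ((1 / 2) ^ k) (f_ k).
  have [_ h _ _ _] := hg k; apply: pbd_leq (leq_maxl k (N_ k)) _; apply: pbd_le h.
  have := half_pow_pos k; have := K1 k => h1 h2.
  apply: (Rmult_le_reg_r (K_ k)); first lra.
  by rewrite /Rdiv Rmult_assoc Rinv_l; nra.
have [F hF hlim] := series_test ft fb.
have tS k : test_fun (psum f_ k) by apply: testA_test (testA_psum k ft).
have tf k : test_fun (f_ k) := testA_test (ft k).
have hM k i : Cmod (T i (psum f_ k)) <= M_ k.
  elim: k => [|k IH] /=.
    rewrite (_ : (fun _ => RtoC 0) = fun x : vec n => (0 * 0)%C); last by apply: functional_extensionality => x; ring.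
    rewrite dist_scal //; last exact: testA_test (@testA_0 n A).
    have -> : M_ 0%N = 0 by [].
    by rewrite Cmult_0_l Cmod_0; lra.
  rewrite (dist_add (hT i) (tS k) (tf k)); apply: Rle_trans (Cmod_triangle _ _) _.
  by have [_ _ _ _ [_ /(_ i)]] := hg k; lra.
have mono k d : (N_ k <= N_ (d + k)%N)%N /\ K_ k <= K_ (d + k)%N.
  elim: d => [|d [IH1 IH2]]; first by rewrite add0n; split => //; lra.
  rewrite addSn; have [_ _ _ [h1 h2] _] := hg (d + k)%N.
  by split; [exact: leq_trans h1 | lra].
(* The k-th functional is bounded with constants at most [N_ j] and [K_ j], and the j-th hump was
   divided by [K_ j]. *)
have later k j : (k < j)%N -> Cmod (T (i_ k) (f_ j)) <= (1 / 2) ^ j.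
  move=> kj; have [_ _ _ _ [h1 _]] := hg k; have [_ h2 _ _ _] := hg j.
  have [m1 m2] := mono k.+1 (j - k.+1)%N; rewrite subnK // in m1 m2.
  have := h1 _ _ (ft j) (pbd_leq (leq_trans m1 (leq_maxr j _)) h2).
  move=> h3; apply: Rle_trans h3 _.
  have := half_pow_pos j; have := K1 j; have := K1 k.+1 => k1 k2 k3.
  apply: Rle_trans (_ : K_ j * ((1 / 2) ^ j / K_ j) <= _).
    by apply: Rmult_le_compat_r => //; apply: Rlt_le; apply: Rdiv_lt_0_compat; lra.
  by apply: Req_le; field; lra.
(* The k-th hump contributes more than [M_ k + INR k + 1], the earlier ones at most [M_ k] and the
   later ones at most 1 in total. *)
have big k : INR k <= Cmod (T (i_ k) F).
  have [K' [N' [K'0 hK']]] := @dist_bound n (T (i_ k)) A (hT (i_ k)).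
  suff : INR k - Cmod (T (i_ k) F) <= 0 by lra.
  apply: (@le_of_half_pow _ _ (2 * K') (maxn k.+1 N')) => m hm.
  have h1 : Cmod (T (i_ k) (psum f_ m) - T (i_ k) (psum f_ k.+1))%C <= 2 * (1 / 2) ^ k.+1.
    apply: (@telescope_half (fun m => T (i_ k) (psum f_ m)) k.+1) => [j hj||] //=; last first.
      exact: leq_trans (leq_maxl _ _) hm.
    rewrite (dist_add (hT (i_ k)) (tS j) (tf j)) (_ : _ + _ - _ = T (i_ k) (f_ j))%C; last by ring.
    exact: later.
  have h2 : M_ k + INR k + 1 < Cmod (T (i_ k) (f_ k)) by case: (hg k).
  have h3 := hM k (i_ k).
  have h4 : T (i_ k) (psum f_ k.+1) = (T (i_ k) (psum f_ k) + T (i_ k) (f_ k))%C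
    by exact: (dist_add (hT (i_ k)) (tS k) (tf k)).
  have h5 : Cmod (T (i_ k) (psum f_ m) - T (i_ k) F)%C <= K' * (2 * (1 / 2) ^ m).
    have -> : (T (i_ k) (psum f_ m) - T (i_ k) F = T (i_ k) (fun x => psum f_ m x + (-(1)) * F x))%C.
      rewrite (dist_add (hT (i_ k)) (tS m) (testA_test (testA_scal _ hF))).
      by rewrite dist_scal //; [ring | exact: testA_test hF].
    apply: hK'; first by apply: testA_plus; [exact: testA_psum | exact: testA_scal].
    move=> l hl x; rewrite pds_plus; [|exact: (testA_psum m ft).1|apply: smooth_scal; exact: hF.1].
    rewrite pds_scal; last exact: hF.1.
    have := hlim l m x (leq_trans hl (leq_trans (leq_maxr k.+1 N') hm)).
    by rewrite (_ : _ + _ = pds l (psum f_ m) x - pds l F x)%C //; ring.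
  have hk : (1 / 2) ^ k.+1 <= 1 / 2.
    elim: k {h1 h2 h3 h4 h5 hm K' N' K'0 hK'} => [|k IH]; first by rewrite /=; lra.
    by rewrite half_powS; have := half_pow_pos k.+1; lra.
  have h6 := Cmod_sub_le (T (i_ k) (f_ k)) (T (i_ k) (psum f_ k.+1)).
  have h7 := Cmod_sub_le (T (i_ k) (psum f_ k.+1)) (T (i_ k) (psum f_ m)).
  have h8 := Cmod_sub_le (T (i_ k) (psum f_ m)) (T (i_ k) F).
  rewrite Cmod_sym in h7.
  have h9 : Cmod (T (i_ k) (f_ k) - T (i_ k) (psum f_ k.+1))%C = Cmod (T (i_ k) (psum f_ k)).
    by rewrite h4 -Cmod_opp; congr Cmod; ring.
  by rewrite h9 in h6; lra.
have [B hB] := hpt F (testA_test hF).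
have [k hk] := nfloor_ex (Rabs B) (Rabs_pos B).
have := big k.+1; have := hB (i_ k.+1); have := Rle_abs B; rewrite S_INR; lra.
Qed.

(** * The wave family applied to slices *)

Lemma isD_bounded (f f1 : R -> C) : (forall s, isD f s (f1 s)) ->
  forall r, exists B, forall s, Rabs s <= r -> Cmod (f s) <= B.
Proof.
move=> hf r.
have cont (p : R -> R) : (forall s, ex_derive p s) -> forall s, continuity_pt (fun s => Rabs (p s)) s.
  move=> hp s; apply: (continuity_pt_comp p Rabs); last exact: Rcontinuity_abs.
  by apply/continuity_pt_filterlim; apply: ex_derive_continuous.
have h1 := cont (fun s => Re (f s)) (fun s => ex_intro _ _ (hf s).1).
have h2 := cont (fun s => Im (f s)) (fun s => ex_intro _ _ (hf s).2).
case: (Rle_dec 0 r) => r0; last by exists 0 => s hs; have := Rabs_pos s; lra.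
have [a [ha _]] := continuity_ab_maj _ (- r) r ltac:(lra) (fun s _ => h1 s).
have [b [hb _]] := continuity_ab_maj _ (- r) r ltac:(lra) (fun s _ => h2 s).
exists (Rabs (Re (f a)) + Rabs (Im (f b))) => s /Rabs_le_between hs.
by apply: Rle_trans (Cmod_le_ReIm _) _; apply: Rplus_le_compat; [exact: ha | exact: hb].
Qed.

Definition sumC n (F : 'I_n -> C) : C := \big[Cplus/RtoC 0]_(i < n) F i.

(** With [j = id] this is the Laplacian of R^n, with [j = lift ord_max] the spatial Laplacian on
    space-time. *)
Definition lap n m (j : 'I_n -> 'I_m) (f : vec m -> C) : vec m -> C :=
  fun x => sumC (fun i => pd (j i) (pd (j i) f) x).

Lemma testA_sum m A (I : Type) (s : seq I) (F : I -> vec m -> C) : (forall i, testA A (F i)) ->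
  testA A (fun x => \big[Cplus/RtoC 0]_(i <- s) F i x).
Proof.
move=> h; elim: s => [|i s IH].
  have -> : (fun x : vec m => \big[Cplus/RtoC 0]_(i <- [::]) F i x) = fun _ => RtoC 0.
    by apply: functional_extensionality => x; rewrite big_nil.
  exact: testA_0.
have -> : (fun x => \big[Cplus/RtoC 0]_(k <- i :: s) F k x) =
    fun x => (F i x + \big[Cplus/RtoC 0]_(k <- s) F k x)%C.
  by apply: functional_extensionality => x; rewrite big_cons.
exact: testA_plus.
Qed.

Lemma dist_0 n (T : functional n) : distribution T -> T (fun _ => RtoC 0) = 0.
Proof.
move=> hT.
have := dist_scal (RtoC 0) hT (testA_test (@testA_0 n 0)).
have -> : (fun _ : vec n => (RtoC 0 * RtoC 0)%C) = fun _ => RtoC 0.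
  by apply: functional_extensionality => x; ring.
by move=> ->; ring.
Qed.

Lemma dist_sum n (T : functional n) A (I : Type) (s : seq I) (F : I -> vec n -> C) :
  distribution T -> (forall i, testA A (F i)) ->
  T (fun x => \big[Cplus/RtoC 0]_(i <- s) F i x) = \big[Cplus/RtoC 0]_(i <- s) T (F i).
Proof.
move=> hT h; elim: s => [|i s IH].
  have -> : (fun x : vec n => \big[Cplus/RtoC 0]_(i <- [::]) F i x) = fun _ => RtoC 0.
    by apply: functional_extensionality => x; rewrite big_nil.
  by rewrite big_nil dist_0.
have -> : (fun x => \big[Cplus/RtoC 0]_(k <- i :: s) F k x) =
    fun x => (F i x + \big[Cplus/RtoC 0]_(k <- s) F k x)%C.
  by apply: functional_extensionality => x; rewrite big_cons.
rewrite big_cons -IH; apply: (dist_add hT); first exact: testA_test (h i).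
by apply: testA_test (testA_sum s h).
Qed.

Lemma testA_lap n m (j : 'I_n -> 'I_m) A f : testA A f -> testA A (lap j f).
Proof. by move=> h; apply: testA_sum => i; exact: (testA_pds [:: j i; j i] h). Qed.

(* Used with [e] the identity of R^n and with [e y = st y 0]. *)
Record embedding n m (e : vec n -> vec m) (j : 'I_n -> 'I_m) : Prop := {
  emb_upd : forall y i s, e (upd y i s) = upd (e y) (j i) s;
  emb_coord : forall y i, e y (j i) = y i;
  emb_near : forall y d y', 0 < d -> near_vec y d y' -> near_vec (e y) d (e y');
  emb_zero : forall k, e (fun _ => 0) k = 0 }.

(** Restriction of [f] to the plane through [z], with the origin moved to [z]: a functional on R^n,
    applied to it, yields a function of [z]. *)
Definition slice n m (e : vec n -> vec m) (f : vec m -> C) (z : vec m) : vec n -> C :=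
  fun y => f (fun k => z k + e y k).

Section Slice.
Variables (n m : nat) (e : vec n -> vec m) (j : 'I_n -> 'I_m).
Hypothesis he : embedding e j.

Lemma slice_is_pd i (f g : vec m -> C) z y : (forall x, is_pd (j i) f x (g x)) ->
  is_pd i (slice e f z) y (slice e g z y).
Proof.
move=> h.
apply: (@isD_ext (fun s => f (upd (fun k => z k + e y k) (j i) (z (j i) + s)))).
  move=> s; rewrite /slice (emb_upd he); congr f; apply: functional_extensionality => k.
  by rewrite /upd; case: eqP => // ->.
apply: (@isD_shift (fun s => f (upd (fun k => z k + e y k) (j i) s))).
have -> : slice e g z y = g (upd (fun k => z k + e y k) (j i) (z (j i) + y i)).
  by rewrite -(emb_coord he y i) upd_id.
exact: is_pd_line.
Qed.

Lemma slice_smooth (f : vec m -> C) z : smooth f -> smooth (slice e f z).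
Proof.
move=> hf; apply: (@smooth_class n (fun g => exists2 f, smooth f & g = slice e f z)); last by exists f.
  move=> g [h hh ->] y.
  have [d [B [d0 hB]]] := @smooth_locb m h [::] hh (fun k => z k + e y k).
  exists d, B; split => // y' hy; apply: hB => k.
  have -> : z k + e y' k - (z k + e y k) = e y' k - e y k by ring.
  exact: (emb_near he d0 hy).
move=> g i [h hh ->]; exists (slice e (pd (j i) h) z).
  by exists (pd (j i) h) => //; apply: smooth_pd.
by move=> x; apply: slice_is_pd => y; apply: smooth_is_pd1.
Qed.

Lemma pd_slice i (f : vec m -> C) z : smooth f -> pd i (slice e f z) = slice e (pd (j i) f) z.
Proof.
move=> hf; apply: functional_extensionality => x; apply: is_pd_pd; apply: slice_is_pd => y.
exact: smooth_is_pd1.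
Qed.

Lemma pds_slice l (f : vec m -> C) z : smooth f -> pds l (slice e f z) = slice e (pds (map j l) f) z.
Proof. by move=> hf; elim: l => //= i l ->; rewrite pd_slice //; apply: smooth_pds. Qed.

Lemma pbd_slice N B (f : vec m -> C) z : smooth f -> pbd N B f -> pbd N B (slice e f z).
Proof. by move=> hf h l hl x; rewrite pds_slice //; apply: h; rewrite size_map. Qed.

Lemma testA_slice A Z (f : vec m -> C) z : testA A f -> (forall k, Rabs (z k) <= Z) ->
  testA (INR n * Rabs (A + Z)) (slice e f z).
Proof.
case=> h1 h2 hz; split; first exact: slice_smooth.
move=> y hy; apply: h2; apply: Rnot_le_lt => hle.
suff : enorm y <= INR n * Rabs (A + Z) by lra.
apply: enorm_le => i; rewrite -(emb_coord he y i).
have := Rle_trans _ _ _ (enorm_ge (fun k => z k + e y k) (j i)) hle.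
have := hz (j i); set a := z _; set b := e y _ => h3 h4.
have -> : b = (a + b) + - a by ring.
by apply: Rle_trans (Rabs_triang _ _) _; rewrite Rabs_Ropp; lra.
Qed.

Lemma test_slice (f : vec m -> C) z : test_fun f -> test_fun (slice e f z).
Proof.
move=> /test_testA [A A0 hA]; have [Z [Z0 hZ]] := finite_bound (fun k => Rabs (z k)).
exact: testA_test (testA_slice hA hZ).
Qed.

Lemma lap_slice (f : vec m -> C) z : smooth f -> lap id (slice e f z) = slice e (lap j f) z.
Proof.
move=> hf; apply: functional_extensionality => y; rewrite /lap /slice.
apply: eq_bigr => i _; rewrite pd_slice // pd_slice //; exact: smooth_pd.
Qed.

End Slice.

Lemma is_derive_st n (i : 'I_n) : lift ord_max i != ord_max :> 'I_n.+1.
Proof. by rewrite eq_sym neq_lift. Qed.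

Lemma st_lift n (x : vec n) t i : st x t (lift ord_max i) = x i.
Proof. by rewrite /st liftK. Qed.

Lemma st_max n (x : vec n) t : st x t ord_max = t.
Proof. by rewrite /st unlift_none. Qed.

Lemma emb_st n : embedding (fun y : vec n => st y 0) (lift ord_max).
Proof.
split=> [y i s|y i|y d y' d0 h|k].
- apply: functional_extensionality => k; rewrite /upd.
  case: (unliftP ord_max k) => [i' ->|->]; last by rewrite !st_max (negbTE (neq_lift _ _)).
  by rewrite !st_lift (inj_eq (@lift_inj _ _)).
- exact: st_lift.
- move=> k; case: (unliftP ord_max k) => [i ->|->]; first by rewrite !st_lift.
  by rewrite !st_max Rminus_diag Rabs_R0.
- by case: (unliftP ord_max k) => [i ->|->]; rewrite ?st_lift ?st_max.
Qed.

Lemma emb_id n : embedding (fun y : vec n => y) id.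
Proof. by split. Qed.

(** * The wave family, its r-derivative, and joint smoothness *)

Section WaveFamily.
Variables (n : nat) (Ew : R -> functional n).
Hypothesis hEw : wave_fundamental_solution Ew.

(** The flag [true] marks the r-derivative. By the wave equation one more derivative gives back the
    family itself, applied to the Laplacian of the test function, so the two cases together are
    closed under d_r. *)
Definition Tw (a : bool) (r : R) : functional n :=
  if a then fun f => derivC (fun s => Ew s f) r else Ew r.

Lemma Ew_dist r : distribution (Ew r).
Proof. by case: hEw => /(_ r) []. Qed.

Lemma Tw_isD0 f r : test_fun f -> isD (fun s => Tw false s f) r (Tw true r f).
Proof.
case: hEw => _ [h _] hf; apply: ex_isD; exact: (h f hf 0%N r).
Qed.

Lemma Tw_isD1 f r : test_fun f -> isD (fun s => Tw true s f) r (Tw false r (lap id f)).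
Proof.
move=> hf; case: hEw => _ [h [hw _]].
have := ex_isD (h f hf 1%N r); rewrite /=.
have -> : derivC (derivC (fun s => Ew s f)) r = Ew r (lap id f); last by [].
have e : forall a b : C, (a - b = 0)%C -> a = b.
  by move=> a b hab; have -> : a = (b + (a - b))%C; [ring | rewrite hab; ring].
rewrite (e _ _ (hw f hf r)) /lap /sumC.
have [A _ hA] := test_testA hf.
rewrite (@dist_sum n (Ew r) A _ _ (fun i => pd i (pd i f))); last first.
- by move=> i; exact: (testA_pds [:: i; i] hA).
- exact: Ew_dist.
by apply: eq_bigr => i _; rewrite /dist_diff; ring.
Qed.

Lemma Tw_add a r f g : test_fun f -> test_fun g ->
  Tw a r (fun x => f x + g x)%C = (Tw a r f + Tw a r g)%C.
Proof.
move=> hf hg; case: a; last exact: dist_add (Ew_dist r) hf hg.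
apply: isD_derivC; apply: (@isD_ext (fun s => Ew s f + Ew s g)%C).
  by move=> s; rewrite (dist_add (Ew_dist s) hf hg).
by apply: isD_plus; apply: Tw_isD0.
Qed.

Lemma Tw_scal a r c f : test_fun f -> Tw a r (fun x => c * f x)%C = (c * Tw a r f)%C.
Proof.
move=> hf; case: a; last exact: dist_scal (Ew_dist r) hf.
apply: isD_derivC; apply: (@isD_ext (fun s => c * Ew s f)%C).
  by move=> s; rewrite (dist_scal _ (Ew_dist s) hf).
by apply: isD_scal; apply: Tw_isD0.
Qed.

(** For fixed [f] the values are bounded on [Rabs r <= r0], being continuous in [r];
    Banach-Steinhaus over this set of indices makes constant and order independent of [f]. *)
Lemma Tw0_bound A r0 : exists K N, 0 <= K /\
  forall r f B, Rabs r <= r0 -> testA A f -> pbd N B f -> Cmod (Tw false r f) <= K * B.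
Proof.
have H : forall f, test_fun f -> exists B, forall r : {r | Rabs r <= r0}, Cmod (Ew (sval r) f) <= B; last first.
  have [K [N [K0 h]]] := @banach_steinhaus n {r | Rabs r <= r0} (fun r => Ew (sval r))
    (fun r => Ew_dist _) H A.
  exists K, N; split => // r f B hr; exact: (h (exist _ r hr)).
move=> f hf; have [B hB] := isD_bounded (fun r => Tw_isD0 r hf) r0.
by exists B => -[r hr] /=; apply: hB.
Qed.

(** The r-derivative is not yet known to be a distribution, so Banach-Steinhaus is applied to the
    difference quotients with steps in (0, 1], which are bounded pointwise by the mean value
    theorem; the uniform bound passes to their limit. *)
Lemma Tw1_bound A r0 : exists K N, 0 <= K /\
  forall r f B, Rabs r <= r0 -> testA A f -> pbd N B f -> Cmod (Tw true r f) <= K * B.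
Proof.
pose I := {p : R * R | Rabs p.1 <= r0 /\ 0 < p.2 <= 1}.
pose D (p : I) : functional n := fun f =>
  (RtoC (/ (sval p).2) * (Ew ((sval p).1 + (sval p).2) f - Ew (sval p).1 f))%C.
have [K [N [K0 h]]] : exists K N, 0 <= K /\
    forall i f B, testA A f -> pbd N B f -> Cmod (D i f) <= K * B.
  apply: banach_steinhaus => [[[r h] /= [hr hh]]|f hf].
    rewrite /D /=; have d1 := Ew_dist (r + h); have d2 := Ew_dist r.
    split; [|split].
    - by move=> f g hf hg; rewrite (dist_add d1 hf hg) (dist_add d2 hf hg); ring.
    - by move=> c f hf; rewrite (dist_scal c d1 hf) (dist_scal c d2 hf); ring.
    - move=> A'; have [K1 [N1 [K10 h1]]] := dist_bound A' d1; have [K2 [N2 [K20 h2]]] := dist_bound A' d2.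
      exists (/ h * (K1 + K2)), (maxn N1 N2) => f hf hs B hB.
      have hA : testA A' f by split; [case: hf | apply/supp_ballE].
      rewrite Cmod_mult Cmod_R Rabs_pos_eq; last by apply: Rlt_le; apply: Rinv_0_lt_compat; lra.
      rewrite Rmult_assoc; apply: Rmult_le_compat_l; first by apply: Rlt_le; apply: Rinv_0_lt_compat; lra.
      have b1 := h1 f B hA (pbd_leq (leq_maxl _ _) hB).
      have b2 := h2 f B hA (pbd_leq (leq_maxr _ _) hB).
      apply: Rle_trans (Cmod_triangle _ _) _; rewrite Cmod_opp; lra.
  have [B hB] := isD_bounded (fun r => Tw_isD1 r hf) (r0 + 1).
  exists (2 * B) => -[[r h] /= [hr hh]]; rewrite /D /=.
  rewrite Cmod_mult Cmod_R Rabs_pos_eq; last by apply: Rlt_le; apply: Rinv_0_lt_compat; lra.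
  have := @lip_of_isD (fun s => Ew s f) (fun s => Tw true s f) r 1 B (fun s _ => Tw_isD0 s hf).
  move=> /(_ _ (r + h)); rewrite (_ : r + h - r = h); last by ring.
  rewrite (Rabs_pos_eq h); last lra.
  move=> H; have {}H : Cmod (Ew (r + h) f - Ew r f)%C <= 2 * B * h.
    apply: H; last lra.
    move=> s hs; apply: hB.
    have -> : s = (s - r) + r by ring.
    by apply: Rle_trans (Rabs_triang _ _) _; lra.
  apply: (Rmult_le_reg_l h); first lra.
  rewrite -Rmult_assoc Rinv_r; lra.
exists K, N; split => // r f B hr hf hB.
have tf := testA_test hf.
have tl : test_fun (lap id f) by have [A' _ hA'] := test_testA tf; apply: testA_test (testA_lap id hA').
have [C2 hC2] := isD_bounded (fun r => Tw_isD0 r tl) (r0 + 1).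
have hC2' s : Rabs (s - r) < 1 -> Cmod (Tw false s (lap id f)) <= C2.
  move=> hs; apply: hC2; have -> : s = (s - r) + r by ring.
  by apply: Rle_trans (Rabs_triang _ _) _; lra.
have T := @taylor_quadC (fun s => Tw false s f) (fun s => Tw true s f) (fun s => Tw false s (lap id f)) r 1 C2
  (fun s _ => Tw_isD0 s tf) (fun s _ => Tw_isD1 s tf).
have {}T := T hC2'.
(* The quotient with step [(1 / 2) ^ k] differs from the derivative by at most
   [2 * C2 * (1 / 2) ^ k]. *)
apply: (@le_of_half_pow _ _ (2 * C2) 1%N) => k hk.
have p0 := half_pow_pos k.
have p1 : (1 / 2) ^ k < 1.
  case: k hk p0 => // k _ _; elim: k => [|k IH]; first by rewrite /=; lra.
  by rewrite half_powS; have := half_pow_pos k.+1; lra.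
have hi : Rabs (r, (1 / 2) ^ k).1 <= r0 /\ 0 < (r, (1 / 2) ^ k).2 <= 1 by rewrite /=; lra.
have h1 := h (exist _ _ hi) f B hf hB; rewrite /D [sval _]/= [_.1]/= [_.2]/= in h1.
have h2 : Cmod (Ew (r + (1 / 2) ^ k) f - Ew r f - RtoC ((1 / 2) ^ k) * Tw true r f)%C <= 2 * C2 * ((1 / 2) ^ k) ^ 2.
  by apply: T; rewrite Rabs_pos_eq; lra.
rewrite -[Ew]/(Tw false) in h1 h2; move: h1 h2; set p := (1 / 2) ^ k in p0 p1 *; set u := (_ - _)%C; set v := Tw true r f => h1 h2.
have h3 := Cmod_sub_le (RtoC p * v)%C u.
rewrite Cmod_sym in h3; rewrite !Cmod_mult !Cmod_R (Rabs_pos_eq p) in h1 h3; try lra.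
rewrite Rabs_pos_eq in h1; last by apply: Rlt_le; apply: Rinv_0_lt_compat.
have h4 : Cmod u <= p * (K * B).
  apply: (Rmult_le_reg_l (/ p)); first exact: Rinv_0_lt_compat.
  by rewrite -(Rmult_assoc (/ p) p) Rinv_l ?Rmult_1_l //; apply: Rgt_not_eq.
apply: (Rmult_le_reg_l p) => //; nra.
Qed.

Lemma Tw_bound A r0 : exists K N, 0 <= K /\
  forall a r f B, Rabs r <= r0 -> testA A f -> pbd N B f -> Cmod (Tw a r f) <= K * B.
Proof.
have [K1 [N1 [K10 h1]]] := Tw0_bound A r0; have [K2 [N2 [K20 h2]]] := Tw1_bound A r0.
exists (K1 + K2), (maxn N1 N2); split; first lra.
move=> a r f B hr hf hB; have B0 := pbd_ge0 hB.
case: a.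
  by have := h2 r f B hr hf (pbd_leq (leq_maxr _ _) hB); nra.
by have := h1 r f B hr hf (pbd_leq (leq_maxl _ _) hB); nra.
Qed.

Lemma Tw_dist a r : distribution (Tw a r).
Proof.
split; [exact: Tw_add | split; first exact: Tw_scal].
move=> A; have [K [N [K0 h]]] := Tw_bound A (Rabs r); exists K, N => f hf hs B hB.
by apply: (h a r f B (Rle_refl _)) => //; split; [case: hf | apply/supp_ballE].
Qed.

Variables (m : nat) (e : vec n -> vec m) (j : 'I_n -> 'I_m).
Hypothesis he : embedding e j.

(** For a test function [f], the case [false] is the solution in [(z, r)] of the wave equation in
    the slice coordinates with Cauchy data [f] and 0; the case [true] is its r-derivative. *)
Definition W (a : bool) (f : vec m -> C) (z : vec m) (r : R) : C := Tw a r (slice e f z).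

Lemma W_bounded f Z r0 : test_fun f -> exists B, forall a z r,
  (forall k, Rabs (z k) <= Z) -> Rabs r <= r0 -> Cmod (W a f z r) <= B.
Proof.
move=> /test_testA [A A0 hA].
have [K [N [K0 h]]] := Tw_bound (INR n * Rabs (A + Z)) r0.
have [B B0 hB] := pbd_exists N hA.
exists (K * B) => a z r hz hr; apply: h => //; first exact: (testA_slice he).
by apply: (pbd_slice he) => //; case: hA.
Qed.

Lemma W_add a f g z r : test_fun f -> test_fun g ->
  W a (fun x => f x + g x)%C z r = (W a f z r + W a g z r)%C.
Proof. by move=> hf hg; apply: Tw_add; apply: (test_slice he). Qed.

Lemma W_scal a c f z r : test_fun f -> W a (fun x => c * f x)%C z r = (c * W a f z r)%C.
Proof. by move=> hf; apply: Tw_scal; apply: (test_slice he). Qed.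

(** The slices through [z] and a shifted point differ from the linear approximation by a test
    function whose derivatives of order at most [N] are of size [h ^ 2]; [Tw_bound] carries this
    over to the values. *)
Lemma W_is_pd a i f z r : test_fun f -> is_pd i (fun z => W a f z r) z (W a (pd i f) z r).
Proof.
move=> tf; have [A A0 hA] := test_testA tf; have sf := hA.1.
have [Z [Z0 hZ]] := finite_bound (fun k => Rabs (z k)).
have [K [N [K0 hK]]] := Tw_bound (INR n * Rabs (A + (Z + 1))) (Rabs r).
(* The Taylor remainder of a derivative of order at most [N] is controlled by two further
   derivatives. *)
have [B B0 hB] := pbd_exists N.+2 hA.
have hz1 : forall h, Rabs h < 1 -> forall k, Rabs (upd z i (z i + h) k) <= Z + 1.
  move=> h hh k; rewrite /upd; case: eqP => [_|_]; last by have := hZ k; lra.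
  by apply: Rle_trans (Rabs_triang _ _) _; have := hZ i; lra.
have hz0 : forall k, Rabs (z k) <= Z + 1 by move=> k; have := hZ k; lra.
apply: (@isD_quad _ (z i) _ (K * (2 * B)) 1); first lra.
move=> h hh; rewrite upd_id /W.
set z' := upd z i _.
have t1 := testA_slice he hA (hz1 h hh); have t2 := testA_slice he hA hz0.
have t3 := testA_slice he (testA_pds [:: i] hA) hz0.
have -> : (Tw a r (slice e f z') - Tw a r (slice e f z) - RtoC h * Tw a r (slice e (pd i f) z) =
   Tw a r (fun y => slice e f z' y + (-(1) * slice e f z y + - RtoC h * slice e (pd i f) z y)))%C.
  rewrite Tw_add; [|exact: testA_test t1|]; last first.
    by apply: testA_test (testA_plus (testA_scal _ t2) (testA_scal _ t3)).
  rewrite Tw_add; [|exact: testA_test (testA_scal _ t2)|exact: testA_test (testA_scal _ t3)].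
  by rewrite Tw_scal ?Tw_scal; [ring | exact: testA_test t3 | exact: testA_test t2].
rewrite Rmult_assoc; apply: hK; [exact: Rle_refl | by apply: testA_plus => //; apply: testA_plus; apply: testA_scal |].
move=> l hl y.
rewrite pds_plus; [|exact: t1.1|by apply: smooth_plus; apply: smooth_scal; [exact: t2.1|exact: t3.1]].
rewrite pds_plus; [|apply: smooth_scal; exact: t2.1|apply: smooth_scal; exact: t3.1].
rewrite pds_scal; last exact: t2.1.
rewrite pds_scal; last exact: t3.1.
rewrite !(pds_slice he) //; last exact: smooth_pd.
rewrite pds_pd_comm // /slice.
set F := pds (map j l) f; have sF : smooth F by exact: smooth_pds.
set q := (fun k => z k + e y k).
have -> : (fun k => z' k + e y k) = upd q i (Rplus (q i) h).
  apply: functional_extensionality => k; rewrite /z' /q /upd; case: eqP => // ->; ring.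
have := @taylor_quadC (fun s => F (upd q i s)) (fun s => pd i F (upd q i s)) (fun s => pd i (pd i F) (upd q i s)) (q i) 1 B.
move=> /(_ (fun s _ => is_pd_line q s (fun x => smooth_is_pd1 i x sF))).
move=> /(_ (fun s _ => is_pd_line q s (fun x => smooth_is_pd1 i x (smooth_pd i sF)))).
move=> T; have {}T := T (fun s _ => hB [:: i, i & map j l] _ _) h hh.
rewrite upd_id in T; apply: Rle_trans (T _).
  by apply: Req_le; congr Cmod; ring.
by rewrite /= size_map.
Qed.

Lemma W_smooth a f r : test_fun f -> smooth (fun z => W a f z r).
Proof.
move=> tf; apply: (@smooth_class m (fun g => exists2 f, test_fun f & g = fun z => W a f z r)); last by exists f.
  move=> g [h th ->] z.
  have [Z [Z0 hZ]] := finite_bound (fun k => Rabs (z k)).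
  have [B hB] := W_bounded (Z + 1) (Rabs r) th.
  exists 1, B; split; first lra.
  move=> z' hz; apply: hB; last exact: Rle_refl.
  move=> k; have -> : z' k = (z' k - z k) + z k by ring.
  by apply: Rle_trans (Rabs_triang _ _) _; have := hZ k; have := hz k; lra.
move=> g i [h th ->]; exists (fun z => W a (pd i h) z r); last by move=> z; exact: W_is_pd.
by exists (pd i h) => //; have [A _ hA] := test_testA th; apply: testA_test (testA_pds [:: i] hA).
Qed.

(** The variables [z] and [r] are joined in one vector so that joint smoothness, and with it the
    chain rule along curves moving both, falls under [smooth_class]. *)
Definition V (a : bool) (f : vec m -> C) (w : vec m.+1) : C := W a f (space w) (time w).

Lemma space_upd_lift (w : vec m.+1) i s : space (upd w (lift ord_max i) s) = upd (space w) i s.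
Proof.
by apply: functional_extensionality => k; rewrite /space /upd (inj_eq (@lift_inj _ _)).
Qed.

Lemma time_upd_lift (w : vec m.+1) i s : time (upd w (lift ord_max i) s) = time w.
Proof. by rewrite /time upd_neq // neq_lift. Qed.

Lemma space_upd_max (w : vec m.+1) s : space (upd w ord_max s) = space w.
Proof. by apply: functional_extensionality => k; rewrite /space upd_neq // eq_sym neq_lift. Qed.

Lemma time_upd_max (w : vec m.+1) s : time (upd w ord_max s) = s.
Proof. by rewrite /time upd_same. Qed.

Lemma V_pd_lift a f i w : test_fun f -> is_pd (lift ord_max i) (V a f) w (V a (pd i f) w).
Proof.
move=> tf; apply: (@isD_ext (fun s => W a f (upd (space w) i s) (time w))).
  by move=> s; rewrite /V space_upd_lift time_upd_lift.
exact: W_is_pd.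
Qed.

(** What a derivative in [r] does to the test function: nothing the first time, a Laplacian the
    second, while the flag is flipped. *)
Definition dr (a : bool) (f : vec m -> C) : vec m -> C := if a then lap j f else f.

Lemma test_dr a f : test_fun f -> test_fun (dr a f).
Proof. by move=> tf; have [A _ hA] := test_testA tf; case: a => //; apply: testA_test (testA_lap j hA). Qed.

Lemma W_isD_r a f z r : test_fun f -> isD (W a f z) r (W (~~ a) (dr a f) z r).
Proof.
move=> tf; have ts := test_slice he z tf; case: a; last exact: Tw_isD0.
by rewrite /W /dr /= -(lap_slice he) //; [exact: Tw_isD1 | case: tf].
Qed.

Lemma V_pd_max a f w : test_fun f -> is_pd ord_max (V a f) w (V (~~ a) (dr a f) w).
Proof.
move=> tf; apply: (@isD_ext (W a f (space w))); first by move=> s; rewrite /V space_upd_max time_upd_max.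
exact: W_isD_r.
Qed.

Lemma V_smooth a f : test_fun f -> smooth (V a f).
Proof.
move=> tf; apply: (@smooth_class m.+1 (fun g => exists a f, test_fun f /\ g = V a f)); last by exists a, f.
  move=> g [b [h [th ->]]] w.
  have [Z [Z0 hZ]] := finite_bound (fun k => Rabs (w k)).
  have [B hB] := W_bounded (Z + 1) (Z + 1) th.
  exists 1, B; split; first lra.
  move=> w' hw.
  have h1 k : Rabs (w' k) <= Z + 1.
    have -> : w' k = (w' k - w k) + w k by ring.
    by apply: Rle_trans (Rabs_triang _ _) _; have := hZ k; have := hw k; lra.
  by apply: hB => [k|]; apply: h1.
move=> g i [b [h [th ->]]]; case: (unliftP ord_max i) => [i' ->|->].
  exists (V b (pd i' h)); last by move=> x; apply: V_pd_lift.
  exists b, (pd i' h); split => //.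
  by have [A _ hA] := test_testA th; apply: testA_test (testA_pds [:: i'] hA).
exists (V (~~ b) (dr b h)); last by move=> x; apply: V_pd_max.
by exists (~~ b), (dr b h); split => //; apply: test_dr.
Qed.

End WaveFamily.

(** * Integration over a box *)

Lemma continuous_lip (g : R -> R) s0 K d : 0 < d ->
  (forall s, Rabs (s - s0) < d -> Rabs (g s - g s0) <= K * Rabs (s - s0)) -> continuous g s0.
Proof.
move=> d0 h P [eps hP].
have K0 : 0 < Rabs K + 1 by have := Rabs_pos K; lra.
have m0 : 0 < Rmin d (eps / (Rabs K + 1)).
  by apply: Rmin_pos => //; apply: Rdiv_lt_0_compat => //; exact: cond_pos.
exists (mkposreal _ m0) => s hs; apply: hP.
have h1 : Rabs (s - s0) < Rmin d (eps / (Rabs K + 1)) := hs.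
have h2 := Rlt_le_trans _ _ _ h1 (Rmin_l _ _); have h3 := Rlt_le_trans _ _ _ h1 (Rmin_r _ _).
apply: Rle_lt_trans (h s h2) _.
have := Rmult_lt_compat_r _ _ _ K0 h3; rewrite /Rdiv Rmult_assoc Rinv_l ?Rmult_1_r; last by apply: Rgt_not_eq.
have := Rabs_pos (s - s0); have := Rle_abs K; move: (Rabs (s - s0)) (Rabs K) => a b; nra.
Qed.

Section BoxIntegral.
Variables (n : nat) (A : R).
Hypothesis A0 : 0 < A.

Definition inbox (rho : R) (x : vec n) : Prop := forall k, Rabs (x k) <= rho.

Definition box_RInt (l : seq 'I_n) (g : vec n -> R) : vec n -> R :=
  foldr (fun i G x => RInt (fun s => G (upd x i s)) (- A) A) g l.

(** A regularity that ensures integrability in each coordinate and is kept by products, by [Rmax 0]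
    and by partial integration; smoothness itself is lost at the edge of the energy weight. *)
Definition loclip (g : vec n -> R) : Prop := forall rho, exists K, 0 <= K /\
  (forall x, inbox rho x -> Rabs (g x) <= K) /\
  forall x i s, inbox rho x -> Rabs s <= rho -> Rabs (g (upd x i s) - g x) <= K * Rabs (s - x i).

Lemma inbox_upd rho x i s : inbox rho x -> Rabs s <= rho -> inbox rho (upd x i s).
Proof. by move=> hx hs k; rewrite /upd; case: eqP. Qed.

Lemma inbox_le rho rho' x : rho <= rho' -> inbox rho x -> inbox rho' x.
Proof. by move=> h hx k; apply: Rle_trans h. Qed.

Lemma inbox_exists (x : vec n) : exists2 rho, 0 < rho & inbox rho x.
Proof. by have [W [W0 hW]] := finite_bound (fun k => Rabs (x k)); exists W. Qed.

Lemma Rabs_in s : - A <= s <= A -> Rabs s <= A.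
Proof. by move=> h; apply/Rabs_le_between. Qed.

Lemma loclip_line g x i s0 : loclip g -> continuous (fun s => g (upd x i s)) s0.
Proof.
move=> hg; have [r r0 hr] := inbox_exists x.
have [K [K0 [_ hK]]] := hg (r + Rabs s0 + 1).
apply: (@continuous_lip _ _ K 1) => [|s hs]; first lra.
have p := Rabs_pos s0.
have := hK (upd x i s0) i s; rewrite upd_upd upd_same; apply.
  by apply: inbox_upd; [apply: inbox_le hr|]; lra.
have -> : s = (s - s0) + s0 by ring.
by apply: Rle_trans (Rabs_triang _ _) _; lra.
Qed.

Lemma loclip_ex_RInt g x i a b : loclip g -> ex_RInt (fun s => g (upd x i s)) a b.
Proof. by move=> hg; apply: ex_RInt_continuous => z _; apply: loclip_line. Qed.

Lemma RInt_abs_le (g : R -> R) K : ex_RInt g (- A) A -> (forall s, - A <= s <= A -> Rabs (g s) <= K) ->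
  Rabs (RInt g (- A) A) <= 2 * A * K.
Proof.
move=> hg hK; have -> : 2 * A * K = (A - - A) * K by ring.
by apply: abs_RInt_le_const => //; lra.
Qed.

Lemma loclip_box_RInt1 g i : loclip g -> loclip (fun x => RInt (fun s => g (upd x i s)) (- A) A).
Proof.
move=> hg rho; have [K [K0 [hb hK]]] := hg (Rabs rho + A).
have p := Rabs_pos rho; have q := Rle_abs rho.
exists (2 * A * K); split; first by nra.
have hin x s : inbox rho x -> - A <= s <= A -> inbox (Rabs rho + A) (upd x i s).
  move=> hx hs; apply: inbox_upd; first by apply: inbox_le hx; lra.
  by apply: Rle_trans (Rabs_in hs) _; lra.
split=> [x hx|x k s' hx hs'].
  by apply: RInt_abs_le => [|s hs]; [exact: loclip_ex_RInt | apply: hb; exact: hin].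
case: (eqVneq k i) => [->|ki].
  rewrite (RInt_ext _ (fun s => g (upd x i s))); last by move=> s _; rewrite upd_upd.
  by rewrite Rminus_diag Rabs_R0; apply: Rmult_le_pos; [nra | exact: Rabs_pos].
have -> : RInt (fun s => g (upd (upd x k s') i s)) (- A) A - RInt (fun s => g (upd x i s)) (- A) A =
   RInt (fun s => g (upd (upd x k s') i s) - g (upd x i s)) (- A) A.
  by symmetry; apply: RInt_minus; exact: loclip_ex_RInt.
rewrite Rmult_assoc; apply: RInt_abs_le => [|s hs].
  by apply: @ex_RInt_minus; exact: loclip_ex_RInt.
rewrite upd_comm //; have := hK (upd x i s) k s'; rewrite upd_neq //; apply; first exact: hin.
by lra.
Qed.

Lemma loclip_box_RInt l g : loclip g -> loclip (box_RInt l g).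
Proof. by move=> hg; elim: l => //= i l; apply: loclip_box_RInt1. Qed.

Lemma box_RInt_plus l g h : loclip g -> loclip h -> forall x, box_RInt l (fun x => g x + h x) x = box_RInt l g x + box_RInt l h x.
Proof.
move=> hg hh; elim: l => //= i l IH x.
rewrite (RInt_ext _ (fun s => plus (box_RInt l g (upd x i s)) (box_RInt l h (upd x i s)))); last by move=> s _; rewrite IH.
by apply: (@RInt_plus R_CompleteNormedModule); apply: loclip_ex_RInt; apply: loclip_box_RInt.
Qed.

Lemma box_RInt_scal l c g : loclip g -> forall x, box_RInt l (fun x => c * g x) x = c * box_RInt l g x.
Proof.
move=> hg; elim: l => //= i l IH x.
rewrite (RInt_ext _ (fun s => scal c (box_RInt l g (upd x i s)))); last by move=> s _; rewrite IH.
by apply: (@RInt_scal R_CompleteNormedModule); apply: loclip_ex_RInt; apply: loclip_box_RInt.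
Qed.

Lemma in_segment s : Rmin (- A) A < s < Rmax (- A) A -> - A <= s <= A.
Proof. by rewrite Rmin_left ?Rmax_right; lra. Qed.

Lemma box_RInt_ext l g h x : (forall y, inbox A y -> g y = h y) -> inbox A x -> box_RInt l g x = box_RInt l h x.
Proof.
move=> e; elim: l x => [|i l IH] x hx /=; first exact: e.
by apply: RInt_ext => s /in_segment hs; apply: IH; apply: inbox_upd => //; exact: Rabs_in.
Qed.

Lemma box_RInt_le l g h x : loclip g -> loclip h -> (forall y, inbox A y -> g y <= h y) -> inbox A x -> box_RInt l g x <= box_RInt l h x.
Proof.
move=> hg hh e; elim: l x => [|i l IH] x hx /=; first exact: e.
apply: RInt_le; first lra.
- by apply: loclip_ex_RInt; apply: loclip_box_RInt.
- by apply: loclip_ex_RInt; apply: loclip_box_RInt.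
- by move=> s hs; apply: IH; apply: inbox_upd => //; apply: Rabs_in; lra.
Qed.

Lemma box_RInt_bound l g K x : loclip g -> (forall y, inbox A y -> Rabs (g y) <= K) -> inbox A x ->
  Rabs (box_RInt l g x) <= (2 * A) ^ size l * K.
Proof.
move=> hg hK; elim: l x => [|i l IH] x hx; first by rewrite /= Rmult_1_l; exact: hK.
rewrite /= Rmult_assoc; apply: RInt_abs_le => [|s hs].
  by apply: loclip_ex_RInt; apply: loclip_box_RInt.
by apply: IH; apply: inbox_upd => //; exact: Rabs_in.
Qed.

Lemma loclip_const c : loclip (fun _ => c).
Proof.
move=> rho; exists (Rabs c); split; first exact: Rabs_pos.
split=> [x _|x i s _ _]; first exact: Rle_refl.
by rewrite Rminus_diag Rabs_R0; apply: Rmult_le_pos; exact: Rabs_pos.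
Qed.

Lemma loclip_plus g h : loclip g -> loclip h -> loclip (fun x => g x + h x).
Proof.
move=> hg hh rho; have [K [K0 [b1 l1]]] := hg rho; have [L [L0 [b2 l2]]] := hh rho.
exists (K + L); split; first lra.
split=> [x hx|x i s hx hs].
  by apply: Rle_trans (Rabs_triang _ _) _; apply: Rplus_le_compat; auto.
have -> : g (upd x i s) + h (upd x i s) - (g x + h x) = (g (upd x i s) - g x) + (h (upd x i s) - h x) by ring.
apply: Rle_trans (Rabs_triang _ _) _; rewrite Rmult_plus_distr_r.
by apply: Rplus_le_compat; auto.
Qed.

Lemma loclip_mult g h : loclip g -> loclip h -> loclip (fun x => g x * h x).
Proof.
move=> hg hh rho; have [K [K0 [b1 l1]]] := hg rho; have [L [L0 [b2 l2]]] := hh rho.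
exists (2 * K * L); split; first by nra.
split=> [x hx|x i s hx hs].
  by rewrite Rabs_mult; have := b1 x hx; have := b2 x hx; have := Rabs_pos (g x); have := Rabs_pos (h x); nra.
have -> : g (upd x i s) * h (upd x i s) - g x * h x =
   g (upd x i s) * (h (upd x i s) - h x) + (g (upd x i s) - g x) * h x by ring.
apply: Rle_trans (Rabs_triang _ _) _; rewrite !Rabs_mult.
have := b1 _ (inbox_upd i hx hs); have := b2 _ hx; have := l1 x i s hx hs; have := l2 x i s hx hs.
move: (Rabs_pos (g (upd x i s))) (Rabs_pos (h x)) (Rabs_pos (s - x i)) (Rabs_pos (h (upd x i s) - h x)) (Rabs_pos (g (upd x i s) - g x)).
move: (Rabs (g (upd x i s))) (Rabs (h x)) (Rabs (s - x i)) (Rabs (h _ - _)) (Rabs (_ - g x)) => a b c d e.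
move=> a0 b0 c0 d0 e0 h1 h2 h3 h4.
have : a * d <= K * (L * c) by apply: Rmult_le_compat.
have : e * b <= (K * c) * L by apply: Rmult_le_compat.
by lra.
Qed.

Lemma loclip_scal c g : loclip g -> loclip (fun x => c * g x).
Proof. by move=> hg; apply: loclip_mult => //; apply: loclip_const. Qed.

Lemma loclip_sum (s : seq 'I_n) (g : 'I_n -> vec n -> R) : (forall i, loclip (g i)) ->
  loclip (fun x => \big[Rplus/0]_(i <- s) g i x).
Proof.
move=> hg; elim: s => [|i s IH].
  have -> : (fun x : vec n => \big[Rplus/0]_(i <- [::]) g i x) = fun _ => 0.
    by apply: functional_extensionality => x; rewrite big_nil.
  exact: loclip_const.
have -> : (fun x => \big[Rplus/0]_(k <- i :: s) g k x) = fun x => g i x + \big[Rplus/0]_(k <- s) g k x.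
  by apply: functional_extensionality => x; rewrite big_cons.
exact: loclip_plus.
Qed.

Lemma box_RInt_sum l (s : seq 'I_n) (g : 'I_n -> vec n -> R) x : (forall i, loclip (g i)) ->
  box_RInt l (fun x => \big[Rplus/0]_(i <- s) g i x) x = \big[Rplus/0]_(i <- s) box_RInt l (g i) x.
Proof.
move=> hg; elim: s => [|i s IH].
  have -> : (fun x : vec n => \big[Rplus/0]_(i <- [::]) g i x) = fun x : vec n => 0 * 1.
    by apply: functional_extensionality => y; rewrite big_nil; ring.
  by rewrite (@box_RInt_scal l 0 (fun _ => 1)) ?big_nil; [ring | exact: loclip_const].
have -> : (fun x => \big[Rplus/0]_(k <- i :: s) g k x) = fun x => g i x + \big[Rplus/0]_(k <- s) g k x.
  by apply: functional_extensionality => y; rewrite big_cons.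
by rewrite box_RInt_plus ?IH ?big_cons //; apply: loclip_sum.
Qed.

Lemma loclip_coord i : loclip (fun x => x i).
Proof.
move=> rho; exists (Rmax 1 rho); split; first by apply: Rle_trans (Rmax_l _ _); lra.
split=> [x hx|x k s hx hs]; first exact: Rle_trans (hx i) (Rmax_r _ _).
have h1 := Rmax_l 1 rho; have h2 := Rabs_pos (s - x k).
rewrite /upd; case: eqP => [->|_]; first by nra.
by rewrite Rminus_diag Rabs_R0; nra.
Qed.

Lemma loclip_max0 g : loclip g -> loclip (fun x => Rmax 0 (g x)).
Proof.
move=> hg rho; have [K [K0 [b1 l1]]] := hg rho.
have lip a b : Rabs (Rmax 0 a - Rmax 0 b) <= Rabs (a - b).
  unfold Rmax, Rabs; destruct (Rle_dec 0 a), (Rle_dec 0 b); repeat destruct Rcase_abs; lra.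
exists K; split => //; split => [x hx|x i s hx hs].
  apply: Rle_trans (b1 x hx); have := lip (g x) 0.
  by rewrite (Rmax_left 0 0) ?Rminus_0_r //; lra.
exact: Rle_trans (lip _ _) (l1 x i s hx hs).
Qed.

Lemma loclip_smooth (f : vec n -> C) : smooth f -> loclip (fun x => Re (f x)).
Proof.
move=> sf rho.
(* A point [s'] of the segment used below satisfies [Rabs s' <= Rabs (s - x i) + Rabs (x i) <= 3 *
   Rabs rho]. *)
have [B hB] := locb_bounded (@smooth_locb n f [::] sf) (3 * Rabs rho).
have [D hD] : exists D, forall i x, inbox (3 * Rabs rho) x -> Cmod (pd i f x) <= D.
  have H i : exists B, forall x, inbox (3 * Rabs rho) x -> Cmod (pd i f x) <= B.
    exact: locb_bounded (@smooth_locb n f [:: i] sf) (3 * Rabs rho).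
  have [W [W0 hW]] := finite_bound (fun i => proj1_sig (constructive_indefinite_description _ (H i))).
  exists W => i x hx; apply: Rle_trans (hW i).
  by case: constructive_indefinite_description => b hb; exact: hb.
have p := Rabs_pos rho; have q := Rle_abs rho.
exists (Rabs B + 2 * Rabs D); split; first by have := Rabs_pos B; have := Rabs_pos D; lra.
split=> [x hx|x i s hx hs].
  have h1 : inbox (3 * Rabs rho) x by apply: inbox_le hx; lra.
  apply: Rle_trans (Re_le_Cmod _) _; have := hB x h1.
  by have := Rle_abs B; have := Rabs_pos D; rewrite /=; lra.
have := @lip_of_isD (fun s => f (upd x i s)) (fun s => pd i f (upd x i s)) (x i) (Rabs (s - x i)) D
  (fun s _ => is_pd_line x s (fun y => smooth_is_pd1 i y sf)) _ s (Rle_refl _).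
rewrite upd_id => H.
apply: Rle_trans (_ : Cmod (f (upd x i s) - f x)%C <= _); first exact: (Re_le_Cmod (f (upd x i s) - f x)).
apply: Rle_trans (H _) _ => [s' hs'|].
  apply: hD; apply: inbox_upd; first by apply: inbox_le hx; lra.
  have -> : s' = (s' - x i) + x i by ring.
  apply: Rle_trans (Rabs_triang _ _) _; have := hx i.
  have := Rabs_triang s (- x i); rewrite Rabs_Ropp; move: hs'; rewrite /Rminus; lra.
by apply: Rmult_le_compat_r; [exact: Rabs_pos | have := Rle_abs D; have := Rabs_pos B; lra].
Qed.

(** Differentiability in a parameter, uniform over the box: exactly what differentiation under
    [box_RInt] uses. The bounds on [phi] and [dphi] are included to make the notion stable under
    products. *)
Definition udiff (phi : R -> vec n -> R) (s0 : R) (dphi : vec n -> R) : Prop :=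
  exists K, 0 <= K /\ forall y h, inbox A y -> Rabs h <= 1 ->
    [/\ Rabs (phi (s0 + h) y) <= K, Rabs (dphi y) <= K &
        Rabs (phi (s0 + h) y - phi s0 y - h * dphi y) <= K * h ^ 2].

Lemma udiff_plus phi psi s0 dphi dpsi : udiff phi s0 dphi -> udiff psi s0 dpsi ->
  udiff (fun s y => phi s y + psi s y) s0 (fun y => dphi y + dpsi y).
Proof.
move=> [K [K0 hK]] [L [L0 hL]]; exists (K + L); split; first lra.
move=> y h hy hh; have [a1 a2 a3] := hK y h hy hh; have [b1 b2 b3] := hL y h hy hh; split.
- by apply: Rle_trans (Rabs_triang _ _) _; lra.
- by apply: Rle_trans (Rabs_triang _ _) _; lra.
- have -> : phi (s0 + h) y + psi (s0 + h) y - (phi s0 y + psi s0 y) - h * (dphi y + dpsi y) =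
    (phi (s0 + h) y - phi s0 y - h * dphi y) + (psi (s0 + h) y - psi s0 y - h * dpsi y) by ring.
  by apply: Rle_trans (Rabs_triang _ _) _; lra.
Qed.

(** The remainder splits into four terms of size at most [K * L * h ^ 2]; in the last of them
    [Rabs h <= 1] absorbs the third power of [h]. *)
Lemma udiff_mult phi psi s0 dphi dpsi : udiff phi s0 dphi -> udiff psi s0 dpsi ->
  udiff (fun s y => phi s y * psi s y) s0 (fun y => dphi y * psi s0 y + phi s0 y * dpsi y).
Proof.
move=> [K [K0 hK]] [L [L0 hL]]; exists (4 * K * L); split; first by nra.
move=> y h hy hh; have [a1 a2 a3] := hK y h hy hh; have [b1 b2 b3] := hL y h hy hh.
have z0 : Rabs 0 <= 1 by rewrite Rabs_R0; lra.
have [a0 _ _] := hK y 0 hy z0; have [b0 _ _] := hL y 0 hy z0; rewrite Rplus_0_r in a0 b0.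
have KL : 0 <= K * L by nra.
have mu a b : Rabs a <= K -> Rabs b <= L -> Rabs (a * b) <= K * L.
  by move=> ha hb; rewrite Rabs_mult; apply: Rmult_le_compat => //; exact: Rabs_pos.
split.
- by apply: Rle_trans (mu _ _ a1 b1) _; lra.
- by apply: Rle_trans (Rabs_triang _ _) _; have := mu _ _ a2 b0; have := mu _ _ a0 b2; lra.
- set u := phi _ _ - _ - _ in a3; set v := psi _ _ - _ - _ in b3.
  have -> : phi (s0 + h) y * psi (s0 + h) y - phi s0 y * psi s0 y - h * (dphi y * psi s0 y + phi s0 y * dpsi y) =
    u * psi (s0 + h) y + (phi s0 y * v + (h * h) * (dphi y * dpsi y) + h * dphi y * v) by rewrite /u /v; ring.
  have hp := pow2_ge_0 h.
  have e1 : Rabs (u * psi (s0 + h) y) <= K * h ^ 2 * L.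
    by rewrite Rabs_mult; apply: Rmult_le_compat => //; exact: Rabs_pos.
  have e2 : Rabs (phi s0 y * v) <= K * (L * h ^ 2).
    by rewrite Rabs_mult; apply: Rmult_le_compat => //; exact: Rabs_pos.
  have e3 : Rabs (h * h * (dphi y * dpsi y)) <= h ^ 2 * (K * L).
    rewrite Rabs_mult; apply: Rmult_le_compat; try exact: Rabs_pos; last exact: mu.
    by rewrite Rabs_pos_eq; nra.
  have e4 : Rabs (h * dphi y * v) <= 1 * K * (L * h ^ 2).
    rewrite Rabs_mult; apply: Rmult_le_compat => //; try exact: Rabs_pos.
    by rewrite Rabs_mult; apply: Rmult_le_compat => //; exact: Rabs_pos.
  apply: Rle_trans (Rabs_triang _ _) _; apply: Rle_trans (Rplus_le_compat _ _ _ _ e1 (Rabs_triang _ _)) _.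
  have := Rabs_triang (phi s0 y * v) (h * h * (dphi y * dpsi y)); lra.
Qed.

Lemma udiff_const s0 (c : vec n -> R) K : (forall y, inbox A y -> Rabs (c y) <= K) ->
  udiff (fun _ => c) s0 (fun _ => 0).
Proof.
move=> hc; exists (Rabs K); split; first exact: Rabs_pos.
move=> y h hy hh; split.
- by apply: Rle_trans (hc y hy) (Rle_abs _).
- by rewrite Rabs_R0; exact: Rabs_pos.
- rewrite (_ : c y - c y - h * 0 = 0); last by ring.
  by rewrite Rabs_R0; apply: Rmult_le_pos; [exact: Rabs_pos | exact: pow2_ge_0].
Qed.

Lemma udiff_sum (l : seq 'I_n) (phi : 'I_n -> R -> vec n -> R) s0 dphi : (forall i, udiff (phi i) s0 (dphi i)) ->
  udiff (fun s y => \big[Rplus/0]_(i <- l) phi i s y) s0 (fun y => \big[Rplus/0]_(i <- l) dphi i y).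
Proof.
move=> H; elim: l => [|i l IH].
  have [K [K0 hK]] := @udiff_const s0 (fun _ => 0) 0 (fun _ _ => Req_le _ _ Rabs_R0).
  by exists K; split => // y h hy hh; rewrite !big_nil; exact: (hK y h hy hh).
have [L [L0 hL]] := udiff_plus (H i) IH.
by exists L; split => // y h hy hh; rewrite !big_cons; exact: hL.
Qed.

(** The square of the positive part has a Lipschitz derivative, by the inequality [m2]; this is why
    the energy weight is a square. *)
Lemma udiff_sqmax0 q s0 dq : udiff q s0 dq ->
  udiff (fun s y => Rmax 0 (q s y) ^ 2) s0 (fun y => 2 * Rmax 0 (q s0 y) * dq y).
Proof.
move=> [K [K0 hK]].
have m1 a : Rabs (Rmax 0 a) <= Rabs a.
  unfold Rmax, Rabs; destruct (Rle_dec 0 a); repeat destruct Rcase_abs; lra.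
have m2 a b : Rabs (Rmax 0 b ^ 2 - Rmax 0 a ^ 2 - 2 * Rmax 0 a * (b - a)) <= (b - a) ^ 2.
  apply/Rabs_le_between.
  case: (Rle_lt_dec 0 a) => ha; [rewrite (Rmax_right 0 a) //|rewrite (Rmax_left 0 a); last lra];
    (case: (Rle_lt_dec 0 b) => hb; [rewrite (Rmax_right 0 b) //|rewrite (Rmax_left 0 b); last lra]);
    try (have := Rmult_le_pos a (- b) ha ltac:(lra)); try (have := Rmult_le_pos b (- a) hb ltac:(lra));
    have := pow2_ge_0 (b - a); split; nra.
(* [4 * K ^ 2] comes from the squared increment of [q], [2 * K ^ 2] from its own Taylor
   remainder. *)
exists (6 * K ^ 2 + 0); split; first by nra.
move=> y h hy hh; have [a1 a2 a3] := hK y h hy hh.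
have [a0 _ _] := hK y 0 hy ltac:(rewrite Rabs_R0; lra); rewrite Rplus_0_r in a0.
have k1 : Rabs (Rmax 0 (q (s0 + h) y)) <= K := Rle_trans _ _ _ (m1 _) a1.
have k0 : Rabs (Rmax 0 (q s0 y)) <= K := Rle_trans _ _ _ (m1 _) a0.
split.
- rewrite -RPow_abs; have := pow_incr _ _ 2 (conj (Rabs_pos _) k1); nra.
- rewrite !Rabs_mult (Rabs_pos_eq 2); last lra.
  have : Rabs (Rmax 0 (q s0 y)) * Rabs (dq y) <= K * K by apply: Rmult_le_compat => //; exact: Rabs_pos.
  by nra.
- set b := q (s0 + h) y in a1 a3 k1 *; set a := q s0 y in a0 a3 k0 *.
  have -> : Rmax 0 b ^ 2 - Rmax 0 a ^ 2 - h * (2 * Rmax 0 a * dq y) =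
    (Rmax 0 b ^ 2 - Rmax 0 a ^ 2 - 2 * Rmax 0 a * (b - a)) + 2 * Rmax 0 a * (b - a - h * dq y) by ring.
  apply: Rle_trans (Rabs_triang _ _) _.
  have e1 := m2 a b.
  have e2 : Rabs (b - a) <= 2 * K * Rabs h.
    have -> : b - a = (b - a - h * dq y) + h * dq y by ring.
    apply: Rle_trans (Rabs_triang _ _) _; rewrite Rabs_mult.
    have : Rabs h * Rabs (dq y) <= Rabs h * K by apply: Rmult_le_compat_l => //; exact: Rabs_pos.
    move: a3; rewrite -(pow2_abs h); have := Rabs_pos h; move: (Rabs h) hh => hh' h1 h2 h3 h4.
    have : K * hh' ^ 2 <= K * hh' by apply: Rmult_le_compat_l => //=; nra.
    by lra.
  have e3 : (b - a) ^ 2 <= 4 * K ^ 2 * h ^ 2.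
    rewrite -(pow2_abs (b - a)) -(pow2_abs h).
    by have := pow_incr _ _ 2 (conj (Rabs_pos _) e2); rewrite Rpow_mult_distr; nra.
  have e4 : Rabs (2 * Rmax 0 a * (b - a - h * dq y)) <= 2 * K * (K * h ^ 2).
    rewrite Rabs_mult; apply: Rmult_le_compat => //; try exact: Rabs_pos.
    by rewrite Rabs_mult (Rabs_pos_eq 2); lra.
  nra.
Qed.

(** The bounds are asked up to distance 2 because [udiff] allows [Rabs h = 1] while [taylor_quad]
    works in an open interval. *)
Lemma udiff_taylor (f f1 f2 : R -> vec n -> C) s0 B :
  (forall s y, isD (fun s => f s y) s (f1 s y)) -> (forall s y, isD (fun s => f1 s y) s (f2 s y)) ->
  (forall s y, Rabs (s - s0) <= 1 + 1 -> inbox A y -> Cmod (f s y) <= B /\ Cmod (f1 s y) <= B /\ Cmod (f2 s y) <= B) ->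
  udiff (fun s y => Re (f s y)) s0 (fun y => Re (f1 s0 y)).
Proof.
move=> h1 h2 hB; exists (Rabs B); split; first exact: Rabs_pos.
have hBB := Rle_abs B.
move=> y h hy hh.
have [b1 _] := hB (s0 + h) y ltac:(rewrite (_ : s0 + h - s0 = h); [lra|ring]) hy.
have [_ [b2 _]] := hB s0 y ltac:(rewrite Rminus_diag Rabs_R0; lra) hy.
split.
- by apply: Rle_trans (Re_le_Cmod _) _; lra.
- by apply: Rle_trans (Re_le_Cmod _) _; lra.
- apply: (@taylor_quad (fun s => Re (f s y)) (fun s => Re (f1 s y)) (fun s => Re (f2 s y)) s0 (1 + 1) (Rabs B)).
  + by move=> s _; exact: (h1 s y).1.
  + by move=> s _; exact: (h2 s y).1.
  + move=> s hs; have [_ [_ b3]] := hB s y (Rlt_le _ _ hs) hy.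
    by apply: Rle_trans (Re_le_Cmod _) _; lra.
  + by lra.
Qed.

Lemma box_RInt_derive l phi s0 dphi x : (forall s, loclip (phi s)) -> loclip dphi -> udiff phi s0 dphi -> inbox A x ->
  is_derive (fun s => box_RInt l (phi s) x) s0 (box_RInt l dphi x).
Proof.
move=> lp ld [K [K0 hK]] hx.
apply: (@is_derive_quad _ _ _ ((2 * A) ^ size l * K) 1) => [|h hh]; first lra.
have -> : box_RInt l (phi (s0 + h)) x - box_RInt l (phi s0) x - h * box_RInt l dphi x =
   box_RInt l (fun y => phi (s0 + h) y + (-1 * phi s0 y + - h * dphi y)) x.
  rewrite box_RInt_plus //; last by apply: loclip_plus; exact: loclip_scal.
  by rewrite box_RInt_plus ?box_RInt_scal //; [ring | exact: loclip_scal | exact: loclip_scal].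
rewrite Rmult_assoc; apply: box_RInt_bound => //.
  by apply: loclip_plus => //; apply: loclip_plus; exact: loclip_scal.
move=> y hy; have [_ _ h3] := hK y h hy (Rlt_le _ _ hh).
by apply: Rle_trans h3; apply: Req_le; congr Rabs; ring.
Qed.

Lemma box_RInt_upd l i s g x : i \notin l -> box_RInt l g (upd x i s) = box_RInt l (fun y => g (upd y i s)) x.
Proof.
elim: l x => //= k l IH x; rewrite inE negb_or => /andP [ik il].
by apply: RInt_ext => t _; rewrite -IH // upd_comm // eq_sym.
Qed.

Lemma loclip_upd g i s : loclip g -> loclip (fun y => g (upd y i s)).
Proof.
move=> hg rho; have [K [K0 [b1 l1]]] := hg (Rabs rho + Rabs s).
have p1 := Rabs_pos rho; have p2 := Rabs_pos s; have p3 := Rle_abs rho.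
have hin x : inbox rho x -> inbox (Rabs rho + Rabs s) (upd x i s).
  by move=> hx; apply: inbox_upd; [apply: inbox_le hx | ]; lra.
exists K; split => //; split => [x hx|x k t hx ht]; first by apply: b1; exact: hin.
case: (eqVneq k i) => [->|ki].
  by rewrite upd_upd Rminus_diag Rabs_R0; apply: Rmult_le_pos => //; exact: Rabs_pos.
rewrite upd_comm //; have := l1 (upd x i s) k t (hin x hx); rewrite upd_neq //.
by apply; lra.
Qed.

(** A divergence theorem that needs no exchange of integrals: if [i] is the outermost variable, the
    inner integral of [dk] is the derivative of the inner integral of [k], which is 0 on both faces;
    otherwise the inner integral is already 0 pointwise. *)
Lemma box_RInt_pd l i k dk x : uniq l -> i \in l -> loclip k -> loclip dk ->
  (forall s0, Rabs s0 <= A -> udiff (fun s y => k (upd y i s)) s0 (fun y => dk (upd y i s0))) ->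
  (forall y, inbox A y -> Rabs (y i) = A -> k y = 0) -> inbox A x -> box_RInt l dk x = 0.
Proof.
move=> ul il lk ldk hq hk.
have J0 l' y : inbox A y -> box_RInt l' (fun _ => 0) y = 0.
  move=> hy; have := @box_RInt_scal l' 0 (fun _ => 1) (loclip_const 1) y.
  rewrite (_ : (fun _ : vec n => 0 * 1) = fun _ => 0); first by move=> ->; ring.
  by apply: functional_extensionality => z; ring.
elim: l ul il x => //= i' l IH /andP [ni ul]; rewrite inE => /orP [/eqP e|il] x hx; last first.
  rewrite (RInt_ext _ (fun _ => 0)); first by rewrite RInt_const /scal /= /mult /=; ring.
  by move=> s /in_segment hs; apply: IH => //; apply: inbox_upd => //; exact: Rabs_in.
subst i'.
have hd s : - A <= s <= A -> is_derive (fun s => box_RInt l (fun y => k (upd y i s)) x) s (box_RInt l dk (upd x i s)).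
  move=> hs; rewrite box_RInt_upd //; apply: box_RInt_derive => //.
  - by move=> t; apply: loclip_upd.
  - exact: loclip_upd.
  - by apply: hq; exact: Rabs_in.
have ha : A = A by [].
have e1 : is_RInt (fun s => box_RInt l dk (upd x i s)) (- A) A
    (minus (box_RInt l (fun y => k (upd y i A)) x) (box_RInt l (fun y => k (upd y i (- A))) x)).
  apply: (@is_RInt_derive R_CompleteNormedModule (fun s => box_RInt l (fun y => k (upd y i s)) x)) => s hs.
    by apply: hd; move: hs; rewrite Rmin_left ?Rmax_right; lra.
  by apply: loclip_line; apply: loclip_box_RInt.
rewrite (is_RInt_unique _ _ _ _ e1).
have face t : Rabs t = A -> box_RInt l (fun y => k (upd y i t)) x = 0.
  move=> ht; rewrite -(J0 l x hx); apply: box_RInt_ext => // y hy; apply: hk.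
    by apply: inbox_upd => //; rewrite ht; lra.
  by rewrite upd_same.
rewrite (face A); last by rewrite Rabs_pos_eq; lra.
rewrite (face (- A)); last by rewrite Rabs_Ropp Rabs_pos_eq; lra.
by rewrite /minus /plus /opp /=; ring.
Qed.

Lemma RInt_zero_pos (g : R -> R) : (forall s, continuous g s) -> (forall s, - A <= s <= A -> 0 <= g s) ->
  RInt g (- A) A = 0 -> forall s, - A < s < A -> g s = 0.
Proof.
move=> hc hp h0 s hs.
have ex a b : ex_RInt g a b by apply: ex_RInt_continuous => z _; exact: hc.
have H a b : - A <= a -> a <= b -> b <= A -> 0 <= RInt g a b.
  by move=> h1 h2 h3; apply: RInt_ge_0 => // t ht; apply: hp; lra.
have hF t : - A <= t <= A -> RInt g (- A) t = 0.
  move=> ht; have h1 := H (- A) t ltac:(lra) ltac:(lra) ltac:(lra).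
  have h2 := H t A ltac:(lra) ltac:(lra) ltac:(lra).
  have := @RInt_Chasles R_CompleteNormedModule g (- A) t A (ex _ _) (ex _ _).
  by rewrite /plus /= h0; lra.
have d1 : is_derive (fun t => RInt g (- A) t) s (g s).
  apply: (@is_derive_RInt R_NormedModule _ _ (- A)); last exact: hc.
  by apply: filter_forall => t; apply: RInt_correct; exact: ex.
have d2 : is_derive (fun t => RInt g (- A) t) s 0.
  apply: (is_derive_ext_loc (fun _ => 0)); last exact: is_derive_const.
  have e0 : 0 < Rmin (s + A) (A - s) by apply: Rmin_pos; lra.
  exists (mkposreal _ e0) => t ht.
  have h1 : Rabs (t - s) < Rmin (s + A) (A - s) := ht.
  have /Rabs_def2 h2 := Rlt_le_trans _ _ _ h1 (Rmin_l _ _).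
  have /Rabs_def2 h3 := Rlt_le_trans _ _ _ h1 (Rmin_r _ _).
  by rewrite hF //; lra.
by rewrite -(is_derive_unique _ _ _ d1) (is_derive_unique _ _ _ d2).
Qed.

(** One coordinate at a time: the primitive of the nonnegative inner integral is constant, so its
    derivative vanishes at interior points. *)
Lemma box_RInt_zero l g x : loclip g -> (forall y, inbox A y -> 0 <= g y) -> inbox A x -> box_RInt l g x = 0 ->
  forall y, (forall k, k \in l -> Rabs (y k) < A) -> (forall k, k \notin l -> y k = x k) -> g y = 0.
Proof.
move=> hg hp; elim: l x => [|i l IH] x hx /= h0 y h1 h2.
  have -> : y = x by apply: functional_extensionality => k; exact: h2.
  exact: h0.
have hyi : Rabs (y i) < A by apply: h1; rewrite inE eqxx.
apply: (IH (upd x i (y i))).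
- by apply: inbox_upd => //; lra.
- apply: (@RInt_zero_pos (fun s => box_RInt l g (upd x i s))) => //.
  + by move=> s; apply: loclip_line; apply: loclip_box_RInt.
  + move=> s hs.
    have hx' : inbox A (upd x i s) by apply: inbox_upd => //; exact: Rabs_in.
    apply: Rle_trans (box_RInt_le l (loclip_const 0) hg hp hx'); apply: Req_le; symmetry.
    have := @box_RInt_scal l 0 (fun _ => 1) (loclip_const 1) (upd x i s).
    rewrite (_ : (fun _ : vec n => 0 * 1) = fun _ => 0); first by move=> ->; ring.
    by apply: functional_extensionality => z; ring.
  + by have := Rabs_def2 _ _ hyi; lra.
- by move=> k hk; apply: h1; rewrite inE hk orbT.
- move=> k hk; rewrite /upd; case: eqP => [->//|/eqP ki].
  by apply: h2; rewrite inE negb_or ki hk.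
Qed.

End BoxIntegral.

(** * Finite propagation speed *)

Lemma test_pd n i (f : vec n -> C) : test_fun f -> test_fun (pd i f).
Proof. by move=> /test_testA [A _ hA]; apply: testA_test (testA_pds [:: i] hA). Qed.

Lemma test_scal n c (f : vec n -> C) : test_fun f -> test_fun (fun x => c * f x)%C.
Proof. by move=> /test_testA [A _ hA]; apply: testA_test (testA_scal c hA). Qed.

Lemma test_plus n (f g : vec n -> C) : test_fun f -> test_fun g -> test_fun (fun x => f x + g x)%C.
Proof.
move=> /test_testA [A _ hA] /test_testA [B _ hB].
by apply: testA_test (testA_plus (testA_le (Rmax_l A B) hA) (testA_le (Rmax_r A B) hB)).
Qed.

Lemma sumR0 (T : Type) (s : seq T) (F : T -> R) : (forall i, F i = 0) -> \big[Rplus/0]_(i <- s) F i = 0.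
Proof. by move=> h; elim: s => [|i s IH]; rewrite ?big_nil // big_cons IH h Rplus_0_l. Qed.

(** Pointwise energy balance, with [P] the time derivative of a wave, [Q i] its gradient, [q i] the
    gradient of [P] and [Qii i] the pure second derivatives. Subtracting twice the divergence of
    [chi * P * Q] leaves only the terms in which the weight is differentiated in space. *)
Lemma energy_identity (T : Type) (s : seq T) (chi P : R) (Q Qii q dchi : T -> R) :
  chi * ((\big[Rplus/0]_(i <- s) Qii i * P + P * \big[Rplus/0]_(i <- s) Qii i)
     + \big[Rplus/0]_(i <- s) (q i * Q i + Q i * q i))
  + \big[Rplus/0]_(i <- s) (-2 * ((dchi i * P + chi * q i) * Q i + chi * P * Qii i))
  = -2 * P * \big[Rplus/0]_(i <- s) (dchi i * Q i).
Proof.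
elim: s => [|i s]; first by rewrite !big_nil; ring.
rewrite !big_cons.
set a := bigop _ _ _; set b := bigop _ _ _; set c := bigop _ _ _; set d := bigop _ _ _.
move=> IH; rewrite (_ : -2 * P * (dchi i * Q i + d) = -2 * P * (dchi i * Q i) + -2 * P * d); last by ring.
by rewrite -IH; ring.
Qed.

(** Termwise the difference of the two sides is [(y i * P - rho * Q i) ^ 2 / rho]. Where
    [|y| <= rho] the flux is thus dominated by what the shrinking weight takes away. *)
Lemma energy_am_gm (T : Type) (s : seq T) (rho P : R) (y Q : T -> R) : 0 < rho ->
  2 * P * \big[Rplus/0]_(i <- s) (y i * Q i) <=
  \big[Rplus/0]_(i <- s) (y i) ^ 2 / rho * (P * P) + rho * \big[Rplus/0]_(i <- s) (Q i * Q i).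
Proof.
move=> r0; elim: s => [|i s]; first by rewrite !big_nil; lra.
rewrite !big_cons.
set a := bigop _ _ _; set b := bigop _ _ _; set c := bigop _ _ _.
move=> IH.
have h : 2 * P * (y i * Q i) <= y i ^ 2 / rho * (P * P) + rho * (Q i * Q i).
  have e : y i ^ 2 / rho * (P * P) + rho * (Q i * Q i) - 2 * P * (y i * Q i) = (y i * P - rho * Q i) ^ 2 / rho.
    by field; apply: Rgt_not_eq.
  have : 0 <= (y i * P - rho * Q i) ^ 2 / rho by apply: Rdiv_le_0_compat => //; exact: pow2_ge_0.
  by rewrite -e; lra.
rewrite (_ : (y i ^ 2 + b) / rho * (P * P) = y i ^ 2 / rho * (P * P) + b / rho * (P * P)); last by rewrite /Rdiv; ring.
by clearbody a b c; lra.
Qed.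

(** * The energy estimate for the real part *)

Section FinitePropagation.
Variables (n : nat) (Ew : R -> functional n).
Hypothesis hEw : wave_fundamental_solution Ew.
Variables (m : nat) (e : vec n -> vec m) (j : 'I_n -> 'I_m).
Hypothesis he : embedding e j.

Local Notation Wv := (W Ew e).

Lemma W_0 f z : test_fun f -> Wv false f z 0 = f z.
Proof.
move=> tf; case: hEw => _ [_ [_ [h _]]].
rewrite /W /Tw (h _ (test_slice he z tf)) /dirac /slice; congr f.
by apply: functional_extensionality => k; rewrite (emb_zero he); ring.
Qed.

Lemma W1_0 f z : test_fun f -> Wv true f z 0 = 0.
Proof.
by move=> tf; case: hEw => _ [_ [_ [_ h]]]; exact: (h _ (test_slice he z tf)).
Qed.

Lemma W_lap f z r : test_fun f -> Wv false (lap j f) z r = sumC (fun i => Wv false (pd (j i) (pd (j i) f)) z r).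
Proof.
move=> tf; have [A _ hA] := test_testA tf.
have [Z [Z0 hZ]] := finite_bound (fun k => Rabs (z k)).
apply: (@dist_sum n (Ew r) _ _ _ (fun i => slice e (pd (j i) (pd (j i) f)) z)).
  exact: Ew_dist.
by move=> i; apply: (testA_slice he _ hZ); exact: (testA_pds [:: j i; j i] hA).
Qed.

(** The sign [sg] selects the direction in which [r] runs, so that one estimate for [0 <= r < rad]
    covers both. *)
Variables (z : vec m) (sg rad : R).
Hypothesis sg2 : sg * sg = 1.
Hypothesis rad0 : 0 < rad.

Let Z (y : vec n) : vec m := fun k => z k + e y k.
(** The box strictly contains the ball of radius [rad], so that the weight vanishes on its faces. *)
Let A := rad + 1.
Let A0 : 0 < A. Proof. rewrite /A; lra. Qed.

Let Z_bounded : exists2 B, 0 < B & forall y k, inbox A y -> Rabs (Z y k) <= B.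
Proof.
have [B [B0 hB]] := finite_bound (fun k => Rabs (z k)).
exists (B + (A + 1)); first by have := A0; lra.
move=> y k hy; apply: Rle_trans (Rabs_triang _ _) _; apply: Rplus_le_compat; first exact: hB.
have := @emb_near _ _ _ _ he (fun _ => 0) (A + 1) y ltac:(have := A0; lra).
move=> h; have := h _ k; rewrite (emb_zero he) Rminus_0_r => h2.
by apply: Rlt_le; apply: h2 => i; rewrite Rminus_0_r; have := hy i; lra.
Qed.

(** The constant [c] collects the factors [sg] produced by derivatives in [r]. *)
Let w (c : C) a f (r : R) (y : vec n) : C := (c * Wv a f (Z y) (sg * r))%C.

Let w_bounded c a f r0 : test_fun f ->
  exists B, forall r y, Rabs (r - r0) <= 2 -> inbox A y -> Cmod (w c a f r y) <= B.
Proof.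
move=> tf; have [B B0 hB] := Z_bounded.
have [K hK] := W_bounded hEw he B (Rabs sg * (Rabs r0 + 2)) tf.
exists (Cmod c * K) => r y hr hy; rewrite /w Cmod_mult; apply: Rmult_le_compat_l; first exact: Cmod_ge_0.
apply: hK => [k|]; first exact: hB.
rewrite Rabs_mult; apply: Rmult_le_compat_l; first exact: Rabs_pos.
have -> : r = (r - r0) + r0 by ring.
by apply: Rle_trans (Rabs_triang _ _) _; lra.
Qed.

Let w_smooth c a f r : test_fun f -> smooth (w c a f r).
Proof.
move=> tf; apply: smooth_scal.
exact: (slice_smooth he z (W_smooth hEw he a (sg * r) tf)).
Qed.

Let w_loclip c a f r : test_fun f -> loclip (fun y => Re (w c a f r y)).
Proof. by move=> tf; apply: loclip_smooth; exact: w_smooth. Qed.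

Let w_isD c a f r y : test_fun f ->
  isD (fun r => w c a f r y) r (w (c * RtoC sg)%C (~~ a) (dr j a f) r y).
Proof.
move=> tf; rewrite /w -Cmult_assoc; apply: isD_scal.
apply: (@isD_comp (Wv a f (Z y)) (fun r => sg * r)); first exact: (W_isD_r hEw he).
by auto_derive => //; ring.
Qed.

Let w_is_pd c a f r i y : test_fun f -> is_pd i (w c a f r) y (w c a (pd (j i) f) r y).
Proof.
move=> tf; apply: isD_scal.
apply: (@slice_is_pd n m e j he i (fun z => Wv a f z (sg * r)) (fun z => Wv a (pd (j i) f) z (sg * r)) z y).
by move=> x; exact: (W_is_pd hEw he).
Qed.

Let udiff_r c a f r : test_fun f -> udiff A (fun r y => Re (w c a f r y)) r
  (fun y => Re (w (c * RtoC sg)%C (~~ a) (dr j a f) r y)).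
Proof.
move=> tf; have tg := test_dr j a tf.
have [B1 h1] := w_bounded c a r tf.
have [B2 h2] := w_bounded (c * RtoC sg)%C (~~ a) r tg.
have [B3 h3] := w_bounded (c * RtoC sg * RtoC sg)%C (~~ ~~ a) r (test_dr j (~~ a) tg).
apply: (@udiff_taylor n A (w c a f) (w (c * RtoC sg)%C (~~ a) (dr j a f))
   (w (c * RtoC sg * RtoC sg)%C (~~ ~~ a) (dr j (~~ a) (dr j a f))) r (Rmax B1 (Rmax B2 B3))).
- by move=> s y; exact: w_isD.
- by move=> s y; exact: w_isD.
- move=> s y hs hy; split; [|split].
  + by apply: Rle_trans (Rmax_l _ _); apply: h1 => //; lra.
  + by apply: Rle_trans (Rmax_r _ _); apply: Rle_trans (Rmax_l _ _); apply: h2 => //; lra.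
  + by apply: Rle_trans (Rmax_r _ _); apply: Rle_trans (Rmax_r _ _); apply: h3 => //; lra.
Qed.

Lemma udiff_smooth (g : vec n -> C) i s0 : smooth g -> Rabs s0 <= A ->
  udiff A (fun s y => Re (g (upd y i s))) s0 (fun y => Re (pd i g (upd y i s0))).
Proof.
move=> sg' hs0.
have H l : exists B, forall s y, Rabs (s - s0) <= 1 + 1 -> inbox A y -> Cmod (pds l g (upd y i s)) <= B.
  have [B hB] := locb_bounded (@smooth_locb n g l sg') (A + 2).
  exists B => s y hs hy; apply: hB; apply: inbox_upd; first by apply: inbox_le hy; lra.
  have -> : s = (s - s0) + s0 by ring.
  by apply: Rle_trans (Rabs_triang _ _) _; lra.
have [B1 h1] := H [::]; have [B2 h2] := H [:: i]; have [B3 h3] := H [:: i; i].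
apply: (@udiff_taylor n A (fun s y => g (upd y i s)) (fun s y => pd i g (upd y i s))
  (fun s y => pd i (pd i g) (upd y i s)) s0 (Rmax B1 (Rmax B2 B3))).
- by move=> s y; apply: is_pd_line => x; exact: smooth_is_pd1.
- by move=> s y; apply: is_pd_line => x; apply: smooth_is_pd1; exact: smooth_pd.
- move=> s y hs hy; split; [|split].
  + by apply: Rle_trans (Rmax_l _ _); exact: h1.
  + by apply: Rle_trans (Rmax_r _ _); apply: Rle_trans (Rmax_l _ _); exact: h2.
  + by apply: Rle_trans (Rmax_r _ _); apply: Rle_trans (Rmax_r _ _); exact: h3.
Qed.

(* The energy is taken with the weight [chi], supported in the ball of radius
   [rad - r] and C^1 up to the lateral boundary. *)
Let qd (r : R) (y : vec n) := (rad - r) ^ 2 + -1 * \big[Rplus/0]_(i < n) (y i * y i).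
Let chi r y := Rmax 0 (qd r y) ^ 2.

Let loclip_qd r : loclip (qd r).
Proof.
apply: loclip_plus; first exact: loclip_const.
by apply: loclip_scal; apply: loclip_sum => i; apply: loclip_mult; exact: loclip_coord.
Qed.

Let loclip_chi r : loclip (chi r).
Proof.
have -> : chi r = fun y => Rmax 0 (qd r y) * Rmax 0 (qd r y).
  by apply: functional_extensionality => y; rewrite /chi /=; ring.
by apply: loclip_mult; apply: loclip_max0; exact: loclip_qd.
Qed.

Let coord_bounded i (y : vec n) : inbox A y -> Rabs (y i * y i) <= A * A.
Proof. by move=> hy; rewrite Rabs_mult; apply: Rmult_le_compat => //; exact: Rabs_pos. Qed.

Let udiff_qd_r r : udiff A qd r (fun _ => -2 * (rad - r)).
Proof.
have h1 : udiff A (fun s (_ : vec n) => (rad - s) ^ 2) r (fun _ => -2 * (rad - r)).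
  exists ((Rabs (rad - r) + 1) ^ 2 + 2 * Rabs (rad - r) + 1).
  have p := Rabs_pos (rad - r).
  split; first by nra.
  move=> y h _ hh; split.
  - rewrite -RPow_abs; have : Rabs (rad - (r + h)) <= Rabs (rad - r) + 1.
      have -> : rad - (r + h) = (rad - r) + - h by ring.
      by apply: Rle_trans (Rabs_triang _ _) _; rewrite Rabs_Ropp; lra.
    move=> h1; have := pow_incr _ _ 2 (conj (Rabs_pos _) h1); lra.
  - rewrite Rabs_mult Rabs_left; last lra.
    by have := pow2_ge_0 (Rabs (rad - r) + 1); lra.
  - have -> : (rad - (r + h)) ^ 2 - (rad - r) ^ 2 - h * (-2 * (rad - r)) = h ^ 2 by ring.
    rewrite Rabs_pos_eq; last exact: pow2_ge_0.
    by have := pow2_ge_0 h; have := pow2_ge_0 (Rabs (rad - r) + 1); nra.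
have [K hK] : exists K, forall y : vec n, inbox A y -> Rabs (-1 * \big[Rplus/0]_(i < n) (y i * y i)) <= K.
  have [K [_ [hK _]]] := loclip_scal (-1) (@loclip_sum n (index_enum 'I_n) (fun i y => y i * y i)
    (fun i => loclip_mult (loclip_coord i) (loclip_coord i))) A.
  by exists K.
have := udiff_plus h1 (udiff_const r hK).
by case=> L [L0 hL]; exists L; split => // y h hy hh; have := hL y h hy hh; rewrite Rplus_0_r.
Qed.

Let udiff_coord k i s0 : Rabs s0 <= A ->
  udiff A (fun s (y : vec n) => upd y i s k * upd y i s k) s0 (fun y => if k == i then 2 * s0 else 0).
Proof.
move=> hs0; exists ((A + 1) ^ 2 + 2 * A); split; first by have := A0; nra.
have a0 := A0; move=> y h hy hh; rewrite /upd; case: eqP => [_|_]; split.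
- rewrite Rabs_mult; have : Rabs (s0 + h) <= A + 1 by apply: Rle_trans (Rabs_triang _ _) _; lra.
  by have := Rabs_pos (s0 + h); nra.
- by rewrite Rabs_mult (Rabs_pos_eq 2); nra.
- have -> : (s0 + h) * (s0 + h) - s0 * s0 - h * (2 * s0) = h ^ 2 by ring.
  by rewrite Rabs_pos_eq; have := pow2_ge_0 h; nra.
- by have := coord_bounded k hy; nra.
- by rewrite Rabs_R0; nra.
- have -> : y k * y k - y k * y k - h * 0 = 0 by ring.
  by rewrite Rabs_R0; have := pow2_ge_0 h; nra.
Qed.

Let udiff_qd_y r i s0 : Rabs s0 <= A ->
  udiff A (fun s y => qd r (upd y i s)) s0 (fun y => -2 * upd y i s0 i).
Proof.
move=> hs0.
have h2 := @udiff_sum n A (index_enum 'I_n) (fun k s y => upd y i s k * upd y i s k) s0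
  (fun k _ => if k == i then 2 * s0 else 0) (fun k => udiff_coord k i hs0).
have h1 : udiff A (fun s (_ : vec n) => -1) s0 (fun _ => 0).
  by apply: (@udiff_const n A s0 (fun _ => -1) 1) => y _; rewrite Rabs_left; lra.
have h3 : udiff A (fun s (_ : vec n) => (rad - r) ^ 2) s0 (fun _ => 0).
  by apply: (@udiff_const n A s0 (fun _ => (rad - r) ^ 2) (Rabs ((rad - r) ^ 2))) => y _; exact: Rle_refl.
have [K [K0 hK]] := udiff_plus h3 (udiff_mult h1 h2).
have E : \big[Rplus/0]_(k < n) (if k == i then 2 * s0 else 0) = 2 * s0.
  have : forall s : seq 'I_n, uniq s -> \big[Rplus/0]_(k <- s) (if k == i then 2 * s0 else 0) =
     if i \in s then 2 * s0 else 0.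
    elim=> [|k s IH] /=; first by rewrite big_nil.
    move=> /andP [ks us]; rewrite big_cons inE IH // eq_sym; case: eqP => [e0|_] /=; last by rewrite Rplus_0_l.
    by rewrite e0 (negbTE ks) Rplus_0_r.
  by move=> ->; rewrite ?mem_index_enum // index_enum_uniq.
exists K; split => // y h hy hh; have := hK y h hy hh; rewrite E upd_same.
by rewrite (_ : 0 + (0 * _ + -1 * (2 * s0)) = -2 * s0) //; ring.
Qed.

Variable f : vec m -> C.
Hypothesis tf : test_fun f.
Hypothesis f0 : forall y, enorm y < rad -> f (Z y) = 0.

(** Real parts of derivatives of the solution [Wv false f (Z y) (sg * r)]: [P] in time, [Q i] in
    space; [Pr] and [Qr] are their time derivatives, [Qii] a pure second derivative in space. *)
Let P r y := Re (w (RtoC sg) true f r y).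
Let Q i r y := Re (w 1 false (pd (j i) f) r y).
Let Pr r y := Re (w (RtoC sg * RtoC sg)%C false (lap j f) r y).
Let Qr i r y := Re (w (1 * RtoC sg)%C true (pd (j i) f) r y).
Let Qii i r y := Re (w 1 false (pd (j i) (pd (j i) f)) r y).

Let Pr_sum r y : Pr r y = \big[Rplus/0]_(i < n) Qii i r y.
Proof.
rewrite /Pr /w W_lap //.
have -> : (RtoC sg * RtoC sg = 1)%C by rewrite -RtoC_mult sg2.
rewrite Cmult_1_l /sumC.
elim: (index_enum 'I_n) => [|i s IH]; first by rewrite !big_nil.
by rewrite !big_cons -IH /Qii /w Cmult_1_l.
Qed.

Let en r y := chi r y * (P r y * P r y + \big[Rplus/0]_(i < n) (Q i r y * Q i r y)).
Let den r y := 2 * Rmax 0 (qd r y) * (-2 * (rad - r)) * (P r y * P r y + \big[Rplus/0]_(i < n) (Q i r y * Q i r y))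
  + chi r y * ((Pr r y * P r y + P r y * Pr r y) + \big[Rplus/0]_(i < n) (Qr i r y * Q i r y + Q i r y * Qr i r y)).

Let loclip_P r : loclip (P r). Proof. exact: w_loclip. Qed.
Let loclip_Pr r : loclip (Pr r).
Proof. by apply: w_loclip; exact: (test_dr j true tf). Qed.
Let loclip_Q i r : loclip (Q i r). Proof. by apply: w_loclip; exact: test_pd. Qed.
Let loclip_Qr i r : loclip (Qr i r). Proof. by apply: w_loclip; exact: test_pd. Qed.
Let loclip_Qii i r : loclip (Qii i r). Proof. by apply: w_loclip; apply: test_pd; exact: test_pd. Qed.

Let loclip_en r : loclip (en r).
Proof.
apply: loclip_mult; first exact: loclip_chi.
by apply: loclip_plus; [apply: loclip_mult; exact: loclip_P | apply: loclip_sum => i; apply: loclip_mult; exact: loclip_Q].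
Qed.

Let loclip_den r : loclip (den r).
Proof.
apply: loclip_plus.
  apply: loclip_mult; first by apply: loclip_mult; [apply: loclip_scal; apply: loclip_max0; exact: loclip_qd | exact: loclip_const].
  by apply: loclip_plus; [apply: loclip_mult; exact: loclip_P | apply: loclip_sum => i; apply: loclip_mult; exact: loclip_Q].
apply: loclip_mult; first exact: loclip_chi.
apply: loclip_plus; first by apply: loclip_plus; apply: loclip_mult; [exact: loclip_Pr|exact: loclip_P|exact: loclip_P|exact: loclip_Pr].
by apply: loclip_sum => i; apply: loclip_plus; apply: loclip_mult; [exact: loclip_Qr|exact: loclip_Q|exact: loclip_Q|exact: loclip_Qr].
Qed.

Let udiff_en r : udiff A en r (den r).
Proof.
apply: udiff_mult; first exact: (udiff_sqmax0 (udiff_qd_r r)).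
apply: udiff_plus; first by apply: udiff_mult; exact: udiff_r.
apply: udiff_sum => i; apply: udiff_mult; exact: (udiff_r 1 false r (test_pd (j i) tf)).
Qed.

(** The i-th partial derivative of the flux component [chi * P * Q i]. *)
Let dG i r y := (2 * Rmax 0 (qd r y) * (-2 * y i) * P r y + chi r y * Qr i r y) * Q i r y
   + chi r y * P r y * Qii i r y.

Let loclip_dG i r : loclip (dG i r).
Proof.
apply: loclip_plus; apply: loclip_mult; try exact: loclip_Q; try exact: loclip_Qii.
  apply: loclip_plus; apply: loclip_mult; try exact: loclip_P; try exact: loclip_Qr; try exact: loclip_chi.
  by apply: loclip_mult; apply: loclip_scal; [apply: loclip_max0; exact: loclip_qd | exact: loclip_coord].
by apply: loclip_mult; [exact: loclip_chi | exact: loclip_P].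
Qed.

Let l := enum 'I_n.
Let o : vec n := fun _ => 0.
Let o_in : inbox A o. Proof. by move=> k; rewrite Rabs_R0; apply: Rlt_le; exact: A0. Qed.

Let box_RInt_dG i r : 0 <= r <= rad -> box_RInt A l (dG i r) o = 0.
Proof.
move=> hr.
apply: (@box_RInt_pd n A A0 l i (fun y => chi r y * P r y * Q i r y)).
- exact: enum_uniq.
- by rewrite mem_enum.
- by apply: loclip_mult; [apply: loclip_mult; [exact: loclip_chi | exact: loclip_P] | exact: loclip_Q].
- exact: loclip_dG.
- move=> s0 hs0.
  have h1 := udiff_sqmax0 (udiff_qd_y r i hs0).
  have h2 := udiff_smooth i (w_smooth (RtoC sg) true r tf) hs0.
  have h3 := udiff_smooth i (w_smooth 1 false r (test_pd (j i) tf)) hs0.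
  have e2 : pd i (w (RtoC sg) true f r) = w (RtoC sg) true (pd (j i) f) r.
    by apply: functional_extensionality => y; apply: is_pd_pd; exact: w_is_pd.
  have e3 : pd i (w 1 false (pd (j i) f) r) = w 1 false (pd (j i) (pd (j i) f)) r.
    by apply: functional_extensionality => y; apply: is_pd_pd; apply: w_is_pd; exact: test_pd.
  rewrite e2 in h2; rewrite e3 in h3.
  have := udiff_mult (udiff_mult h1 h2) h3.
  by rewrite /dG /Qr Cmult_1_l.
- move=> y hy hi.
  have : qd r y <= 0.
    have hs : y i * y i <= \big[Rplus/0]_(k < n) (y k * y k).
      have : i \in index_enum 'I_n by rewrite mem_index_enum.
      have hs (s : seq 'I_n) : 0 <= \big[Rplus/0]_(k <- s) (y k * y k).
        elim: s => [|k s IH]; rewrite ?big_nil ?big_cons; first lra.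
        by have := Rle_0_sqr (y k); rewrite /Rsqr; move: IH; set S := bigop _ _ _; lra.
      elim: (index_enum 'I_n) => [//|k s IH]; rewrite inE big_cons => /orP [/eqP <-|/IH].
        by have := hs s; set S := bigop _ _ _; lra.
      by have := Rle_0_sqr (y k); rewrite /Rsqr; set S := bigop _ _ _; lra.
    have : (rad - r) ^ 2 <= y i * y i.
      have -> : y i * y i = Rabs (y i) * Rabs (y i) by rewrite -Rabs_mult Rabs_pos_eq //; exact: Rle_0_sqr.
      by rewrite hi /A; nra.
    by rewrite /qd; move: hs; set S := bigop _ _ _; lra.
  by move=> h; rewrite /chi Rmax_left //; ring.
- exact: o_in.
Qed.

(** Twice the divergence of the flux has integral 0 and may be subtracted. With [M] the positive
    part of [qd] there remains [-4 * M * (rad - r)] times the energy density plus [8 * M * P] times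
    the sum of the [y i * Q i]; this is at most 0, as [|y| <= rad - r] where [M > 0]. *)
Let den_le r : 0 <= r < rad -> box_RInt A l (den r) o <= 0.
Proof.
move=> hr.
have LLs : loclip (fun y => \big[Rplus/0]_(i < n) (-2 * dG i r y)).
  by apply: loclip_sum => i; apply: loclip_scal; exact: loclip_dG.
have -> : box_RInt A l (den r) o = box_RInt A l (fun y => den r y + \big[Rplus/0]_(i < n) (-2 * dG i r y)) o.
  rewrite (box_RInt_plus A0) //.
  rewrite (box_RInt_sum A0); last by move=> i; apply: loclip_scal; exact: loclip_dG.
  rewrite sumR0 ?Rplus_0_r // => i; rewrite (box_RInt_scal A0) // box_RInt_dG; [ring | lra].
have J00 : box_RInt A l (fun _ => 0) o = 0.
  have := @box_RInt_scal n A A0 l 0 (fun _ => 1) (loclip_const n 1) o.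
  rewrite (_ : (fun _ : vec n => 0 * 1) = fun _ => 0); first by move=> ->; ring.
  by apply: functional_extensionality => y; ring.
apply: Rle_trans (_ : _ <= box_RInt A l (fun _ => 0) o) _; last by rewrite J00; exact: Rle_refl.
apply: (box_RInt_le A0); [exact: (loclip_plus (loclip_den r) LLs) | exact: loclip_const | | exact: o_in ].
move=> y hy; rewrite /den Pr_sum.
have := @energy_identity _ (index_enum 'I_n) (chi r y) (P r y) (fun i => Q i r y) (fun i => Qii i r y) (fun i => Qr i r y)
  (fun i => 2 * Rmax 0 (qd r y) * (-2 * y i)).
rewrite -/(dG _ _ _) /=.
set X := _ * (_ + _) => hid; set Y := 2 * _ * _ * _.
have -> : Y + X + \big[Rplus/0]_(i < n) (-2 * dG i r y) = Y + (X + \big[Rplus/0]_(i < n) (-2 * dG i r y)) by ring.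
rewrite hid.
have -> : \big[Rplus/0]_(i < n) (2 * Rmax 0 (qd r y) * (-2 * y i) * Q i r y) =
    -4 * Rmax 0 (qd r y) * \big[Rplus/0]_(i < n) (y i * Q i r y).
  elim: (index_enum 'I_n) => [|i s IH]; first by rewrite !big_nil; ring.
  by rewrite !big_cons IH; set S := bigop _ _ _; ring.
rewrite /Y; clear Y X hid.
set M := Rmax 0 (qd r y); have M0 : 0 <= M by exact: Rmax_l.
case: (Rle_lt_dec (qd r y) 0) => hq.
  by have -> : M = 0; [rewrite /M Rmax_left | apply: Req_le; ring].
have r0 : 0 < rad - r by lra.
have := @energy_am_gm _ (index_enum 'I_n) (rad - r) (P r y) (fun i => y i) (fun i => Q i r y) r0.
have hq2 : \big[Rplus/0]_(i < n) y i ^ 2 / (rad - r) <= rad - r.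
  apply: (Rmult_le_reg_r (rad - r)) => //.
  rewrite /Rdiv Rmult_assoc Rinv_l ?Rmult_1_r; last by apply: Rgt_not_eq.
  move: hq; rewrite /qd (eq_bigr (fun i => y i ^ 2)); last by move=> i _; rewrite /=; ring.
  by set S := bigop _ _ _; rewrite /=; lra.
move: hq2; set S1 := \big[Rplus/0]_(i < n) y i ^ 2; set S2 := \big[Rplus/0]_(i < n) (y i * Q i r y).
set S3 := \big[Rplus/0]_(i < n) (Q i r y * Q i r y) => h1 h2.
have h3 : S1 / (rad - r) * (P r y * P r y) <= (rad - r) * (P r y * P r y).
  by apply: Rmult_le_compat_r => //; exact: Rle_0_sqr.
have h4 : 2 * P r y * S2 <= (rad - r) * (P r y * P r y + S3) by lra.
by have := Rmult_le_compat_l _ _ _ M0 h4; lra.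
Qed.

Let en_ge0 r y : 0 <= en r y.
Proof.
apply: Rmult_le_pos; first exact: pow2_ge_0.
apply: Rplus_le_le_0_compat; first exact: Rle_0_sqr.
elim: (index_enum 'I_n) => [|i s IH]; rewrite ?big_nil ?big_cons; first exact: Rle_refl.
by apply: Rplus_le_le_0_compat => //; exact: Rle_0_sqr.
Qed.

Let en_0 y : en 0 y = 0.
Proof.
case: (Rle_lt_dec (qd 0 y) 0) => hq; first by rewrite /en /chi Rmax_left //; ring.
have hy : enorm y < rad.
  rewrite /enorm -(sqrt_pow2 rad); last lra.
  apply: sqrt_lt_1_alt; split.
    elim: (index_enum 'I_n) => [|i s IH]; rewrite ?big_nil ?big_cons; first exact: Rle_refl.
    by apply: Rplus_le_le_0_compat => //; exact: pow2_ge_0.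
  move: hq; rewrite /qd (eq_bigr (fun i => y i ^ 2)); last by move=> i _; rewrite /=; ring.
  by set S := bigop _ _ _; rewrite Rminus_0_r; lra.
have [d d0 hd] : exists2 d, 0 < d & forall y', near_vec y d y' -> enorm y' < rad.
  have h0 : \big[Rplus/0]_(i < n) y i ^ 2 < rad ^ 2.
    move: hq; rewrite /qd (eq_bigr (fun i => y i ^ 2)); last by move=> i _; rewrite /=; ring.
    by set S := bigop _ _ _; rewrite Rminus_0_r; lra.
  have [d d0 hd] := @continuous_sum_sq n y (rad ^ 2 - \big[Rplus/0]_(i < n) y i ^ 2) ltac:(lra).
  exists d => // y' /hd /Rabs_def2 [h1 _].
  rewrite /enorm -(sqrt_pow2 rad); last lra.
  apply: sqrt_lt_1_alt; split; last by lra.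
  elim: (index_enum 'I_n) => [|i s IH]; rewrite ?big_nil ?big_cons; first exact: Rle_refl.
  by apply: Rplus_le_le_0_compat => //; exact: pow2_ge_0.
have p0 : P 0 y = 0 by rewrite /P /w Rmult_0_r W1_0 // Cmult_0_r.
have q0 i : Q i 0 y = 0.
  rewrite /Q /w Rmult_0_r W_0; last exact: test_pd.
  have -> : pd (j i) f (Z y) = pd i (slice e f z) y by rewrite (pd_slice he) //; case: tf.
  have -> : pd i (slice e f z) y = 0.
    by apply: (@pds_near0 n [:: i] (slice e f z) y d) => // y' /hd; exact: f0.
  by rewrite Cmult_0_r.
rewrite /en p0 sumR0; last by move=> i; rewrite q0; ring.
by ring.
Qed.

(** The energy starts at 0, is nonnegative and, by [den_le], does not increase. *)
Let box_RInt_en r : 0 <= r < rad -> box_RInt A l (en r) o = 0.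
Proof.
move=> hr.
have J00 : box_RInt A l (fun _ => 0) o = 0.
  have := @box_RInt_scal n A A0 l 0 (fun _ => 1) (loclip_const n 1) o.
  rewrite (_ : (fun _ : vec n => 0 * 1) = fun _ => 0); first by move=> ->; ring.
  by apply: functional_extensionality => y; ring.
have h0 : box_RInt A l (en 0) o = 0.
  by apply: etrans J00; apply: box_RInt_ext => // y _; exact: en_0.
apply: Rle_antisym; last first.
  apply: Rle_trans (_ : box_RInt A l (fun _ => 0) o <= _); first by rewrite J00; exact: Rle_refl.
  by apply: (box_RInt_le A0); [exact: loclip_const | exact: loclip_en | move=> y _; exact: en_ge0 | exact: o_in].
have hd s : is_derive (fun s => box_RInt A l (en s) o) s (box_RInt A l (den s) o).
  by apply: (box_RInt_derive A0) => //; exact: o_in.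
case: (Req_dec r 0) => [->|r0]; first by lra.
have [c [hc1 hc2]] := MVT_gen (fun s => box_RInt A l (en s) o) 0 r (fun s => box_RInt A l (den s) o)
  (fun s _ => hd s) (fun s _ => ltac:(apply/continuity_pt_filterlim; apply: ex_derive_continuous; eexists; exact: hd)).
rewrite Rmin_left in hc1; last lra; rewrite Rmax_right in hc1; last lra.
have hc3 : box_RInt A l (en r) o - 0 = box_RInt A l (den c) o * (r - 0) by rewrite -hc2 h0.
have := den_le (conj hc1.1 (Rle_lt_trans _ _ _ hc1.2 hr.2)); move: hc3.
by move: (box_RInt A l (en r) o) (box_RInt A l (den c) o) => a b; nra.
Qed.

Let P_zero r : 0 <= r < rad -> P r o = 0.
Proof.
move=> hr; have a0 := A0.
have := @box_RInt_zero n A A0 l (en r) o (loclip_en r) (fun y _ => en_ge0 r y) o_in (box_RInt_en hr) o.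
move=> /(_ (fun k _ => ltac:(rewrite Rabs_R0; lra)) (fun k _ => erefl)).
rewrite /en => h.
have hchi : 0 < chi r o.
  apply: pow_lt; rewrite /qd sumR0; last by move=> i; rewrite /o; ring.
  apply: Rlt_le_trans (Rmax_r _ _).
  have : 0 < (rad - r) ^ 2 by apply: pow_lt; lra.
  lra.
have [|h1] := Rmult_integral _ _ h; first by lra.
have hs : 0 <= \big[Rplus/0]_(i < n) (Q i r o * Q i r o).
  elim: (index_enum 'I_n) => [|i s IH]; rewrite ?big_nil ?big_cons; first exact: Rle_refl.
  by apply: Rplus_le_le_0_compat => //; exact: Rle_0_sqr.
have h2 : P r o * P r o = 0.
  by have := Rle_0_sqr (P r o); move: h1 hs; rewrite /Rsqr; set S := bigop _ _ _; lra.
by case: (Rmult_integral _ _ h2).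
Qed.

(** At the centre the weight is positive up to the time [rad], so the time derivative vanishes there
    and the solution keeps its initial value 0. *)
Lemma Re_W_zero r : 0 <= r < rad -> Re (Wv false f z (sg * r)) = 0.
Proof.
move=> hr.
have Zo : Z o = z by apply: functional_extensionality => k; rewrite /Z (emb_zero he); ring.
have hd s : is_derive (fun s => Re (w 1 false f s o)) s (P s o).
  have [h _] := w_isD 1 false s o tf; move: h; rewrite /P (_ : (1 * RtoC sg = RtoC sg)%C) //; ring.
have h0 : Re (w 1 false f 0 o) = 0.
  rewrite /w Rmult_0_r W_0 // f0 ?Cmult_0_r //.
  rewrite /enorm sumR0; last by move=> i; rewrite /o /=; ring.
  by rewrite sqrt_0.
have hw : Re (w 1 false f r o) = 0.
  case: (Req_dec r 0) => [->//|r0].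
  have hc s : continuity_pt (fun s => Re (w 1 false f s o)) s.
    apply/continuity_pt_filterlim.
    by apply: (@ex_derive_continuous R_AbsRing R_NormedModule (fun s => Re (w 1 false f s o))); eexists; exact: hd.
  have [c [hc1 hc2]] := MVT_gen (fun s => Re (w 1 false f s o)) 0 r (fun s => P s o)
    (fun s _ => hd s) (fun s _ => hc s).
  rewrite Rmin_left in hc1; last lra; rewrite Rmax_right in hc1; last lra.
  by rewrite h0 P_zero in hc2; lra.
by rewrite -hw /w Zo Cmult_1_l.
Qed.

End FinitePropagation.

Section FinitePropagation2.
Variables (n : nat) (Ew : R -> functional n).
Hypothesis hEw : wave_fundamental_solution Ew.
Variables (m : nat) (e : vec n -> vec m) (j : 'I_n -> 'I_m).
Hypothesis he : embedding e j.

Lemma finite_propagation z rad f r : test_fun f ->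
  (forall y, enorm y < rad -> f (fun k => z k + e y k) = 0) ->
  Rabs r < rad -> W Ew e false f z r = 0.
Proof.
move=> tf f0 hr.
have rad0 : 0 < rad by have := Rabs_pos r; lra.
have H g : test_fun g -> (forall y, enorm y < rad -> g (fun k => z k + e y k) = 0) ->
    Re (W Ew e false g z r) = 0.
  move=> tg g0; case: (Rle_lt_dec 0 r) => r0.
    have := @Re_W_zero n Ew hEw m e j he z 1 rad ltac:(ring) rad0 g tg g0 r.
    by rewrite Rmult_1_l; apply; have := Rle_abs r; lra.
  have := @Re_W_zero n Ew hEw m e j he z (-1) rad ltac:(ring) rad0 g tg g0 (- r).
  have -> : -1 * - r = r by ring.
  by apply; rewrite Rabs_left in hr; lra.
apply: C_eq; first exact: H.
(* The real part of [- Ci * f] is the imaginary part of [f]. *)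
have := H (fun x => (- Ci * f x)%C) (test_scal _ tf).
rewrite (W_scal hEw he) // => H1.
transitivity (Re (- Ci * W Ew e false f z r)%C); first by rewrite /Re /Im /=; ring.
by apply: H1 => y hy; rewrite f0 // Cmult_0_r.
Qed.
End FinitePropagation2.

(** * The hypergeometric kernel *)

Section Hypergeometric.
Variable M : R.

Definition aM : C := (RtoC (1 / 2) + Ci * RtoC M)%C.

(** The Gauss coefficients for third parameter 1, where [(1)_k = k!]. *)
Let c (k : nat) : C := (pochhammer aM k * pochhammer aM k / RtoC (INR (Factorial.fact k) * INR (Factorial.fact k)))%C.

Let fact_nz k : INR (Factorial.fact k) <> 0.
Proof. by apply: not_0_INR; exact: Factorial.fact_neq_0. Qed.

Let RtoC_nz (x : R) : x <> 0 -> RtoC x <> 0.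
Proof. by move=> h e; apply: h; case: e. Qed.

Let pochhammer1 k : pochhammer (RtoC 1) k = RtoC (INR (Factorial.fact k)).
Proof.
elim: k => //= k ->; rewrite -RtoC_plus -RtoC_mult; congr RtoC.
by rewrite plus_INR mult_INR; ring.
Qed.

Let c_rec k : (RtoC ((INR k + 1) ^ 2) * c k.+1 = (aM + RtoC (INR k)) ^ 2 * c k)%C.
Proof.
have h1 : RtoC (INR (Factorial.fact k)) <> 0 by apply: RtoC_nz.
have h2 : RtoC (INR k + 1) <> 0 by apply: RtoC_nz; apply: Rgt_not_eq; have := pos_INR k; move: (INR k) => x; lra.
have e : INR (Factorial.fact k.+1) = (INR k + 1) * INR (Factorial.fact k).
  by rewrite -S_INR -mult_INR.
rewrite /c e [pochhammer _ k.+1]/= !RtoC_mult; field.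
by split.
Qed.

(** [|aM + k|^2 = (k + 1/2)^2 + M^2] is at most [(k + 1)^2] once [k >= M^2], so by [c_rec] the
    moduli eventually decrease. Bounded coefficients give a radius of convergence of at least 1. *)
Let c_bounded : exists B, forall k, Cmod (c k) <= B.
Proof.
have [N hN] := nfloor_ex (M ^ 2) (pow2_ge_0 M).
have step k : (N < k)%N -> Cmod (c k.+1) <= Cmod (c k).
  move=> hk; have hk2 : M ^ 2 <= INR k.
    apply: Rlt_le; apply: Rlt_le_trans hN.2 _.
    by rewrite -S_INR; apply: le_INR; apply/leP.
  have k0 := pos_INR k.
  have := c_rec k; move=> /(f_equal Cmod); rewrite Cmod_mult Cmod_R Cmod_mult Cmod_pow.
  rewrite Rabs_pos_eq; last exact: pow2_ge_0.
  have hm : Cmod (aM + RtoC (INR k))%C ^ 2 = (1 / 2 + INR k) ^ 2 + M ^ 2.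
    rewrite /Cmod pow2_sqrt; last by apply: Rplus_le_le_0_compat; exact: pow2_ge_0.
    by rewrite /aM /= ; ring.
  rewrite hm; have c0 := Cmod_ge_0 (c k).
  move: (Cmod (c k.+1)) (Cmod (c k)) c0 => u v v0 e.
  move: (INR k) e hk2 k0 => x e hk2 k0.
  have h3 : (1 / 2 + x) ^ 2 + M ^ 2 <= (x + 1) ^ 2 by nra.
  have h4 : (x + 1) ^ 2 * u <= (x + 1) ^ 2 * v by rewrite e; apply: Rmult_le_compat_r.
  by apply: Rmult_le_reg_l h4; nra.
have [B hB] : exists B, forall k, (k <= N.+1)%N -> Cmod (c k) <= B.
  elim: N.+1 => [|m [B hB]]; first by exists (Cmod (c 0%N)) => k; rewrite leqn0 => /eqP ->; lra.
  exists (Rmax B (Cmod (c m.+1))) => k; rewrite leq_eqVlt => /orP [/eqP ->|hk]; first exact: Rmax_r.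
  by apply: Rle_trans (Rmax_l _ _); exact: hB.
exists B => k; elim: k => [|k IH]; first exact: hB.
case: (leqP k N) => hk; first exact: hB.
exact: Rle_trans (step k hk) IH.
Qed.

Let cv (p : C -> R) z : (forall w, Rabs (p w) <= Cmod w) -> Rabs z < 1 ->
  Rbar_lt (Rabs z) (CV_radius (fun k => p (c k))).
Proof.
move=> hp hz; have [B hB] := c_bounded.
have [h _] := CV_radius_bounded (fun k => p (c k)).
have : Rbar_le 1 (CV_radius (fun k => p (c k))).
  apply: h; exists B => k; rewrite pow1 Rmult_1_r.
  exact: Rle_trans (hp _) (hB k).
by apply: Rbar_lt_le_trans.
Qed.

(** * Complex power series in a real variable, and the hypergeometric equation *)

Definition isP (u : nat -> C) (z : R) (l : C) : Prop :=
  is_pseries (fun k => Re (u k)) z (Re l) /\ is_pseries (fun k => Im (u k)) z (Im l).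

Lemma isP_ext u v z l : (forall k, u k = v k) -> isP u z l -> isP v z l.
Proof. by move=> /functional_extensionality ->. Qed.

Lemma isP_unique u z l l' : isP u z l -> isP u z l' -> l = l'.
Proof.
by case=> a b [d e]; apply: C_eq; [rewrite -(is_pseries_unique _ _ _ a) (is_pseries_unique _ _ _ d)
 | rewrite -(is_pseries_unique _ _ _ b) (is_pseries_unique _ _ _ e)].
Qed.

Lemma isP_plus u v z l m : isP u z l -> isP v z m -> isP (fun k => u k + v k)%C z (l + m)%C.
Proof.
by case=> a b [d e]; split; apply: is_pseries_plus.
Qed.

Lemma isP_scal (w : C) u z l : isP u z l -> isP (fun k => w * u k)%C z (w * l)%C.
Proof.
case=> a b.
have sc (x : R) v lv : is_pseries v z lv -> is_pseries (fun k => x * v k) z (x * lv).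
  by move=> h; apply: (is_pseries_scal x v z lv (Rmult_comm _ _) h).
split.
  have := is_pseries_plus _ _ _ _ _ (sc (Re w) _ _ a) (sc (- Im w) _ _ b).
  have -> : plus (Re w * Re l) (- Im w * Im l) = Re (w * l)%C by rewrite /plus /Re /Im /=; ring.
  by apply: is_pseries_ext => k; rewrite /PS_plus /plus /Re /Im /=; ring.
have := is_pseries_plus _ _ _ _ _ (sc (Re w) _ _ b) (sc (Im w) _ _ a).
have -> : plus (Re w * Im l) (Im w * Re l) = Im (w * l)%C by rewrite /plus /Re /Im /=; ring.
by apply: is_pseries_ext => k; rewrite /PS_plus /plus /Re /Im /=; ring.
Qed.

Lemma isP_incr u z l : isP u z l -> isP (fun k => if k is k'.+1 then u k' else RtoC 0) z (RtoC z * l)%C.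
Proof.
case=> a b; split.
  have -> : Re (RtoC z * l)%C = scal z (Re l) by rewrite /scal /= /mult /Re /=; ring.
  by have := is_pseries_incr_1 _ _ _ a; apply: is_pseries_ext => -[|k].
have -> : Im (RtoC z * l)%C = scal z (Im l) by rewrite /scal /= /mult /Im /=; ring.
by have := is_pseries_incr_1 _ _ _ b; apply: is_pseries_ext => -[|k].
Qed.

(** The j-th derivative of the Gauss series. *)
Let F (j : nat) (z : R) : C :=
  (PSeries (iter j PS_derive (fun k => Re (c k))) z, PSeries (iter j PS_derive (fun k => Im (c k))) z).

Let cvj (p : C -> R) j z : (forall w, Rabs (p w) <= Cmod w) -> Rabs z < 1 ->
  Rbar_lt (Rabs z) (CV_radius (iter j PS_derive (fun k => p (c k)))).
Proof. by move=> hp hz; elim: j => [|j IH] /=; [exact: cv | rewrite CV_radius_derive]. Qed.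

Let F_isD j z : Rabs z < 1 -> isD (F j) z (F j.+1 z).
Proof.
by move=> hz; split; apply: is_derive_PSeries; apply: cvj => //; [exact: Re_le_Cmod | exact: Im_le_Cmod].
Qed.

Let d (j k : nat) : C := (iter j PS_derive (fun k => Re (c k)) k, iter j PS_derive (fun k => Im (c k)) k).

Let F_isP j z : Rabs z < 1 -> isP (d j) z (F j z).
Proof.
move=> hz; split; apply: PSeries_correct; apply: CV_radius_inside.
  by apply: (cvj (p := Re)) => //; exact: Re_le_Cmod.
by apply: (cvj (p := Im)) => //; exact: Im_le_Cmod.
Qed.

Let dS j k : d j.+1 k = (RtoC (INR k + 1) * d j k.+1)%C.
Proof.
have e (a : nat -> R) : PS_derive a k = (INR k + 1) * a k.+1 by rewrite /PS_derive -S_INR.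
by apply: C_eq; rewrite /d /Re /Im !iterS !e /=; ring.
Qed.

(** Comparison of coefficients: [c_rec] reads [z F'' + F' = z^2 F'' + (2 aM + 1) z F' + aM^2 F]. *)
Let F_ode z : Rabs z < 1 ->
  (RtoC (z * (1 - z)) * F 2 z + (1 - (2 * aM + 1) * RtoC z) * F 1 z - aM * aM * F 0 z = 0)%C.
Proof.
move=> hz.
have p1 := F_isP 1 hz; have p2 := isP_incr (F_isP 2 hz).
have q0 := F_isP 0 hz; have q1 := isP_incr (F_isP 1 hz); have q2 := isP_incr p2.
have L := isP_plus p1 p2.
have K := isP_plus q2 (isP_plus (isP_scal (2 * aM + 1)%C q1) (isP_scal (aM * aM)%C q0)).
have E : (F 1 z + RtoC z * F 2 z = RtoC z * (RtoC z * F 2 z) + ((2 * aM + 1) * (RtoC z * F 1 z) + aM * aM * F 0 z))%C.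
  apply: (isP_unique L); apply: isP_ext K => k.
  have ck i : d 0 i = c i by apply: C_eq.
  have e1 : (d 1 k + (if k is k'.+1 then d 2 k' else RtoC 0) = RtoC ((INR k + 1) ^ 2) * c k.+1)%C.
    case: k => [|k].
      by rewrite dS ck (_ : INR 0 = 0) // Rplus_0_l pow1; ring.
    by rewrite !dS ck S_INR RtoC_pow !RtoC_plus; ring.
  rewrite e1 c_rec -!ck.
  case: k {e1} => [|[|k]].
  - by rewrite (_ : INR 0 = 0) //; ring.
  - by rewrite !dS (_ : INR 0 = 0) // (_ : INR 1 = 1) // Rplus_0_l; ring.
  - by rewrite !dS !S_INR !RtoC_plus; ring.
have e2 : (RtoC (z * (1 - z)) = RtoC z * (1 - RtoC z))%C by rewrite RtoC_mult RtoC_minus.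
rewrite e2.
have -> : (RtoC z * (1 - RtoC z) * F 2 z + (1 - (2 * aM + 1) * RtoC z) * F 1 z - aM * aM * F 0 z =
  (F 1 z + RtoC z * F 2 z) - (RtoC z * (RtoC z * F 2 z) + ((2 * aM + 1) * (RtoC z * F 1 z) + aM * aM * F 0 z)))%C by ring.
by rewrite E; ring.
Qed.

Let F_hyp z : hyp2F1 aM aM (RtoC 1) (RtoC z) = F 0 z.
Proof.
have e k : hyp2F1_term aM aM (RtoC 1) (RtoC z) k = (RtoC (z ^ k) * c k)%C.
  rewrite /hyp2F1_term pochhammer1 -RtoC_pow /c RtoC_mult; field.
  exact: RtoC_nz.
by apply: C_eq; apply: Series_ext => k; rewrite e /Re /Im /=; ring.
Qed.

Let F_0 : F 0 0 = 1.
Proof.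
have c0 : c 0%N = 1.
  by rewrite /c /= Rmult_1_r; field; exact: RtoC_nz R1_neq_R0.
by apply: C_eq; [transitivity (PSeries (fun k => Re (c k)) 0) | transitivity (PSeries (fun k => Im (c k)) 0)] => //;
  rewrite PSeries_0 c0.
Qed.

Lemma RpowC_isD (w : C) x : 0 < x -> isD (fun x => RpowC x w) x (w * RtoC (/ x) * RpowC x w)%C.
Proof.
move=> x0; case: w => u v; split.
  rewrite /RpowC /=; apply: (is_derive_ext (fun s => exp (u * ln s) * cos (v * ln s))).
    by move=> s; rewrite /Re /=; ring.
  by auto_derive; [lra | rewrite /Re /=; field; lra].
rewrite /RpowC /=; apply: (is_derive_ext (fun s => exp (u * ln s) * sin (v * ln s))).
  by move=> s; rewrite /Im /=; ring.
by auto_derive; [lra | rewrite /Im /=; field; lra].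
Qed.

(** By Pfaff's transformation this is [F(aM, 1 - aM; 1; -Y)], a Legendre function of [1 + 2 Y]. Its
    equation has real coefficients, so real and imaginary parts can be handled separately in
    Riemann's identity. *)
Definition Hf (Y : R) : C := (RpowC (1 + Y) (- aM) * hyp2F1 aM aM (RtoC 1) (RtoC (Y / (1 + Y))))%C.

Let v (Y : R) : C := RtoC (/ (1 + Y)).
Let E (Y : R) : C := RpowC (1 + Y) (- aM).
Let FF j (Y : R) : C := F j (Y / (1 + Y)).

(** The kernel is evaluated at [Y >= 0]; the margin down to [-1/2], where [Y / (1 + Y)] reaches -1,
    makes 0 an interior point. *)
Let z_lt Y : -1 / 2 < Y -> Rabs (Y / (1 + Y)) < 1.
Proof.
move=> hY; apply: Rabs_def1.
  by apply: (Rmult_lt_reg_r (1 + Y)); rewrite /Rdiv ?Rmult_assoc ?Rinv_l; lra.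
by apply: (Rmult_lt_reg_r (1 + Y)); rewrite /Rdiv ?Rmult_assoc ?Rinv_l; lra.
Qed.

Let v_isD Y : -1 / 2 < Y -> isD v Y (- (v Y * v Y))%C.
Proof.
move=> hY; rewrite /v -RtoC_mult -RtoC_opp; apply: isD_RtoC.
by auto_derive; [lra | field; lra].
Qed.

Let E_isD Y : -1 / 2 < Y -> isD E Y (- aM * v Y * E Y)%C.
Proof.
move=> hY.
have := @isD_shift (fun x => RpowC x (- aM)) 1 Y _ (@RpowC_isD (- aM)%C (1 + Y) ltac:(lra)).
exact.
Qed.

Let FF_isD j Y : -1 / 2 < Y -> isD (FF j) Y (v Y * v Y * FF j.+1 Y)%C.
Proof.
move=> hY; rewrite /v -RtoC_mult.
apply: (@isD_comp (F j) (fun Y => Y / (1 + Y))); first by apply: F_isD; exact: z_lt.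
by auto_derive; [lra | field; lra].
Qed.

Definition Hf1 (Y : R) : C := (E Y * (- aM * v Y * FF 0 Y + v Y * v Y * FF 1 Y))%C.
Definition Hf2 (Y : R) : C :=
  (E Y * (aM * (aM + 1) * (v Y * v Y) * FF 0 Y - (2 * aM + 2) * (v Y * v Y * v Y) * FF 1 Y
     + v Y * v Y * v Y * v Y * FF 2 Y))%C.

Lemma HfE Y : Hf Y = (E Y * FF 0 Y)%C.
Proof. by rewrite /Hf F_hyp. Qed.

Lemma Hf_isD Y : -1 / 2 < Y -> isD Hf Y (Hf1 Y).
Proof.
move=> hY; apply: (@isD_ext (fun Y => E Y * FF 0 Y)%C); first by move=> s; rewrite HfE.
have := isD_mult (E_isD hY) (FF_isD 0 hY).
by rewrite (_ : _ + _ = Hf1 Y)%C // /Hf1; ring.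
Qed.

Lemma Hf1_isD Y : -1 / 2 < Y -> isD Hf1 Y (Hf2 Y).
Proof.
move=> hY.
have hv := v_isD hY; have hE := E_isD hY; have h0 := FF_isD 0 hY; have h1 := FF_isD 1 hY.
have := isD_mult hE (isD_plus (isD_mult (isD_scal (- aM)%C hv) h0) (isD_mult (isD_mult hv hv) h1)).
by rewrite (_ : _ + _ = Hf2 Y)%C // /Hf2; ring.
Qed.

Lemma Hf2_isD Y : -1 / 2 < Y -> exists l, isD Hf2 Y l.
Proof.
move=> hY.
have hv := v_isD hY; have hE := E_isD hY; have h0 := FF_isD 0 hY; have h1 := FF_isD 1 hY; have h2 := FF_isD 2 hY.
have hv2 := isD_mult hv hv; have hv3 := isD_mult hv2 hv; have hv4 := isD_mult hv3 hv.
eexists; apply: (isD_mult hE).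
apply: isD_plus; last exact: isD_mult hv4 h2.
by apply: isD_minus; apply: isD_mult; try exact: h0; try exact: h1; apply: isD_scal; [exact: hv2 | exact: hv3].
Qed.

Let aM_conj : (aM * (1 - aM) = RtoC (M ^ 2 + 1 / 4))%C.
Proof. by apply: C_eq; rewrite /aM /Re /Im /=; field. Qed.

(** The hypergeometric equation at [Y / (1 + Y)], multiplied by [(1 + Y)^(-aM - 1)]; the coefficient
    of [Hf] is [aM * (1 - aM)], which is real. *)
Lemma Hf_ode Y : -1 / 2 < Y ->
  (RtoC (Y * (1 + Y)) * Hf2 Y + RtoC (1 + 2 * Y) * Hf1 Y + RtoC (M ^ 2 + 1 / 4) * Hf Y = 0)%C.
Proof.
move=> hY; rewrite HfE /Hf1 /Hf2 -aM_conj.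
have := F_ode (z_lt hY); rewrite -/(FF 2 Y) -/(FF 1 Y) -/(FF 0 Y).
set f0 := FF 0 Y; set f1 := FF 1 Y; set f2 := FF 2 Y; set e := E Y => h.
have s0 : RtoC (1 + Y) <> 0 by apply: RtoC_nz; apply: Rgt_not_eq; lra.
have e1 : v Y = (/ RtoC (1 + Y))%C by rewrite /v RtoC_inv //; lra.
have e2 : RtoC (Y / (1 + Y)) = (RtoC Y * v Y)%C by rewrite -RtoC_mult.
have e3 : RtoC (Y / (1 + Y) * (1 - Y / (1 + Y))) = (RtoC Y * v Y * v Y)%C.
  by rewrite /v -!RtoC_mult; congr RtoC; field; lra.
rewrite e2 e3 in h.
have sv : ((1 + RtoC Y) * v Y = 1)%C by rewrite e1 RtoC_plus; field; rewrite -RtoC_plus.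
have -> : (RtoC (Y * (1 + Y)) = RtoC Y * (1 + RtoC Y))%C by rewrite RtoC_mult RtoC_plus.
have -> : (RtoC (1 + 2 * Y) = 1 + 2 * RtoC Y)%C by rewrite RtoC_plus RtoC_mult.
have key : RtoC Y = (/ v Y - 1)%C.
  have v0 : v Y <> 0 by apply: RtoC_nz; apply: Rinv_neq_0_compat; apply: Rgt_not_eq; lra.
  have -> : RtoC Y = ((1 + RtoC Y) * v Y / v Y - 1)%C by field.
  by rewrite sv /Cdiv; ring.
have v0 : v Y <> 0 by apply: RtoC_nz; apply: Rinv_neq_0_compat; apply: Rgt_not_eq; lra.
transitivity (e * v Y * (RtoC Y * v Y * v Y * f2 + (1 - (2 * aM + 1) * (RtoC Y * v Y)) * f1 - aM * aM * f0))%C.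
  by rewrite key; field.
by rewrite h; ring.
Qed.

Lemma Hf_0 : Hf 0 = 1.
Proof.
rewrite HfE /FF /Rdiv Rmult_0_l F_0 /E Rplus_0_r /RpowC ln_1 !Rmult_0_r exp_0 cos_0 sin_0.
by apply: C_eq; rewrite /Re /Im /=; ring.
Qed.

Lemma RpowC_add x w w' : (RpowC x w * RpowC x w' = RpowC x (w + w'))%C.
Proof.
rewrite /RpowC.
have -> : Re (w + w') = Re w + Re w' by [].
have -> : Im (w + w') = Im w + Im w' by [].
rewrite !Rmult_plus_distr_r exp_plus cos_plus sin_plus.
by apply: C_eq; rewrite /Re /Im /=; ring.
Qed.

Lemma RpowC_mult x y w : 0 < x -> 0 < y -> RpowC (x * y) w = (RpowC x w * RpowC y w)%C.
Proof.
move=> x0 y0; rewrite /RpowC ln_mult // !Rmult_plus_distr_l exp_plus cos_plus sin_plus.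
by apply: C_eq; rewrite /Re /Im /=; ring.
Qed.

(** Since [(e^(-t0) + e^(-t))^2 - r^2 = 4 e^(-t0-t) (1 + Y)], the two complex powers combine to
    [(4 e^(-t0-t))^(-1/2) (1 + Y)^(-aM)]: the exponent [iM] cancels, and the kernel depends on [r]
    only through [Y]. *)
Lemma Gkernel_Hf r t t0 :
  let Y := ((exp (- t0) - exp (- t)) ^ 2 - r ^ 2) / (4 * exp (- t0 - t)) in
  -1 < Y -> Gkernel M r t t0 = (RtoC (1 / 2 * exp ((t0 + t) / 2)) * Hf Y)%C.
Proof.
move=> Y hY.
have q0 : 0 < 4 * exp (- t0 - t) by have := exp_pos (- t0 - t); lra.
have qE : exp (- t0 - t) = exp (- t0) * exp (- t) by rewrite -exp_plus; congr exp; ring.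
have eB : (exp (- t0) + exp (- t)) ^ 2 - r ^ 2 = (4 * exp (- t0 - t)) * (1 + Y).
  rewrite /Y qE; field; split; apply: Rgt_not_eq; exact: exp_pos.
rewrite /Gkernel eB.
have -> : ((exp (- t0) - exp (- t)) ^ 2 - r ^ 2) / (4 * exp (- t0 - t) * (1 + Y)) = Y / (1 + Y).
  rewrite {2}/Y; field; split; lra.
rewrite -/aM (@RpowC_mult _ (1 + Y)) //; last lra.
have -> : (- RtoC (1 / 2) - Ci * RtoC M = - aM)%C by rewrite /aM; ring.
rewrite /Hf Cmult_assoc Cmult_assoc RpowC_add.
have -> : (Ci * RtoC M + - aM = RtoC (- (1 / 2)))%C by rewrite /aM RtoC_opp; ring.
have -> : RpowC (4 * exp (- t0 - t)) (RtoC (- (1 / 2))) = RtoC (1 / 2 * exp ((t0 + t) / 2)).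
  rewrite /RpowC ln_mult ?ln_exp; [|lra|exact: exp_pos].
  rewrite [Re _]/= [Im _]/= Rmult_0_l cos_0 sin_0.
  have -> : exp (- (1 / 2) * (ln 4 + (- t0 - t))) = 1 / 2 * exp ((t0 + t) / 2).
    have -> : - (1 / 2) * (ln 4 + (- t0 - t)) = - (1 / 2) * ln 4 + (t0 + t) / 2 by field.
    rewrite exp_plus; congr (_ * _).
    have -> : ln 4 = 2 * ln 2 by rewrite (_ : 4 = 2 * 2) ?ln_mult; lra.
    have -> : - (1 / 2) * (2 * ln 2) = - ln 2 by field.
    by rewrite exp_Ropp exp_ln; lra.
  by apply: C_eq; rewrite /Re /Im /=; ring.
by rewrite Cmult_assoc.
Qed.

End Hypergeometric.

(** * Riemann's method in the characteristic triangle *)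

Lemma continuity_2d_snd (F : R -> R -> R) x y : continuity_2d_pt F x y -> continuous (F x) y.
Proof.
move=> h P [eps hP]; have [d hd] := h eps.
exists d => s hs; apply: hP; apply: hd; first by rewrite Rminus_diag Rabs_R0; exact: cond_pos.
exact: hs.
Qed.

Lemma continuous_RInt_param (F : R -> R -> R) x :
  (forall x y, 0 <= y <= 1 -> continuity_2d_pt F x y) -> continuous (fun x => RInt (F x) 0 1) x.
Proof.
move=> hF P [eps hP].
have ex z : ex_RInt (F z) 0 1.
  apply: ex_RInt_continuous => t ht; apply: continuity_2d_snd; apply: hF.
  by move: ht; rewrite Rmin_left ?Rmax_right; lra.
have e2 : 0 < eps / 2 by have := cond_pos eps; lra.
have hsw y : 0 <= y <= 1 -> continuity_2d_pt (fun u v => F v u) y x.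
  by move=> hy d; have [r hr] := hF x y hy d; exists r => u v hu hv; exact: hr.
have [d hd] := @uniform_continuity_2d_1d (fun u v => F v u) 0 1 x hsw (mkposreal _ e2).
exists d => z hz; apply: hP.
have hz' : Rabs (z - x) < d := hz.
have -> : ball (RInt (F x) 0 1) eps (RInt (F z) 0 1) = (Rabs (RInt (F z) 0 1 - RInt (F x) 0 1) < eps) by [].
have -> : RInt (F z) 0 1 - RInt (F x) 0 1 = RInt (fun t => F z t - F x t) 0 1.
  by symmetry; apply: RInt_minus.
apply: Rle_lt_trans (_ : (1 - 0) * (eps / 2) < _); last by have := cond_pos eps; lra.
apply: abs_RInt_le_const; [lra | by apply: @ex_RInt_minus | move=> t ht; apply: Rlt_le].
have := Rabs_def2 _ _ hz' => h1; have d0 := cond_pos d.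
apply: hd => //; try lra.
by rewrite Rminus_diag Rabs_R0.
Qed.

(* [exp (- t0) * phi (t - t0)] is the radius of the cone at time [t]; [yc tau sg] is
   the [Y] of [Gkernel_Hf] at [t - t0 = tau], [r = sg * exp (- t0) * phi tau]. *)
Definition phi (tau : R) : R := 1 - exp (- tau).

Definition yc (tau sg : R) : R := phi tau ^ 2 * (1 - sg ^ 2) * exp tau / 4.

Lemma yc_ge0 tau sg : 0 <= sg <= 1 -> 0 <= yc tau sg.
Proof.
move=> h; rewrite /yc; have := exp_pos tau; have := pow2_ge_0 (phi tau) => h1 h2.
have h3 : 0 <= 1 - sg ^ 2 by nra.
have := Rmult_le_pos _ _ (Rmult_le_pos _ _ h1 h3) (Rlt_le _ _ h2); lra.
Qed.

Lemma continuity_2d_cont1 (F : R -> R) x y : continuous F x -> continuity_2d_pt (fun u _ => F u) x y.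
Proof.
move=> h; apply: (continuity_1d_2d_pt_comp F (fun u _ => u)); first by apply/continuity_pt_filterlim.
exact: continuity_2d_pt_id1.
Qed.

Lemma continuity_2d_ex (F : R -> R) x y : (forall s, ex_derive F s) -> continuity_2d_pt (fun u _ => F u) x y.
Proof. by move=> h; apply: continuity_2d_cont1; apply: ex_derive_continuous. Qed.

Ltac c2d := repeat first
  [ assumption
  | apply: continuity_2d_pt_plus | apply: continuity_2d_pt_minus | apply: continuity_2d_pt_mult
  | apply: continuity_2d_pt_opp | apply: continuity_2d_pt_const
  | apply: continuity_2d_pt_id1 | apply: continuity_2d_pt_id2 ].

Lemma yc_cont tau sg : continuity_2d_pt yc tau sg.
Proof.
have h1 : continuity_2d_pt (fun u _ => phi u ^ 2 * exp u / 4) tau sg.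
  by apply: continuity_2d_ex => s; rewrite /phi; auto_derive.
have h2 : continuity_2d_pt (fun _ v => 1 - v * v) tau sg by c2d.
apply: (continuity_2d_pt_ext (fun u v => phi u ^ 2 * exp u / 4 * (1 - v * v))); last by c2d.
by move=> u v; rewrite /yc /=; field.
Qed.

Lemma yc_local tau sg : 0 <= sg <= 1 -> locally_2d (fun u v => -1 / 2 < yc u v) tau sg.
Proof.
move=> h; have [d hd] := yc_cont tau sg (mkposreal (1 / 2) ltac:(lra)).
exists d => u v hu hv; have := Rabs_def2 _ _ (hd u v hu hv); rewrite /=.
by have := yc_ge0 tau h; lra.
Qed.

Section Identity.
Variables (M : R) (h h1 h2 : R -> R).
Hypothesis hd0 : forall Y, -1 / 2 < Y -> is_derive h Y (h1 Y).
Hypothesis hd1 : forall Y, -1 / 2 < Y -> is_derive h1 Y (h2 Y).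
Hypothesis hc2 : forall Y, -1 / 2 < Y -> continuous h2 Y.
Hypothesis hode : forall Y, -1 / 2 < Y ->
  Y * (1 + Y) * h2 Y + (1 + 2 * Y) * h1 Y + (M ^ 2 + 1 / 4) * h Y = 0.

(** [A0 t s] stands for a function [u(rho, tau)] taken at [rho = s * phi t], [tau = t]; index 1
    means a derivative in [rho], index 2 one in [tau]. The differential hypotheses are the chain
    rule, as the derivative of [phi] is [exp (- t)]. *)
Variables A0 A1 A2 A11 A12 A22 : R -> R -> R.
Hypothesis A0_s : forall t s, is_derive (A0 t) s (phi t * A1 t s).
Hypothesis A0_t : forall t s, is_derive (fun t => A0 t s) t (s * exp (- t) * A1 t s + A2 t s).
Hypothesis A1_s : forall t s, is_derive (A1 t) s (phi t * A11 t s).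
Hypothesis A2_s : forall t s, is_derive (A2 t) s (phi t * A12 t s).
Hypothesis A2_t : forall t s, is_derive (fun t => A2 t s) t (s * exp (- t) * A12 t s + A22 t s).
Hypothesis cA0 : forall t s, continuity_2d_pt A0 t s.
Hypothesis cA1 : forall t s, continuity_2d_pt A1 t s.
Hypothesis cA2 : forall t s, continuity_2d_pt A2 t s.
Hypothesis cA11 : forall t s, continuity_2d_pt A11 t s.
Hypothesis cA12 : forall t s, continuity_2d_pt A12 t s.
Hypothesis cA22 : forall t s, continuity_2d_pt A22 t s.
Hypothesis neumann : forall t, A1 t 0 = 0.
Variable T : R.
Hypothesis A0_T : forall s, A0 T s = 0.
Hypothesis A2_T : forall s, A2 T s = 0.

Let H0 t s := h (yc t s).
Let H1 t s := h1 (yc t s).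
Let H2 t s := h2 (yc t s).

Let yt t s := (exp t - exp (- t)) * (1 - s ^ 2) / 4.
Let ys t s := - s * phi t ^ 2 * exp t / 2.

Let yc_t t s : is_derive (fun t => yc t s) t (yt t s).
Proof.
rewrite /yc /yt /phi; auto_derive => //.
rewrite exp_Ropp; field; apply: Rgt_not_eq; exact: exp_pos.
Qed.

Let yc_s t s : is_derive (yc t) s (ys t s).
Proof. by rewrite /yc /ys; auto_derive => //; field. Qed.

Let H0_t t s : -1 / 2 < yc t s -> is_derive (fun t => H0 t s) t (yt t s * H1 t s).
Proof. by move=> hy; apply: (is_derive_comp h (fun t => yc t s)); [exact: hd0 | exact: yc_t]. Qed.
Let H1_t t s : -1 / 2 < yc t s -> is_derive (fun t => H1 t s) t (yt t s * H2 t s).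
Proof. by move=> hy; apply: (is_derive_comp h1 (fun t => yc t s)); [exact: hd1 | exact: yc_t]. Qed.
Let H0_s t s : -1 / 2 < yc t s -> is_derive (H0 t) s (ys t s * H1 t s).
Proof. by move=> hy; apply: (is_derive_comp h (yc t)); [exact: hd0 | exact: yc_s]. Qed.
Let H1_s t s : -1 / 2 < yc t s -> is_derive (H1 t) s (ys t s * H2 t s).
Proof. by move=> hy; apply: (is_derive_comp h1 (yc t)); [exact: hd1 | exact: yc_s]. Qed.

(* The partial derivatives of [e^(tau/2) h(Y(rho, tau))] at [rho = s * phi tau]
   are [e^(tau/2) Y_rho h1] and [e^(tau/2) (h / 2 + Y_tau h1)]. *)
Let Yr t s := - s * phi t * exp t / 2.
Let Yt t s := (exp t - exp (- t) - s ^ 2 * phi t ^ 2 * exp t) / 4.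

(** Green's current of [v = e^(tau/2) h(Y)] and [u] in the coordinates [(t, s)]. With
    [L = d_tau^2 - e^(-2 tau) d_rho^2 + M^2] one has [d_t P - d_s Q = phi * (v * L u - u * L v)],
    and [L v = 0] leaves [Nker]. *)
Let P t s := phi t * (exp (t / 2) * (H0 t s * A2 t s - (H0 t s / 2 + Yt t s * H1 t s) * A0 t s)).
Let Q t s := s * exp (- t) * (exp (t / 2) * (H0 t s * A2 t s - (H0 t s / 2 + Yt t s * H1 t s) * A0 t s))
  + exp (- t) ^ 2 * (exp (t / 2) * (H0 t s * A1 t s - Yr t s * H1 t s * A0 t s)).
Definition Nker t s := phi t * exp (t / 2) * h (yc t s) * (A22 t s - exp (- t) ^ 2 * A11 t s + M ^ 2 * A0 t s).

Let dQ t s := exp (- t) * (exp (t / 2) * (H0 t s * A2 t s - (H0 t s / 2 + Yt t s * H1 t s) * A0 t s))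
  + s * exp (- t) * (exp (t / 2) * (ys t s * H1 t s * A2 t s + H0 t s * (phi t * A12 t s)
      - ((ys t s * H1 t s) / 2 + (- s * phi t ^ 2 * exp t / 2) * H1 t s + Yt t s * (ys t s * H2 t s)) * A0 t s
      - (H0 t s / 2 + Yt t s * H1 t s) * (phi t * A1 t s)))
  + exp (- t) ^ 2 * (exp (t / 2) * (ys t s * H1 t s * A1 t s + H0 t s * (phi t * A11 t s)
      - (- phi t * exp t / 2) * H1 t s * A0 t s - Yr t s * (ys t s * H2 t s) * A0 t s
      - Yr t s * H1 t s * (phi t * A1 t s))).

Let Q_s t s : -1 / 2 < yc t s -> is_derive (Q t) s (dQ t s).
Proof.
move=> hy; rewrite /Q /dQ /Yt /Yr.
have a0 := A0_s t s; have a1 := A1_s t s; have a2 := A2_s t s.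
have b0 := H0_s hy; have b1 := H1_s hy.
auto_derive; first by repeat split => //; eexists; eassumption.
rewrite (is_derive_unique _ _ _ a0) (is_derive_unique _ _ _ a1) (is_derive_unique _ _ _ a2).
rewrite (is_derive_unique _ _ _ b0) (is_derive_unique _ _ _ b1).
by field.
Qed.

Let P_t t s : -1 / 2 < yc t s -> is_derive (fun t => P t s) t (Nker t s + dQ t s).
Proof.
move=> hy; rewrite /P /Nker /dQ /Yt /Yr.
have a0 := A0_t t s; have a2 := A2_t t s.
have b0 := H0_t hy; have b1 := H1_t hy.
rewrite /phi; auto_derive; first by repeat split => //; eexists; eassumption.
rewrite (is_derive_unique _ _ _ a0) (is_derive_unique _ _ _ a2).
rewrite (is_derive_unique _ _ _ b0) (is_derive_unique _ _ _ b1).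
have := hode hy; rewrite -/(H0 t s) -/(H1 t s) -/(H2 t s) /yt /ys /phi.
have e0 := exp_pos t; rewrite {1 2 3}/yc /phi !exp_Ropp.
set q := exp (t / 2); set e := exp t in e0 *.
move=> hX.
apply: Rminus_diag_uniq.
(* The difference of the two sides is [- phi t * A0 t s] times [L v], and [L v] is [e^(t/2)] times
   the hypergeometric equation at [yc t s]. *)
match type of hX with ?X = 0 => transitivity (- phi t * A0 t s * q * X); last by rewrite hX; ring end.
rewrite /phi exp_Ropp -/e.
by field; apply: Rgt_not_eq.
Qed.

Let gt0 t s : 0 <= s <= 1 -> -1 / 2 < yc t s.
Proof. by move=> /(yc_ge0 t); lra. Qed.

Let c_exp (F : R -> R) t s : (forall t, ex_derive F t) -> continuity_2d_pt (fun t _ => F t) t s.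
Proof. exact: continuity_2d_ex. Qed.

Let cphi t s : continuity_2d_pt (fun t _ => phi t) t s.
Proof. by apply: c_exp => u; rewrite /phi; auto_derive. Qed.

Let ce1 t s : continuity_2d_pt (fun t _ => exp (- t)) t s.
Proof. by apply: c_exp => u; auto_derive. Qed.

Let ce2 t s : continuity_2d_pt (fun t _ => exp t) t s.
Proof. by apply: c_exp => u; auto_derive. Qed.

Let ce3 t s : continuity_2d_pt (fun t _ => exp (t / 2)) t s.
Proof. by apply: c_exp => u; auto_derive. Qed.

Let cH (F G : R -> R) t s : (forall Y, -1 / 2 < Y -> is_derive F Y (G Y)) -> 0 <= s <= 1 ->
  continuity_2d_pt (fun t s => F (yc t s)) t s.
Proof.
move=> hF hs; apply: continuity_1d_2d_pt_comp; last exact: yc_cont.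
apply/continuity_pt_filterlim; apply: ex_derive_continuous; eexists; apply: hF; exact: gt0.
Qed.

Let cH2 t s : 0 <= s <= 1 -> continuity_2d_pt H2 t s.
Proof.
move=> hs; apply: continuity_1d_2d_pt_comp; last exact: yc_cont.
by apply/continuity_pt_filterlim; apply: hc2; exact: gt0.
Qed.

Lemma Nker_cont t s : 0 <= s <= 1 -> continuity_2d_pt Nker t s.
Proof.
move=> hs; have k0 := cH t hd0 hs; have a0 := cA0 t s; have a1 := cA11 t s; have a2 := cA22 t s.
have e1 := ce1 t s; have e3 := ce3 t s; have p := cphi t s.
rewrite /Nker.
apply: (continuity_2d_pt_ext (fun t s => phi t * exp (t / 2) * h (yc t s) *
   (A22 t s - exp (- t) * exp (- t) * A11 t s + M * M * A0 t s))); first by move=> u v /=; ring.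
by c2d.
Qed.

Let dQ_cont t s : 0 <= s <= 1 -> continuity_2d_pt dQ t s.
Proof.
move=> hs; have k0 : continuity_2d_pt H0 t s := cH t hd0 hs; have k1 : continuity_2d_pt H1 t s := cH t hd1 hs.
have k2 := cH2 t hs.
have a0 := cA0 t s; have a1 := cA1 t s; have a2 := cA2 t s.
have a11 := cA11 t s; have a12 := cA12 t s.
have e1 := ce1 t s; have e2 := ce2 t s; have e3 := ce3 t s; have p := cphi t s.
rewrite /dQ /ys /Yt /Yr /Rdiv /=.
by c2d.
Qed.

Let I t := RInt (P t) 0 1.

Let P_cont t s : 0 <= s <= 1 -> continuity_2d_pt P t s.
Proof.
move=> hs; have k0 : continuity_2d_pt H0 t s := cH t hd0 hs; have k1 : continuity_2d_pt H1 t s := cH t hd1 hs.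
have a0 := cA0 t s; have a2 := cA2 t s.
have e1 := ce1 t s; have e2 := ce2 t s; have e3 := ce3 t s; have p := cphi t s.
rewrite /P /Yt /Rdiv /=.
by c2d.
Qed.

Let seg s : Rmin 0 1 <= s <= Rmax 0 1 -> 0 <= s <= 1.
Proof. by rewrite Rmin_left ?Rmax_right; lra. Qed.

Let I_t t : is_derive I t (RInt (Nker t) 0 1 + (Q t 1 - Q t 0)).
Proof.
have hN : ex_RInt (Nker t) 0 1.
  by apply: ex_RInt_continuous => s /seg hs; apply: continuity_2d_snd; exact: Nker_cont.
have hQ : is_RInt (dQ t) 0 1 (Q t 1 - Q t 0).
  apply: (@is_RInt_derive R_CompleteNormedModule (Q t)) => s /seg hs.
    by apply: Q_s; exact: gt0.
  by apply: continuity_2d_snd; exact: dQ_cont.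
have -> : RInt (Nker t) 0 1 + (Q t 1 - Q t 0) = RInt (fun s => Derive (fun t => P t s) t) 0 1.
  have e := @RInt_plus R_CompleteNormedModule (Nker t) (dQ t) 0 1 hN (ex_intro _ _ hQ).
  rewrite (is_RInt_unique _ _ _ _ hQ) in e; apply: etrans (esym e) _.
  apply: RInt_ext => s hs; symmetry; apply: is_derive_unique; apply: P_t; apply: gt0.
  by move: hs; rewrite Rmin_left ?Rmax_right; lra.
apply: is_derive_RInt_param.
- by apply: filter_forall => u s /seg hs; eexists; apply: P_t; exact: gt0.
- move=> s /seg hs.
  apply: (continuity_2d_pt_ext_loc (fun t s => Nker t s + dQ t s)).
    have [d hd] := yc_local t hs; exists d => u v hu hv; symmetry.
    by apply: is_derive_unique; apply: P_t; exact: hd.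
  by apply: continuity_2d_pt_plus; [exact: Nker_cont | exact: dQ_cont].
- apply: filter_forall => u; apply: ex_RInt_continuous => s /seg hs.
  by exact: (@continuity_2d_snd P u s (P_cont u hs)).
Qed.

(** On the characteristic [s = 1] one has [Y = 0], the terms with [h1] cancel, and the current
    becomes a total derivative along the side; at [s = 0] it vanishes by [neumann]. *)
Let B t := h 0 * exp (- (t / 2)) * A0 t 1.

Let B_t t : is_derive B t (Q t 1 - Q t 0).
Proof.
have a0 := A0_t t 1.
rewrite /B; auto_derive; first by exists (1 * exp (- t) * A1 t 1 + A2 t 1); exact: a0.
rewrite (is_derive_unique _ _ _ a0) /Q /H0 /H1 /Yr /Yt neumann.
have -> : yc t 1 = 0 by rewrite /yc /=; field.
rewrite /phi.
have e1 : exp (t / 2) = exp (- (t / 2)) * exp t by rewrite -exp_plus; congr exp; field.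
have e2 : exp (- (t * / 2)) = exp (- (t / 2)) by [].
rewrite ?e2 e1 !exp_Ropp; have := exp_pos t; have := exp_pos (t / 2).
move: (exp t) (exp (t / 2)) => e q q0 e0; field; split; exact: Rgt_not_eq.
Qed.

(** The integral of the derivative of [I - B]. At [T] both vanish with [A0] and [A2], and [I 0 = 0]
    because [phi 0 = 0], so only [B 0], the value at the apex, is left. *)
Lemma riemann_identity : is_RInt (fun t => RInt (Nker t) 0 1) 0 T (h 0 * A0 0 1).
Proof.
have H t : is_derive (fun t => minus (I t) (B t)) t (RInt (Nker t) 0 1).
  have e (a b : R) : a = minus (a + b) b by rewrite /minus /plus /opp /=; ring.
  by rewrite (e (RInt (Nker t) 0 1) (Q t 1 - Q t 0)); apply: (@is_derive_minus R_AbsRing R_NormedModule I B); [exact: I_t | exact: B_t].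
have hI := @is_RInt_derive R_CompleteNormedModule (fun t => minus (I t) (B t)) (fun t => RInt (Nker t) 0 1) 0 T
  (fun t _ => H t) (fun t _ => @continuous_RInt_param Nker t (fun x y hy => Nker_cont x hy)).
have PT s : P T s = 0 by rewrite /P A0_T A2_T; ring.
have P0 s : P 0 s = 0 by rewrite /P /phi Ropp_0 exp_0; ring.
have IT : I T = 0.
  rewrite /I (RInt_ext _ (fun _ => 0)); first by rewrite RInt_const; exact: Rmult_0_r.
  by move=> s _; exact: PT.
have I0 : I 0 = 0.
  rewrite /I (RInt_ext _ (fun _ => 0)); first by rewrite RInt_const; exact: Rmult_0_r.
  by move=> s _; exact: P0.
have e : minus (minus (I T) (B T)) (minus (I 0) (B 0)) = h 0 * A0 0 1.
  have e0 : exp (- (0 / 2)) = 1 by rewrite -exp_0; congr exp; field.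
  by rewrite IT I0 /B A0_T e0 /minus /plus /opp /= /minus /plus /opp /=; ring.
by rewrite e in hI.
Qed.

End Identity.

(** * Double integrals of complex-valued functions *)

(** Only [s] in [0, 1] is considered, since there [yc] is nonnegative and [Hf] regular. *)
Definition cont_strip (v : R -> R -> C) : Prop := forall t s, 0 <= s <= 1 ->
  continuity_2d_pt (fun t s => Re (v t s)) t s /\ continuity_2d_pt (fun t s => Im (v t s)) t s.

Definition I1 (v : R -> C) : C := (RInt (fun s => Re (v s)) 0 1, RInt (fun s => Im (v s)) 0 1).

(** The outer integral is oriented: [T] is negative for the backward cone. *)
Definition I2 (T : R) (v : R -> R -> C) : C :=
  (RInt (fun t => RInt (fun s => Re (v t s)) 0 1) 0 T, RInt (fun t => RInt (fun s => Im (v t s)) 0 1) 0 T).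

Lemma seg01 s : Rmin 0 1 <= s <= Rmax 0 1 -> 0 <= s <= 1.
Proof. by rewrite Rmin_left ?Rmax_right; lra. Qed.

Lemma seg01' s : Rmin 0 1 < s < Rmax 0 1 -> 0 <= s <= 1.
Proof. by rewrite Rmin_left ?Rmax_right; lra. Qed.

Lemma seg_abs T t : Rmin 0 T <= t <= Rmax 0 T -> Rabs t <= Rabs T.
Proof.
unfold Rmin, Rmax; destruct (Rle_dec 0 T); unfold Rabs; repeat destruct Rcase_abs; lra.
Qed.

(** * Linearity and bounds of the iterated integral *)

Section RealDouble.
Variables (u : R -> R -> R).
Hypothesis cu : forall t s, 0 <= s <= 1 -> continuity_2d_pt u t s.

Lemma ex_RInt_inner t : ex_RInt (u t) 0 1.
Proof. by apply: ex_RInt_continuous => s /seg01 hs; apply: continuity_2d_snd; exact: cu. Qed.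

Lemma cont_outer t : continuous (fun t => RInt (u t) 0 1) t.
Proof. by apply: continuous_RInt_param => x y; exact: cu. Qed.

Lemma ex_RInt_outer a b : ex_RInt (fun t => RInt (u t) 0 1) a b.
Proof. by apply: ex_RInt_continuous => t _; exact: cont_outer. Qed.
End RealDouble.

Lemma abs_RInt_le (g : R -> R) a b K : ex_RInt g a b ->
  (forall t, Rmin a b <= t <= Rmax a b -> Rabs (g t) <= K) -> Rabs (RInt g a b) <= Rabs (b - a) * K.
Proof.
move=> hg hK; case: (Rle_lt_dec a b) => ab.
  rewrite (Rabs_pos_eq (b - a)); last lra.
  by apply: abs_RInt_le_const => // t ht; apply: hK; rewrite Rmin_left ?Rmax_right.
rewrite -opp_RInt_swap; last exact: ex_RInt_swap.
rewrite /opp /= Rabs_Ropp (Rabs_left (b - a)); last lra.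
have -> : - (b - a) * K = (a - b) * K by ring.
apply: abs_RInt_le_const; [lra | exact: ex_RInt_swap | move=> t ht; apply: hK].
by rewrite Rmin_right ?Rmax_left; lra.
Qed.

Lemma RInt2_le (u : R -> R -> R) T K : (forall t s, 0 <= s <= 1 -> continuity_2d_pt u t s) ->
  (forall t s, Rabs t <= Rabs T -> 0 <= s <= 1 -> Rabs (u t s) <= K) ->
  Rabs (RInt (fun t => RInt (u t) 0 1) 0 T) <= Rabs T * K.
Proof.
move=> cu hK; rewrite -{2}(Rminus_0_r T); apply: abs_RInt_le; first exact: ex_RInt_outer.
move=> t ht; have -> : K = Rabs (1 - 0) * K by rewrite Rminus_0_r Rabs_R1; ring.
apply: abs_RInt_le => [|s hs]; first exact: ex_RInt_inner.
apply: hK; last exact: seg01.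
exact: seg_abs.
Qed.

Lemma RInt2_plus (u v : R -> R -> R) T : (forall t s, 0 <= s <= 1 -> continuity_2d_pt u t s) ->
  (forall t s, 0 <= s <= 1 -> continuity_2d_pt v t s) ->
  RInt (fun t => RInt (fun s => u t s + v t s) 0 1) 0 T =
  RInt (fun t => RInt (u t) 0 1) 0 T + RInt (fun t => RInt (v t) 0 1) 0 T.
Proof.
move=> cu cv.
have := @RInt_plus R_CompleteNormedModule _ _ 0 T (ex_RInt_outer cu 0 T) (ex_RInt_outer cv 0 T).
rewrite /plus /= => <-; apply: RInt_ext => t _.
exact: (@RInt_plus R_CompleteNormedModule _ _ 0 1 (ex_RInt_inner cu t) (ex_RInt_inner cv t)).
Qed.

Lemma RInt2_scal (u : R -> R -> R) T c : (forall t s, 0 <= s <= 1 -> continuity_2d_pt u t s) ->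
  RInt (fun t => RInt (fun s => c * u t s) 0 1) 0 T = c * RInt (fun t => RInt (u t) 0 1) 0 T.
Proof.
move=> cu.
have := @RInt_scal R_CompleteNormedModule _ 0 T c (ex_RInt_outer cu 0 T).
rewrite /scal /= /mult /= => <-; apply: RInt_ext => t _.
exact: (@RInt_scal R_CompleteNormedModule _ 0 1 c (ex_RInt_inner cu t)).
Qed.

Lemma cont_strip_plus u v : cont_strip u -> cont_strip v -> cont_strip (fun t s => u t s + v t s)%C.
Proof.
move=> hu hv t s hs; have [a b] := hu t s hs; have [c d] := hv t s hs.
by split; apply: continuity_2d_pt_plus.
Qed.

Lemma cont_strip_mult u v : cont_strip u -> cont_strip v -> cont_strip (fun t s => u t s * v t s)%C.
Proof.
move=> hu hv t s hs; have [a b] := hu t s hs; have [c d] := hv t s hs.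
split.
  by apply: continuity_2d_pt_minus; apply: continuity_2d_pt_mult.
by apply: continuity_2d_pt_plus; apply: continuity_2d_pt_mult.
Qed.

Lemma cont_strip_RtoC (u : R -> R -> R) : (forall t s, 0 <= s <= 1 -> continuity_2d_pt u t s) ->
  cont_strip (fun t s => RtoC (u t s)).
Proof. by move=> hu t s hs; split; [exact: hu | exact: continuity_2d_pt_const]. Qed.

Lemma cont_strip_const c : cont_strip (fun _ _ => c).
Proof. by move=> t s hs; split; exact: continuity_2d_pt_const. Qed.

Lemma cont_strip_scal c u : cont_strip u -> cont_strip (fun t s => c * u t s)%C.
Proof. by move=> hu; apply: cont_strip_mult => //; exact: cont_strip_const. Qed.

Lemma I2_ext T u v : (forall t s, Rabs t <= Rabs T -> 0 <= s <= 1 -> u t s = v t s) -> I2 T u = I2 T v.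
Proof.
move=> h.
have ht t : Rmin 0 T < t < Rmax 0 T -> Rabs t <= Rabs T.
  by move=> ht; apply: seg_abs; lra.
by congr (_, _); apply: RInt_ext => t /ht hht; apply: RInt_ext => s /seg01' hs; rewrite h.
Qed.

Lemma I2_plus T u v : cont_strip u -> cont_strip v -> I2 T (fun t s => u t s + v t s)%C = (I2 T u + I2 T v)%C.
Proof.
move=> hu hv; apply: C_eq.
  exact: (RInt2_plus T (fun t s hs => (hu t s hs).1) (fun t s hs => (hv t s hs).1)).
exact: (RInt2_plus T (fun t s hs => (hu t s hs).2) (fun t s hs => (hv t s hs).2)).
Qed.

Lemma I2_scal T c u : cont_strip u -> I2 T (fun t s => c * u t s)%C = (c * I2 T u)%C.
Proof.
move=> hu; have h1 := fun t s hs => (hu t s hs).1; have h2 := fun t s hs => (hu t s hs).2.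
have sc (k : R) (w : R -> R -> R) : (forall t s, 0 <= s <= 1 -> continuity_2d_pt w t s) ->
    forall t s, 0 <= s <= 1 -> continuity_2d_pt (fun t s => k * w t s) t s.
  by move=> hw t s hs; apply: continuity_2d_pt_mult; [exact: continuity_2d_pt_const | exact: hw].
apply: C_eq.
  transitivity (RInt (fun t => RInt (fun s => Re c * Re (u t s) + - Im c * Im (u t s)) 0 1) 0 T).
    by apply: RInt_ext => t _; apply: RInt_ext => s _; rewrite /Re /Im /=; ring.
  rewrite (RInt2_plus T (sc _ _ h1) (sc _ _ h2)) (RInt2_scal _ _ h1) (RInt2_scal _ _ h2).
  by rewrite /I2 /Re /Im /=; ring.
transitivity (RInt (fun t => RInt (fun s => Re c * Im (u t s) + Im c * Re (u t s)) 0 1) 0 T).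
  by apply: RInt_ext => t _; apply: RInt_ext => s _; rewrite /Re /Im /=; ring.
rewrite (RInt2_plus T (sc _ _ h2) (sc _ _ h1)) (RInt2_scal _ _ h1) (RInt2_scal _ _ h2).
by rewrite /I2 /Re /Im /=; ring.
Qed.

Lemma I2_bound T u K : cont_strip u -> (forall t s, Rabs t <= Rabs T -> 0 <= s <= 1 -> Cmod (u t s) <= K) ->
  Cmod (I2 T u) <= 2 * Rabs T * K.
Proof.
move=> hu hK; apply: Rle_trans (Cmod_le_ReIm _) _.
have := RInt2_le (fun t s hs => (hu t s hs).1) (fun t s h1 h2 => Rle_trans _ _ _ (Re_le_Cmod _) (hK t s h1 h2)).
have := RInt2_le (fun t s hs => (hu t s hs).2) (fun t s h1 h2 => Rle_trans _ _ _ (Im_le_Cmod _) (hK t s h1 h2)).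
by rewrite /I2 /Re /Im /=; lra.
Qed.

Lemma I2_isD T (v : R -> R -> R -> C) v' x0 K : (forall x, cont_strip (v x)) -> cont_strip v' ->
  (forall h t s, Rabs h < 1 -> Rabs t <= Rabs T -> 0 <= s <= 1 ->
     Cmod (v (Rplus x0 h) t s - v x0 t s - RtoC h * v' t s)%C <= K * h ^ 2) ->
  isD (fun x => I2 T (v x)) x0 (I2 T v').
Proof.
move=> cv cv' hK; apply: (@isD_quad _ x0 _ (2 * Rabs T * K) 1) => [|h hh]; first lra.
have -> : (I2 T (v (Rplus x0 h)) - I2 T (v x0) - RtoC h * I2 T v' =
  I2 T (fun t s => v (Rplus x0 h) t s + (-(1) * v x0 t s + - RtoC h * v' t s)))%C.
  rewrite I2_plus //; last by apply: cont_strip_plus; apply: cont_strip_scal.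
  by rewrite I2_plus ?I2_scal //; [ring | exact: cont_strip_scal | exact: cont_strip_scal].
rewrite Rmult_assoc; apply: I2_bound => [|t s ht hs].
  by apply: cont_strip_plus => //; apply: cont_strip_plus; apply: cont_strip_scal.
apply: Rle_trans (hK h t s hh ht hs); apply: Req_le; congr Cmod; ring.
Qed.

Lemma I2_opp T u : cont_strip u -> I2 (- T) u = (- I2 T (fun t s => u (Ropp t) s))%C.
Proof.
move=> hu.
have H (g : R -> R) : (forall t, continuous g t) -> RInt g 0 (- T) = - RInt (fun t => g (- t)) 0 T.
  move=> hg.
  have ex a b : ex_RInt g a b by apply: ex_RInt_continuous => t _; exact: hg.
  have h1 := RInt_correct _ _ _ (ex (- 0) (- T)).
  have h2 := @is_RInt_comp_opp R_NormedModule g 0 T _ h1.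
  have h3 := @is_RInt_opp R_NormedModule _ 0 T _ h2.
  have -> : RInt (fun t => g (- t)) 0 T = - RInt g (- 0) (- T).
    apply: is_RInt_unique; apply: is_RInt_ext h3 => t _.
    by rewrite /opp /=; ring.
  by rewrite Ropp_involutive Ropp_0.
apply: C_eq.
  by apply: H => t; apply: (cont_outer (u := fun t s => Re (u t s))) => x y hy; case: (hu x y hy).
by apply: H => t; apply: (cont_outer (u := fun t s => Im (u t s))) => x y hy; case: (hu x y hy).
Qed.

Lemma chain2_real (f fu : R -> R -> R) (a b : R -> R) s a' b' dv :
  (forall u v, is_derive (fun z => f z v) u (fu u v)) -> is_derive (f (a s)) (b s) dv ->
  continuity_2d_pt fu (a s) (b s) -> is_derive a s a' -> is_derive b s b' ->
  is_derive (fun s => f (a s) (b s)) s (a' * fu (a s) (b s) + b' * dv).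
Proof.
move=> h1 h2 /continuity_2d_pt_filterlim h3 ha hb.
have h0 : locally (a s, b s) (fun u : R * R => is_derive (fun z => f z u.2) u.1 (fu u.1 u.2)).
  by apply: filter_forall => u; exact: h1.
have h4 := @is_derive_filterdiff f (a s) (b s) fu dv h0 h2 h3.
have h5 := @filterdiff_comp'_2 R_AbsRing R_NormedModule R_NormedModule R_NormedModule R_NormedModule
  a b f s _ _ (fun x y => plus (scal x (fu (a s) (b s))) (scal y dv)) ha hb h4.
apply: filterdiff_ext_lin h5 _ => y.
by rewrite /plus /scal /= /mult /=; ring.
Qed.

Lemma chain2 m (F : vec m -> C) w (i k : 'I_m) (a b : R -> R) s a' b' : smooth F -> i != k ->
  is_derive a s a' -> is_derive b s b' ->
  isD (fun s => F (upd (upd w i (a s)) k (b s))) s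
    (RtoC a' * pd i F (upd (upd w i (a s)) k (b s)) + RtoC b' * pd k F (upd (upd w i (a s)) k (b s)))%C.
Proof.
move=> sF ik ha hb.
have hi u v : isD (fun z => F (upd (upd w i z) k v)) u (pd i F (upd (upd w i u) k v)).
  apply: (@isD_ext (fun z => F (upd (upd w k v) i z))); first by move=> z; rewrite upd_comm // eq_sym.
  rewrite upd_comm //; apply: is_pd_line => x; exact: smooth_is_pd1.
have hk u v : isD (fun z => F (upd (upd w i u) k z)) v (pd k F (upd (upd w i u) k v)).
  by apply: is_pd_line => x; exact: smooth_is_pd1.
have hc : continuous (pd i F) (upd (upd w i (a s)) k (b s)) := @smooth_cont m F [:: i] _ sF.
have [c1 cont_strip'] := continuity_2d_upd hc.
split.
  have := chain2_real (fun u v => (hi u v).1) (hk (a s) (b s)).1 c1 ha hb.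
  by rewrite /Re /Im /= !Rmult_0_l !Rminus_0_r.
have := chain2_real (fun u v => (hi u v).2) (hk (a s) (b s)).2 cont_strip' ha hb.
by rewrite /Re /Im /= !Rmult_0_l !Rplus_0_r.
Qed.

(** Twice the kernel [G] times the Jacobian [e^(-t0) * phi t] of the substitution for [r]; see
    [is_RInt_integrand]. *)
Definition kap (M : R) (t s : R) : C := (RtoC (phi t * exp (t / 2)) * Hf M (yc t s))%C.

Lemma kap_cont_strip M : cont_strip (kap M).
Proof.
apply: cont_strip_mult.
  apply: cont_strip_RtoC => t s hs; apply: continuity_2d_ex => u; rewrite /phi; auto_derive => //.
move=> t s hs; have hy : -1 / 2 < yc t s by have := yc_ge0 t hs; lra.
have [h1 h2] := Hf_isD M hy.
split; [apply: (continuity_1d_2d_pt_comp (fun y => Re (Hf M y)))|apply: (continuity_1d_2d_pt_comp (fun y => Im (Hf M y)))];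
  try exact: yc_cont; apply/continuity_pt_filterlim.
  by apply: (@ex_derive_continuous R_AbsRing R_NormedModule (fun y => Re (Hf M y))); eexists; exact: h1.
by apply: (@ex_derive_continuous R_AbsRing R_NormedModule (fun y => Im (Hf M y))); eexists; exact: h2.
Qed.

Definition cont2 (A : R -> R -> C) : Prop := forall t s,
  continuity_2d_pt (fun t s => Re (A t s)) t s /\ continuity_2d_pt (fun t s => Im (A t s)) t s.

Lemma cont2_plus (u v : R -> R -> C) : cont2 u -> cont2 v -> cont2 (fun t s => u t s + v t s)%C.
Proof. by move=> hu hv t s; have [a1 a2] := hu t s; have [b1 b2] := hv t s; split; exact: continuity_2d_pt_plus. Qed.

Lemma cont2_RtoC (c : R -> R -> R) (u : R -> R -> C) : (forall t s, continuity_2d_pt c t s) -> cont2 u ->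
  cont2 (fun t s => RtoC (c t s) * u t s)%C.
Proof.
move=> hc hu t s; have [h1 h2] := hu t s; split.
  apply: (continuity_2d_pt_ext (fun t s => c t s * Re (u t s))); first by move=> x y; rewrite /Re /Im /=; ring.
  exact: continuity_2d_pt_mult.
apply: (continuity_2d_pt_ext (fun t s => c t s * Im (u t s))); first by move=> x y; rewrite /Re /Im /=; ring.
exact: continuity_2d_pt_mult.
Qed.

Section ComplexIdentity.
Variables (M : R).
Variables A0 A1 A2 A11 A12 A22 : R -> R -> C.
Hypothesis A0_s : forall t s, isD (A0 t) s (RtoC (phi t) * A1 t s)%C.
Hypothesis A0_t : forall t s, isD (fun t => A0 t s) t (RtoC (s * exp (- t)) * A1 t s + A2 t s)%C.
Hypothesis A1_s : forall t s, isD (A1 t) s (RtoC (phi t) * A11 t s)%C.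
Hypothesis A2_s : forall t s, isD (A2 t) s (RtoC (phi t) * A12 t s)%C.
Hypothesis A2_t : forall t s, isD (fun t => A2 t s) t (RtoC (s * exp (- t)) * A12 t s + A22 t s)%C.
Hypothesis cA0 : cont2 A0.
Hypothesis cA1 : cont2 A1.
Hypothesis cA2 : cont2 A2.
Hypothesis cA11 : cont2 A11.
Hypothesis cA12 : cont2 A12.
Hypothesis cA22 : cont2 A22.
Hypothesis neumann : forall t, A1 t 0 = 0.
Variable T : R.
Hypothesis A0_T : forall s, A0 T s = 0.
Hypothesis A2_T : forall s, A2 T s = 0.

(** The identity is bilinear in the solution and the kernel and has real coefficients. The complex
    case is therefore assembled from four real ones, [p] taking a part of the solution and [q] one
    of the kernel. *)
Let ident (p q : C -> R) : p = Re \/ p = Im -> q = Re \/ q = Im ->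
  is_RInt (fun t => RInt (Nker M (fun y => q (Hf M y)) (fun t s => p (A0 t s)) (fun t s => p (A11 t s))
    (fun t s => p (A22 t s)) t) 0 1) 0 T (q 1 * p (A0 0 1)).
Proof.
move=> hp hq.
have Hp : (forall (x : R) (z : C), p (RtoC x * z)%C = x * p z) /\ (forall z w : C, p (z + w)%C = p z + p w)
   /\ p (RtoC 0) = 0.
  by case: hp => ->; split; [|split| |split] => *; rewrite /Re /Im /=; ring.
have Hq : (forall (x : R) (z : C), q (RtoC x * z)%C = x * q z) /\ (forall z w : C, q (z + w)%C = q z + q w)
   /\ q (RtoC 0) = 0.
  by case: hq => ->; split; [|split| |split] => *; rewrite /Re /Im /=; ring.
have Dp (f : R -> C) x l : isD f x l -> is_derive (fun s => p (f s)) x (p l).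
  by case: hp => ->; case.
have Dq (f : R -> C) x l : isD f x l -> is_derive (fun s => q (f s)) x (q l).
  by case: hq => ->; case.
have Cp (A : R -> R -> C) : cont2 A -> forall t s, continuity_2d_pt (fun t s => p (A t s)) t s.
  by move=> hA t s; case: hp => ->; case: (hA t s).
case: Hp => p1 [p2 p3]; case: Hq => q1 [q2 q3].
rewrite -(Hf_0 M).
apply: (@riemann_identity M (fun y => q (Hf M y)) (fun y => q (Hf1 M y)) (fun y => q (Hf2 M y)) _ _ _ _
  (fun t s => p (A0 t s)) (fun t s => p (A1 t s)) (fun t s => p (A2 t s))
  (fun t s => p (A11 t s)) (fun t s => p (A12 t s)) (fun t s => p (A22 t s))).
- by move=> Y hY; apply: Dq; exact: Hf_isD.
- by move=> Y hY; apply: Dq; exact: Hf1_isD.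
- move=> Y hY; have [l hl] := Hf2_isD M hY.
  by apply: (@ex_derive_continuous R_AbsRing R_NormedModule); eexists; apply: Dq hl.
- move=> Y hY; rewrite -!q1 -!q2; have := Hf_ode M hY => e.
  by rewrite -[RHS]q3; congr q; exact: e.
- by move=> t s; rewrite -p1; apply: Dp; exact: A0_s.
- by move=> t s; rewrite -p1 -p2; apply: (Dp (fun t => A0 t s)); exact: A0_t.
- by move=> t s; rewrite -p1; apply: Dp; exact: A1_s.
- by move=> t s; rewrite -p1; apply: Dp; exact: A2_s.
- by move=> t s; rewrite -p1 -p2; apply: (Dp (fun t => A2 t s)); exact: A2_t.
- exact: Cp.
- exact: Cp.
- exact: Cp.
- exact: Cp.
- exact: Cp.
- exact: Cp.
- by move=> t; rewrite neumann.
- by move=> s; rewrite A0_T.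
- by move=> s; rewrite A2_T.
Qed.

Let Nk (p q : C -> R) := Nker M (fun y => q (Hf M y)) (fun t s => p (A0 t s)) (fun t s => p (A11 t s))
    (fun t s => p (A22 t s)).

Let Nk_cont p q : p = Re \/ p = Im -> q = Re \/ q = Im ->
  forall t s, 0 <= s <= 1 -> continuity_2d_pt (Nk p q) t s.
Proof.
move=> hp hq t s hs.
have Dq (f : R -> C) x l : isD f x l -> is_derive (fun s => q (f s)) x (q l).
  by case: hq => ->; case.
have Cp (A : R -> R -> C) : cont2 A -> forall t s, continuity_2d_pt (fun t s => p (A t s)) t s.
  by move=> hA t' s'; case: hp => ->; case: (hA t' s').
apply: (@Nker_cont M (fun y => q (Hf M y)) (fun y => q (Hf1 M y))) => //; try exact: Cp.
by move=> Y hY; apply: Dq; exact: Hf_isD.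
Qed.

Lemma riemannC :
  I2 T (fun t s => kap M t s * (A22 t s - RtoC (exp (- t) ^ 2) * A11 t s + RtoC (M ^ 2) * A0 t s))%C = A0 0 1.
Proof.
have l1 := or_introl erefl : Re = Re \/ Re = Im.
have l2 := or_intror erefl : Im = Re \/ Im = Im.
apply: C_eq.
  transitivity (RInt (fun t => RInt (fun s => Nk Re Re t s + -1 * Nk Im Im t s) 0 1) 0 T).
    apply: RInt_ext => t _; apply: RInt_ext => s _.
    by rewrite /Nk /Nker /kap /Re /Im /=; ring.
  rewrite RInt2_plus; last first.
  - by move=> t s hs; apply: continuity_2d_pt_mult; [exact: continuity_2d_pt_const | exact: Nk_cont].
  - exact: Nk_cont.
  rewrite RInt2_scal; last exact: Nk_cont.
  rewrite (is_RInt_unique _ _ _ _ (ident l1 l1)) (is_RInt_unique _ _ _ _ (ident l2 l2)).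
  by rewrite /Re /Im /=; ring.
transitivity (RInt (fun t => RInt (fun s => Nk Im Re t s + Nk Re Im t s) 0 1) 0 T).
  apply: RInt_ext => t _; apply: RInt_ext => s _.
  by rewrite /Nk /Nker /kap /Re /Im /=; ring.
rewrite RInt2_plus; [|exact: Nk_cont|exact: Nk_cont].
rewrite (is_RInt_unique _ _ _ _ (ident l2 l1)) (is_RInt_unique _ _ _ _ (ident l1 l2)).
by rewrite /Re /Im /=; ring.
Qed.
End ComplexIdentity.

(** * The propagation operator and its inversion formulas *)

Lemma continuity_2d_comp m (F : vec m -> C) (g : R -> R -> vec m) t s :
  continuous F (g t s) -> (forall k, continuity_2d_pt (fun t s => g t s k) t s) ->
  continuity_2d_pt (fun t s => Re (F (g t s))) t s /\ continuity_2d_pt (fun t s => Im (F (g t s))) t s.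
Proof.
move=> /continuousC_P hF hg.
have H eps : 0 < eps -> exists2 d, 0 < d & forall u v, Rabs (u - t) < d -> Rabs (v - s) < d ->
    Cmod (F (g u v) - F (g t s))%C < eps.
  move=> /hF [d d0 hd].
  have [r r0 hr] : exists2 r, 0 < r & forall k, k \in enum 'I_m -> forall u v, Rabs (u - t) < r -> Rabs (v - s) < r ->
      Rabs (g u v k - g t s k) < d.
    elim: (enum 'I_m) => [|k l [r r0 hr]]; first by exists 1; [lra|].
    have [r' hr'] := hg k (mkposreal _ d0).
    exists (Rmin r r'); first by apply: Rmin_pos => //; exact: cond_pos.
    move=> k'; rewrite inE => /orP [/eqP ->|hk] u v hu hv.
      by apply: hr'; [apply: Rlt_le_trans hu _ | apply: Rlt_le_trans hv _]; exact: Rmin_r.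
    by apply: hr => //; [apply: Rlt_le_trans hu _ | apply: Rlt_le_trans hv _]; exact: Rmin_l.
  exists r => // u v hu hv; apply: hd => k; apply: hr => //; exact: mem_enum.
split=> eps; have [d d0 hd] := H eps (cond_pos eps); exists (mkposreal _ d0) => u v hu hv;
  apply: Rle_lt_trans (hd u v hu hv); [exact: (Re_le_Cmod (F (g u v) - F (g t s))) | exact: (Im_le_Cmod (F (g u v) - F (g t s)))].
Qed.

Lemma cont_strip_bounded u T : cont_strip u -> exists B, forall t s, Rabs t <= T -> 0 <= s <= 1 -> Cmod (u t s) <= B.
Proof.
move=> hu.
(* Clamping the second variable into [0, 1] extends the function to a locally bounded one on the
   plane, to which [locb_bounded] applies. *)
pose cl s := Rmin 1 (Rmax 0 s).
have cl01 s : 0 <= cl s <= 1.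
  by unfold cl, Rmin, Rmax; destruct (Rle_dec 0 s); destruct Rle_dec; lra.
have cl_id s : 0 <= s <= 1 -> cl s = s.
  by move=> hs; unfold cl, Rmin, Rmax; destruct (Rle_dec 0 s); destruct Rle_dec; lra.
have cl_lip s s' : Rabs (cl s - cl s') <= Rabs (s - s').
  unfold cl, Rmin, Rmax; destruct (Rle_dec 0 s), (Rle_dec 0 s'); repeat destruct Rle_dec; unfold Rabs;
    repeat destruct Rcase_abs; lra.
pose f (x : vec 2) := u (x ord0) (cl (x ord_max)).
have lf : locb f.
  move=> x; have [h1 h2] := hu (x ord0) (cl (x ord_max)) (cl01 _).
  have [d1 hd1] := h1 (mkposreal _ Rlt_0_1); have [d2 hd2] := h2 (mkposreal _ Rlt_0_1).
  exists (Rmin d1 d2), (Cmod (f x) + 2); split; first by apply: Rmin_pos; exact: cond_pos.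
  move=> y hy.
  have k1 d : Rmin d1 d2 <= d -> Rabs (y ord0 - x ord0) < d /\ Rabs (cl (y ord_max) - cl (x ord_max)) < d.
    move=> hd; split; first exact: Rlt_le_trans (hy ord0) hd.
    by apply: Rle_lt_trans (cl_lip _ _) _; exact: Rlt_le_trans (hy ord_max) hd.
  have [a1 a2] := k1 _ (Rmin_l d1 d2); have [b1 b2] := k1 _ (Rmin_r d1 d2).
  have e1 := hd1 _ _ a1 a2; have e2 := hd2 _ _ b1 b2; rewrite /= in e1 e2.
  have := Cmod_sub_le (f y) (f x).
  have := Cmod_le_ReIm (f y - f x)%C.
  have -> : Re (f y - f x)%C = Re (f y) - Re (f x) by [].
  have -> : Im (f y - f x)%C = Im (f y) - Im (f x) by [].
  by rewrite /f in e1 e2 *; lra.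
have [B hB] := locb_bounded lf (Rmax T 1).
exists B => t s ht hs.
pose x : vec 2 := fun k => if k == ord0 then t else s.
have -> : u t s = f x by rewrite /f /x /= cl_id.
apply: hB => k; rewrite /x; case: eqP => _; first exact: Rle_trans ht (Rmax_l _ _).
by rewrite Rabs_pos_eq; [apply: Rle_trans (Rmax_r _ _); lra | lra].
Qed.

Lemma I2_sum T (A : Type) (l : seq A) (u : A -> R -> R -> C) : (forall i, cont_strip (u i)) ->
  cont_strip (fun t s => \big[Cplus/RtoC 0]_(i <- l) u i t s) /\
  I2 T (fun t s => \big[Cplus/RtoC 0]_(i <- l) u i t s) = \big[Cplus/RtoC 0]_(i <- l) I2 T (u i).
Proof.
move=> hu; elim: l => [|i l [IH1 IH2]].
  have e : (fun t s : R => \big[Cplus/RtoC 0]_(i <- [::]) u i t s) = fun t s => (RtoC 0 * RtoC 0)%C.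
    by apply: functional_extensionality => t; apply: functional_extensionality => s; rewrite big_nil; ring.
  rewrite e big_nil I2_scal; last exact: cont_strip_const.
  by split; [exact: cont_strip_scal (cont_strip_const _) | ring].
have e : (fun t s => \big[Cplus/RtoC 0]_(k <- i :: l) u k t s) =
    fun t s => (u i t s + \big[Cplus/RtoC 0]_(k <- l) u k t s)%C.
  by apply: functional_extensionality => t; apply: functional_extensionality => s; rewrite big_cons.
rewrite e big_cons I2_plus // IH2; split => //; exact: cont_strip_plus.
Qed.

Lemma isD_eq f x l l' : l = l' -> isD f x l -> isD f x l'.
Proof. by move=> ->. Qed.

Section Parametrix.
Variables (n : nat) (Ew : R -> functional n).
Hypothesis hEw : wave_fundamental_solution Ew.

Let e : vec n -> vec n.+1 := fun y => st y 0.
Let j : 'I_n -> 'I_n.+1 := lift ord_max.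
Let he : embedding e j := emb_st n.

Local Notation WW := (W Ew e).
Local Notation mx := (@ord_max n).

Let st_upd (z : vec n.+1) i u r0 r : st (upd z i u) r = upd (upd (st z r0) (lift ord_max i) u) ord_max r.
Proof.
apply: functional_extensionality => k; case: (unliftP ord_max k) => [k' ->|->].
  rewrite upd_neq; last by rewrite eq_sym neq_lift.
  by rewrite st_lift /upd (inj_eq (@lift_inj _ _)) st_lift.
by rewrite st_max upd_same.
Qed.

Let space_st (z : vec n.+1) r : space (st z r) = z.
Proof. by apply: functional_extensionality => k; rewrite /space st_lift. Qed.

Let time_st (z : vec n.+1) r : time (st z r) = r.
Proof. by rewrite /time st_max. Qed.

Let WV a f z r : WW a f z r = V Ew e a f (st z r).
Proof. by rewrite /V space_st time_st. Qed.

Lemma W_chain a f z i (al be : R -> R) s al' be' : test_fun f -> is_derive al s al' -> is_derive be s be' ->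
  isD (fun s => WW a f (upd z i (al s)) (be s)) s
    (RtoC al' * WW a (pd i f) (upd z i (al s)) (be s) +
     RtoC be' * WW (~~ a) (dr j a f) (upd z i (al s)) (be s))%C.
Proof.
move=> tf ha hb.
apply: (@isD_ext (fun s => V Ew e a f (upd (upd (st z 0) (lift ord_max i) (al s)) ord_max (be s)))).
  by move=> u; rewrite WV (st_upd z i (al u) 0).
have := chain2 (st z 0) (V_smooth hEw he a tf) (is_derive_st i) ha hb.
rewrite -st_upd (is_pd_pd (V_pd_lift hEw he a i _ tf)) (is_pd_pd (V_pd_max hEw he a _ tf)).
by rewrite -!WV.
Qed.

Lemma W_cont2 a f z i (al be : R -> R -> R) t s : test_fun f ->
  continuity_2d_pt al t s -> continuity_2d_pt be t s ->
  continuity_2d_pt (fun t s => Re (WW a f (upd z i (al t s)) (be t s))) t s /\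
  continuity_2d_pt (fun t s => Im (WW a f (upd z i (al t s)) (be t s))) t s.
Proof.
move=> tf ha hb.
have E : (fun t s => WW a f (upd z i (al t s)) (be t s)) =
   fun t s => V Ew e a f (upd (upd (st z 0) (lift ord_max i) (al t s)) ord_max (be t s)).
  apply: functional_extensionality => u; apply: functional_extensionality => v.
  by rewrite WV (st_upd z i (al u v) 0).
have := @continuity_2d_comp n.+2 (V Ew e a f)
  (fun t s => upd (upd (st z 0) (lift ord_max i) (al t s)) ord_max (be t s)) t s.
rewrite -[fun t s => Re (V _ _ _ _ _)]/(fun t s => Re ((fun t s => V Ew e a f (upd (upd (st z 0) (lift ord_max i) (al t s)) ord_max (be t s))) t s)).
rewrite -[fun t s => Im (V _ _ _ _ _)]/(fun t s => Im ((fun t s => V Ew e a f (upd (upd (st z 0) (lift ord_max i) (al t s)) ord_max (be t s))) t s)).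
rewrite -E; apply; first exact: (@smooth_cont n.+2 (V Ew e a f) [::] _ (V_smooth hEw he a tf)).
move=> k; rewrite /upd; case: eqP => // _; case: eqP => // _.
exact: continuity_2d_pt_const.
Qed.

Lemma W_slice_zero a (f : vec n.+1 -> C) z r : (forall w, time w = time z -> f w = 0) -> WW a f z r = 0.
Proof.
move=> h; rewrite /W.
have -> : slice e f z = fun _ => RtoC 0.
  apply: functional_extensionality => y; rewrite /slice h //.
  by rewrite /time /e st_max Rplus_0_r.
exact: dist_0 (Tw_dist hEw a r).
Qed.

(** General enough to contain, up to sums, all z-derivatives of the integrand: a time derivative may
    bring down a factor [e^(-time z)] from the radius, counted by [k], together with a coefficient
    depending on [t] and [s] only, and flips [a]. *)
Definition gen (c : R -> R -> C) (k : nat) (a : bool) (f : vec n.+1 -> C) (z : vec n.+1) (t s : R) : C :=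
  (c t s * (RtoC (exp (- INR k * time z)) *
     WW a f (upd z mx (time z + t)) (exp (- time z) * (s * phi t))))%C.

Inductive integrand_class : (vec n.+1 -> R -> R -> C) -> Prop :=
| class_gen c k a f : cont_strip c -> test_fun f -> integrand_class (gen c k a f)
| class_plus u v : integrand_class u -> integrand_class v -> integrand_class (fun z t s => u z t s + v z t s)%C.

Let cphi2 t s : continuity_2d_pt (fun t s => s * phi t) t s.
Proof.
apply: continuity_2d_pt_mult; first exact: continuity_2d_pt_id2.
by apply: continuity_2d_ex => u; rewrite /phi; auto_derive.
Qed.

Lemma class_cont_strip v z : integrand_class v -> cont_strip (v z).
Proof.
elim=> [c k a f hc tf|u w _ hu _ hw]; last exact: cont_strip_plus.
apply: cont_strip_mult => //; apply: cont_strip_scal => t s hs.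
apply: (@W_cont2 a f z mx (fun t s => time z + t) (fun t s => exp (- time z) * (s * phi t))) => //.
  by apply: continuity_2d_pt_plus; [exact: continuity_2d_pt_const | exact: continuity_2d_pt_id1].
by apply: continuity_2d_pt_mult; [exact: continuity_2d_pt_const | exact: cphi2].
Qed.

(** The time of the apex enters in three places: the exponential prefactor, the time at which [f] is
    sliced, and the radius. *)
Lemma gen_pd_max c k a f z t s : test_fun f ->
  is_pd mx (fun z => gen c k a f z t s) z
    (gen (fun t s => RtoC (- INR k) * c t s)%C k a f z t s + (gen c k a (pd mx f) z t s +
     gen (fun t s => RtoC (- (s * phi t)) * c t s)%C k.+1 (~~ a) (dr j a f) z t s))%C.
Proof.
move=> tf; rewrite /is_pd -/(time z).
apply: (@isD_ext (fun u => c t s * (RtoC (exp (- INR k * u)) *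
  WW a f (upd z mx (u + t)) (exp (- u) * (s * phi t))))%C).
  by move=> u; rewrite /gen time_upd_max upd_upd.
have h1 : is_derive (fun u => u + t) (time z) 1 by auto_derive.
have h2 : is_derive (fun u => exp (- u) * (s * phi t)) (time z) (- exp (- time z) * (s * phi t)).
  by auto_derive => //; ring.
have h3 : is_derive (fun u => exp (- INR k * u)) (time z) (- INR k * exp (- INR k * time z)).
  by auto_derive => //; ring.
have := isD_scal (c t s) (isD_mult (isD_RtoC h3) (@W_chain a f z mx _ _ _ _ _ tf h1 h2)).
rewrite /gen.
have -> : exp (- INR k.+1 * time z) = exp (- time z) * exp (- INR k * time z).
  by rewrite -exp_plus S_INR; congr exp; ring.
rewrite !RtoC_mult !RtoC_opp !RtoC_mult.
match goal with |- isD _ _ ?x -> isD _ _ ?y => have -> : x = y; last by [] end.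
by ring.
Qed.

Lemma gen_pd_lift c k a f i z t s : test_fun f ->
  is_pd (j i) (fun z => gen c k a f z t s) z (gen c k a (pd (j i) f) z t s).
Proof.
move=> tf; rewrite /is_pd.
apply: (@isD_ext (fun u => c t s * (RtoC (exp (- INR k * time z)) *
  WW a f (upd (upd z mx (time z + t)) (j i) u) (exp (- time z) * (s * phi t))))%C).
  move=> u; rewrite /gen time_upd_lift upd_comm //.
  exact: neq_lift.
apply: isD_scal; apply: isD_scal.
have := W_is_pd hEw he a (j i) (upd z mx (time z + t)) (exp (- time z) * (s * phi t)) tf.
by rewrite /is_pd upd_neq // eq_sym neq_lift.
Qed.

Lemma class_pd v i : integrand_class v -> exists2 v', integrand_class v' & forall z t s, is_pd i (fun z => v z t s) z (v' z t s).
Proof.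
elim=> [c k a f hc tf|u w _ [u' hu hu'] _ [w' hw hw']]; last first.
  exists (fun z t s => u' z t s + w' z t s)%C; first exact: class_plus.
  by move=> z t s; apply: is_pd_plus.
case: (unliftP ord_max i) => [i' ->|->].
  exists (gen c k a (pd (j i') f)); first by apply: class_gen => //; exact: test_pd.
  by move=> z t s; exact: gen_pd_lift.
exists (fun z t s => gen (fun t s => RtoC (- INR k) * c t s)%C k a f z t s + (gen c k a (pd mx f) z t s +
     gen (fun t s => RtoC (- (s * phi t)) * c t s)%C k.+1 (~~ a) (dr j a f) z t s))%C; last first.
  by move=> z t s; exact: gen_pd_max.
apply: class_plus; first by apply: class_gen => //; exact: cont_strip_scal.
apply: class_plus; first by apply: class_gen => //; exact: test_pd.
apply: class_gen; last exact: test_dr.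
apply: cont_strip_mult => //; apply: cont_strip_RtoC => t s _; apply: continuity_2d_pt_opp; exact: cphi2.
Qed.

Lemma class_bounded v T z : integrand_class v -> exists B, forall z' t s, near_vec z 1 z' -> Rabs t <= Rabs T -> 0 <= s <= 1 ->
  Cmod (v z' t s) <= B.
Proof.
elim=> [c k a f hc tf|u w _ [B hB] _ [D hD]]; last first.
  exists (B + D) => z' t s hz ht hs; apply: Rle_trans (Cmod_triangle _ _) _.
  by apply: Rplus_le_compat; [exact: hB | exact: hD].
have [Z [Z0 hZ]] := finite_bound (fun i => Rabs (z i)).
have [Bc hBc] := cont_strip_bounded (Rabs T) hc.
have hz1 z' : near_vec z 1 z' -> forall i, Rabs (z' i) <= Z + 1.
  move=> h i; have -> : z' i = (z' i - z i) + z i by ring.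
  by apply: Rle_trans (Rabs_triang _ _) _; have := h i; have := hZ i; lra.
have exp_le u b : Rabs u <= b -> exp u <= exp b.
  move=> h; case: (Rle_lt_or_eq_dec u b); first by have := Rle_abs u; lra.
    by move=> hl; apply: Rlt_le; exact: exp_increasing.
  by move=> ->; exact: Rle_refl.
pose r0 := exp (Z + 1) * (1 + exp (Rabs T)).
have [Bw hBw] := W_bounded hEw he (Z + 1 + Rabs T) r0 tf.
have k0 := pos_INR k; have T0 := Rabs_pos T.
exists (Bc * (exp (INR k * (Z + 1)) * Bw)) => z' t s hz ht hs.
have hz' := hz1 z' hz; have htz : Rabs (time z') <= Z + 1 := hz' ord_max.
have hphi : Rabs (s * phi t) <= 1 + exp (Rabs T).
  rewrite Rabs_mult (Rabs_pos_eq s); last lra.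
  have : Rabs (phi t) <= 1 + exp (Rabs T).
    rewrite /phi; apply: Rle_trans (Rabs_triang _ _) _.
    rewrite Rabs_R1 Rabs_Ropp (Rabs_pos_eq (exp _)); last by apply: Rlt_le; exact: exp_pos.
    by apply: Rplus_le_compat_l; apply: exp_le; rewrite Rabs_Ropp.
  by have := Rabs_pos (phi t); nra.
have hr : Rabs (exp (- time z') * (s * phi t)) <= r0.
  rewrite Rabs_mult; apply: Rmult_le_compat; try exact: Rabs_pos; last exact: hphi.
  rewrite Rabs_pos_eq; last by apply: Rlt_le; exact: exp_pos.
  by apply: exp_le; rewrite Rabs_Ropp.
rewrite /gen !Cmod_mult Cmod_R; apply: Rmult_le_compat; try exact: Cmod_ge_0.
- by apply: Rmult_le_pos; [exact: Rabs_pos | exact: Cmod_ge_0].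
- exact: hBc.
apply: Rmult_le_compat; try exact: Cmod_ge_0; first exact: Rabs_pos.
  rewrite Rabs_pos_eq; last by apply: Rlt_le; exact: exp_pos.
  apply: exp_le; rewrite Rabs_mult Rabs_Ropp (Rabs_pos_eq (INR k)) //.
  by apply: Rmult_le_compat_l.
apply: hBw => // i; rewrite /upd; case: eqP => _; last by have := hz' i; lra.
by apply: Rle_trans (Rabs_triang _ _) _; lra.
Qed.

Lemma I2_class_is_pd v v' i T z : integrand_class v -> integrand_class v' -> (forall z t s, is_pd i (fun z => v z t s) z (v' z t s)) ->
  is_pd i (fun z => I2 T (v z)) z (I2 T (v' z)).
Proof.
move=> hv hv' h; have [v2 hv2 h2] := class_pd i hv'.
have [B hB] := class_bounded T z hv2.
apply: (@I2_isD T (fun s => v (upd z i s)) (v' z) (z i) (2 * B)).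
- by move=> x; exact: class_cont_strip.
- exact: class_cont_strip.
move=> x t s hx ht hs.
have := @taylor_quadC (fun u => v (upd z i u) t s) (fun u => v' (upd z i u) t s) (fun u => v2 (upd z i u) t s) (z i) 1 B
  (fun u _ => is_pd_line z u (fun y => h y t s)) (fun u _ => is_pd_line z u (fun y => h2 y t s)).
move=> H; have {}H := H (fun u hu => hB (upd z i u) t s (near_vec_upd (near_vec_refl z Rlt_0_1) hu) ht hs) x hx.
by move: H; rewrite upd_id.
Qed.

Lemma I2_class_smooth v T : integrand_class v -> smooth (fun z => I2 T (v z)).
Proof.
move=> hv; apply: (@smooth_class n.+1 (fun g => exists2 v, integrand_class v & g = fun z => I2 T (v z))); last by exists v.
  move=> g [u hu ->] z; have [B hB] := class_bounded T z hu.
  exists 1, (2 * Rabs T * B); split; first lra.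
  move=> y hy; apply: I2_bound; first exact: class_cont_strip.
  by move=> t s ht hs; exact: hB.
move=> g i [u hu ->]; have [u' hu' h] := class_pd i hu.
exists (fun z => I2 T (u' z)); first by exists u'.
by move=> z; exact: I2_class_is_pd.
Qed.

Lemma I2_class_pd v v' i T : integrand_class v -> integrand_class v' -> (forall z t s, is_pd i (fun z => v z t s) z (v' z t s)) ->
  pd i (fun z => I2 T (v z)) = fun z => I2 T (v' z).
Proof.
by move=> h1 h2 h; apply: functional_extensionality => z; apply: is_pd_pd; exact: I2_class_is_pd.
Qed.

Variable M : R.

Definition Kop (T : R) (f : vec n.+1 -> C) (z : vec n.+1) : C := I2 T (gen (kap M) 0 false f z).

(* The transpose of [KG_op M]. *)
Definition KGt (f : vec n.+1 -> C) (z : vec n.+1) : C :=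
  (pd mx (pd mx f) z -
   sumC (fun i => pd (j i) (pd (j i) (fun z => RtoC (exp (- 2 * time z)) * f z)) z)
   + RtoC (M ^ 2) * f z)%C.

Lemma Kop_smooth T f : test_fun f -> smooth (Kop T f).
Proof. by move=> tf; apply: I2_class_smooth; apply: class_gen => //; exact: kap_cont_strip. Qed.

Let pd_exp i f z : smooth f ->
  pd (j i) (fun z => RtoC (exp (- 2 * time z)) * f z)%C z = (RtoC (exp (- 2 * time z)) * pd (j i) f z)%C.
Proof.
move=> sf; apply: is_pd_pd; apply: (@isD_ext (fun s => RtoC (exp (- 2 * time z)) * f (upd z (j i) s))%C).
  by move=> s; rewrite time_upd_lift.
by apply: isD_scal; exact: smooth_is_pd1.
Qed.

Lemma KGtE f z : smooth f ->
  KGt f z = (pd mx (pd mx f) z - RtoC (exp (- 2 * time z)) * lap j f z + RtoC (M ^ 2) * f z)%C.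
Proof.
move=> sf; rewrite /KGt; congr (_ - _ + _)%C; rewrite /lap /sumC.
have -> : \big[Cplus/RtoC 0]_(i < n) pd (j i) (pd (j i) (fun z => RtoC (exp (- 2 * time z)) * f z)%C) z =
   \big[Cplus/RtoC 0]_(i < n) (RtoC (exp (- 2 * time z)) * pd (j i) (pd (j i) f) z)%C.
  apply: eq_bigr => i _.
  have -> : pd (j i) (fun z => RtoC (exp (- 2 * time z)) * f z)%C = fun z => (RtoC (exp (- 2 * time z)) * pd (j i) f z)%C.
    by apply: functional_extensionality => y; exact: pd_exp.
  by apply: pd_exp; exact: smooth_pd.
elim: (index_enum 'I_n) => [|i l IH]; first by rewrite !big_nil; ring.
by rewrite !big_cons IH; set S := bigop _ _ _; ring.
Qed.

Lemma lap_Kop T f z : test_fun f -> lap j (Kop T f) z = Kop T (lap j f) z.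
Proof.
move=> tf; rewrite /lap /sumC -/(lap j f).
have tp i : test_fun (pd (j i) (pd (j i) f)) by apply: test_pd; exact: test_pd.
have e1 i : pd (j i) (pd (j i) (Kop T f)) = fun z => I2 T (gen (kap M) 0 false (pd (j i) (pd (j i) f)) z).
  have g1 := class_gen 0 false (@kap_cont_strip M) tf; have g2 := class_gen 0 false (@kap_cont_strip M) (test_pd (j i) tf).
  rewrite /Kop (I2_class_pd T g1 g2); last by move=> *; exact: gen_pd_lift.
  rewrite (I2_class_pd T g2 (class_gen 0 false (@kap_cont_strip M) (tp i))) //.
  by move=> *; apply: gen_pd_lift; exact: test_pd.
have [_ e2] := I2_sum T (index_enum 'I_n) (fun i => class_cont_strip z (class_gen 0 false (@kap_cont_strip M) (tp i))).
rewrite (eq_bigr (fun i => I2 T (gen (kap M) 0 false (pd (j i) (pd (j i) f)) z))); last by move=> i _; rewrite e1.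
rewrite -e2; apply: I2_ext => t s _ _; rewrite /gen (W_lap hEw he) // /sumC.
elim: (index_enum 'I_n) => [|i l IH]; first by rewrite !big_nil; ring.
by rewrite !big_cons IH; set S := bigop _ _ _; ring.
Qed.

(* Both inversion formulas are instances of [riemannC]: for [KGt] inside the
   integral one follows [W] along times [time z + t]; for [KGt] outside one
   reverses the sign of [t], the kernel being symmetric in its two times. *)
Lemma Kop_KGt T f z : test_fun f ->
  (forall w, time w = time z + T -> f w = 0) -> (forall w, time w = time z + T -> pd mx f w = 0) ->
  Kop T (KGt f) z = f z.
Proof.
move=> tf f0 df0.
have sf : smooth f by case: tf.
have tl : test_fun (lap j f) := test_dr j true tf.
have tm := test_pd mx tf; have tmm := test_pd mx tm.
pose E0 := exp (- time z).
pose w a g t s := WW a g (upd z mx (time z + t)) (E0 * (s * phi t)).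
have w_s a g t s : test_fun g -> isD (fun s => w a g t s) s (RtoC (E0 * phi t) * w (~~ a) (dr j a g) t s)%C.
  move=> tg.
  have h1 : is_derive (fun _ : R => time z + t) s 0 by auto_derive.
  have h2 : is_derive (fun s => E0 * (s * phi t)) s (E0 * phi t) by auto_derive => //; ring.
  have := @W_chain a g z mx _ _ _ _ _ tg h1 h2.
  by rewrite Cmult_0_l Cplus_0_l.
have w_t a g t s : test_fun g -> isD (fun t => w a g t s) t
    (w a (pd mx g) t s + RtoC (E0 * (s * exp (- t))) * w (~~ a) (dr j a g) t s)%C.
  move=> tg.
  have h1 : is_derive (fun t : R => time z + t) t 1 by auto_derive.
  have h2 : is_derive (fun t => E0 * (s * phi t)) t (E0 * (s * exp (- t))).
    by rewrite /phi; auto_derive => //; ring.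
  have := @W_chain a g z mx _ _ _ _ _ tg h1 h2.
  by rewrite Cmult_1_l.
have w_c a g c : test_fun g -> cont2 (fun t s => RtoC c * w a g t s)%C.
  move=> tg; apply: (cont2_RtoC (c := fun _ _ => c)) => [t s|t s]; first exact: continuity_2d_pt_const.
  apply: (@W_cont2 a g z mx (fun t s => time z + t) (fun t s => E0 * (s * phi t))) => //.
    by apply: continuity_2d_pt_plus; [exact: continuity_2d_pt_const | exact: continuity_2d_pt_id1].
  by apply: continuity_2d_pt_mult; [exact: continuity_2d_pt_const | exact: cphi2].
(* Here [u(rho, tau)] is the wave solution with data sliced at time [time z + tau], taken at radius
   [E0 * rho]; each derivative in [rho] produces a factor [E0] and one in the radius. *)
have H := @riemannC M (fun t s => RtoC 1 * w false f t s)%C (fun t s => RtoC E0 * w true f t s)%C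
  (fun t s => RtoC 1 * w false (pd mx f) t s)%C (fun t s => RtoC (E0 * E0) * w false (lap j f) t s)%C
  (fun t s => RtoC E0 * w true (pd mx f) t s)%C (fun t s => RtoC 1 * w false (pd mx (pd mx f)) t s)%C.
have q1 : forall t s, isD (fun s => RtoC 1 * w false f t s)%C s (RtoC (phi t) * (RtoC E0 * w true f t s))%C.
  move=> t s; have h := isD_scal (RtoC 1) (w_s false f t s tf); move: h; apply: isD_eq.
  by rewrite /dr /= !RtoC_mult; ring.
have q2 : forall t s, isD (fun t => RtoC 1 * w false f t s)%C t
    (RtoC (s * exp (- t)) * (RtoC E0 * w true f t s) + RtoC 1 * w false (pd mx f) t s)%C.
  move=> t s; have h := isD_scal (RtoC 1) (w_t false f t s tf); move: h; apply: isD_eq.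
  by rewrite /dr /= !RtoC_mult; ring.
have q3 : forall t s, isD (fun s => RtoC E0 * w true f t s)%C s (RtoC (phi t) * (RtoC (E0 * E0) * w false (lap j f) t s))%C.
  move=> t s; have h := isD_scal (RtoC E0) (w_s true f t s tf); move: h; apply: isD_eq.
  by rewrite /dr /= !RtoC_mult; ring.
have q4 : forall t s, isD (fun s => RtoC 1 * w false (pd mx f) t s)%C s (RtoC (phi t) * (RtoC E0 * w true (pd mx f) t s))%C.
  move=> t s; have h := isD_scal (RtoC 1) (w_s false _ t s tm); move: h; apply: isD_eq.
  by rewrite /dr /= !RtoC_mult; ring.
have q5 : forall t s, isD (fun t => RtoC 1 * w false (pd mx f) t s)%C t
    (RtoC (s * exp (- t)) * (RtoC E0 * w true (pd mx f) t s) + RtoC 1 * w false (pd mx (pd mx f)) t s)%C.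
  move=> t s; have h := isD_scal (RtoC 1) (w_t false _ t s tm); move: h; apply: isD_eq.
  by rewrite /dr /= !RtoC_mult; ring.
have q6 : forall t, (RtoC E0 * w true f t 0)%C = 0.
  by move=> t; rewrite /w Rmult_0_l Rmult_0_r (W1_0 hEw he) //; ring.
have q7 : forall s, (RtoC 1 * w false f T s)%C = 0.
  move=> s; rewrite /w (@W_slice_zero false f (upd z mx (time z + T))); first by ring.
  by move=> v hv; apply: f0; rewrite hv time_upd_max.
have q8 : forall s, (RtoC 1 * w false (pd mx f) T s)%C = 0.
  move=> s; rewrite /w (@W_slice_zero false (pd mx f) (upd z mx (time z + T))); first by ring.
  by move=> v hv; apply: df0; rewrite hv time_upd_max.
have {}H := H q1 q2 q3 q4 q5 (w_c false f 1 tf) (w_c true f E0 tf) (w_c false (pd mx f) 1 tm)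
   (w_c false (lap j f) (E0 * E0) tl) (w_c true (pd mx f) E0 tm) (w_c false (pd mx (pd mx f)) 1 tmm) q6 T q7 q8.
transitivity (RtoC 1 * w false f 0 1)%C; last first.
  rewrite /w /phi Ropp_0 exp_0 (_ : E0 * (1 * (1 - 1)) = 0); last by ring.
  by rewrite (W_0 hEw he) // Rplus_0_r upd_id; ring.
rewrite -H.
apply: I2_ext => t s _ _; rewrite /gen; congr (_ * _)%C.
rewrite (_ : INR 0 = 0) // Ropp_0 Rmult_0_l exp_0 Cmult_1_l.
rewrite {1}/W.
have -> : slice e (KGt f) (upd z mx (time z + t)) = fun y =>
   (slice e (pd mx (pd mx f)) (upd z mx (time z + t)) y +
     (- RtoC (exp (- 2 * (time z + t))) * slice e (lap j f) (upd z mx (time z + t)) y +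
      RtoC (M ^ 2) * slice e f (upd z mx (time z + t)) y))%C.
  apply: functional_extensionality => y; rewrite /slice KGtE //.
  have -> : time (fun k => upd z mx (time z + t) k + e y k) = time z + t.
    by rewrite /time upd_same /e st_max Rplus_0_r.
  by ring.
have s1 := test_slice he (upd z mx (time z + t)) tmm.
have s2 := test_slice he (upd z mx (time z + t)) tl.
have s3 := test_slice he (upd z mx (time z + t)) tf.
rewrite (Tw_add hEw) //; last by apply: test_plus; exact: test_scal.
rewrite (Tw_add hEw); [|exact: test_scal|exact: test_scal].
rewrite !(Tw_scal hEw) //.
have -> : exp (- 2 * (time z + t)) = exp (- t) ^ 2 * (E0 * E0).
  by rewrite /E0 /= -!exp_plus ?Rmult_1_r -!exp_plus; congr exp; ring.
by rewrite /w /W -/E0 RtoC_mult; ring.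
Qed.

(** [yc] is even in [t], and [phi t * exp (t / 2) = exp (t / 2) - exp (- t / 2)] is odd. *)
Let kap_opp t s : kap M (- t) s = (- kap M t s)%C.
Proof.
have e0 := exp_pos t; have e1 := exp_pos (t / 2).
have hy : yc (- t) s = yc t s.
  by rewrite /yc /phi Ropp_involutive exp_Ropp; field; apply: Rgt_not_eq.
rewrite /kap hy.
have -> : phi (- t) * exp (- t / 2) = - (phi t * exp (t / 2)).
  have e2 : exp t = exp (t / 2) * exp (t / 2) by rewrite -exp_plus; congr exp; field.
  have -> : - t / 2 = - (t / 2) by field.
  by rewrite /phi Ropp_involutive !exp_Ropp e2; field; apply: Rgt_not_eq.
by rewrite RtoC_opp; ring.
Qed.

Lemma KGt_Kop T f z : test_fun f ->
  (forall w, time w = time z + T -> f w = 0) -> (forall w, time w = time z + T -> pd mx f w = 0) ->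
  KGt (Kop T f) z = f z.
Proof.
move=> tf f0 df0.
have sf : smooth f by case: tf.
have tl : test_fun (lap j f) := test_dr j true tf.
have tm := test_pd mx tf; have tmm := test_pd mx tm.
rewrite KGtE; last exact: Kop_smooth.
rewrite lap_Kop //.
have g0 := class_gen 0 false (@kap_cont_strip M) tf; have gl := class_gen 0 false (@kap_cont_strip M) tl.
have [v1 g1 h1] := class_pd mx g0; have [v2 g2 h2] := class_pd mx g1.
rewrite {1}/Kop (I2_class_pd T g0 g1 h1) (I2_class_pd T g1 g2 h2).
pose X a g u t s := WW a g (upd z mx (u + t)) (exp (- u) * (s * phi t)).
have X_d a g u t s : test_fun g -> isD (fun u => X a g u t s) u
    (X a (pd mx g) u t s + RtoC (- (exp (- u) * (s * phi t))) * X (~~ a) (dr j a g) u t s)%C.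
  move=> tg.
  have k1 : is_derive (fun u : R => u + t) u 1 by auto_derive.
  have k2 : is_derive (fun u => exp (- u) * (s * phi t)) u (- (exp (- u) * (s * phi t))).
    by auto_derive => //; ring.
  have := @W_chain a g z mx _ _ _ _ _ tg k1 k2.
  by rewrite Cmult_1_l.
have v0E u t s : gen (kap M) 0 false f (upd z mx u) t s = (kap M t s * X false f u t s)%C.
  by rewrite /gen time_upd_max upd_upd (_ : INR 0 = 0) // Ropp_0 Rmult_0_l exp_0 Cmult_1_l.
have v1E u t s : v1 (upd z mx u) t s = (kap M t s * (X false (pd mx f) u t s +
    RtoC (- (exp (- u) * (s * phi t))) * X true f u t s))%C.
  apply: isD_unique (is_pd_line z u (fun y => h1 y t s)) _.
  by apply: (isD_ext (fun u => esym (v0E u t s))); apply: isD_scal; exact: (X_d false f).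
have v2E u t s : v2 (upd z mx u) t s = (kap M t s * ((X false (pd mx (pd mx f)) u t s +
    RtoC (- (exp (- u) * (s * phi t))) * X true (pd mx f) u t s) +
    (RtoC (exp (- u) * (s * phi t)) * X true f u t s + RtoC (- (exp (- u) * (s * phi t))) *
      (X true (pd mx f) u t s + RtoC (- (exp (- u) * (s * phi t))) * X false (lap j f) u t s))))%C.
  apply: isD_unique (is_pd_line z u (fun y => h2 y t s)) _.
  apply: (isD_ext (fun u => esym (v1E u t s))); apply: isD_scal; apply: isD_plus; first exact: (X_d false).
  apply: isD_mult; last exact: (X_d true).
  by apply: isD_RtoC; auto_derive => //; ring.
pose E0 := exp (- time z).
pose w a g t s := WW a g (upd z mx (time z + - t)) (E0 * (s * phi (- t))).
have Xw a g t s : X a g (time z) (- t) s = w a g t s by [].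
transitivity (I2 T (fun t s => v2 z t s + (RtoC (- exp (- 2 * time z)) * gen (kap M) 0 false (lap j f) z t s +
   RtoC (M ^ 2) * gen (kap M) 0 false f z t s)))%C.
  rewrite I2_plus; [|exact: class_cont_strip|by apply: cont_strip_plus; apply: cont_strip_scal; exact: class_cont_strip].
  rewrite I2_plus; [|by apply: cont_strip_scal; exact: class_cont_strip|by apply: cont_strip_scal; exact: class_cont_strip].
  rewrite !I2_scal; [|exact: class_cont_strip|exact: class_cont_strip].
  by rewrite /Kop RtoC_opp; ring.
rewrite -{1}(Ropp_involutive T) I2_opp; last first.
  by apply: cont_strip_plus; [exact: class_cont_strip | apply: cont_strip_plus; apply: cont_strip_scal; exact: class_cont_strip].
have w_s a g t s : test_fun g -> isD (fun s => w a g t s) s (RtoC (E0 * phi (- t)) * w (~~ a) (dr j a g) t s)%C.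
  move=> tg.
  have k1 : is_derive (fun _ : R => time z + - t) s 0 by auto_derive.
  have k2 : is_derive (fun s => E0 * (s * phi (- t))) s (E0 * phi (- t)) by auto_derive => //; ring.
  have := @W_chain a g z mx _ _ _ _ _ tg k1 k2.
  by rewrite Cmult_0_l Cplus_0_l.
have w_t a g t s : test_fun g -> isD (fun t => w a g t s) t
    (- w a (pd mx g) t s + RtoC (- (E0 * (s * exp t))) * w (~~ a) (dr j a g) t s)%C.
  move=> tg.
  have k1 : is_derive (fun t : R => time z + - t) t (-1) by auto_derive => //; ring.
  have k2 : is_derive (fun t => E0 * (s * phi (- t))) t (- (E0 * (s * exp t))).
    by rewrite /phi; auto_derive => //; rewrite ?Ropp_involutive; ring.
  have := @W_chain a g z mx _ _ _ _ _ tg k1 k2.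
  apply: isD_eq; congr (_ + _)%C.
  by rewrite -/(w a (pd mx g) t s) (_ : RtoC (-1) = - RtoC 1)%C; [ring | rewrite -RtoC_opp].
have w_c a g t s : test_fun g -> 
    continuity_2d_pt (fun t s => Re (w a g t s)%C) t s /\ continuity_2d_pt (fun t s => Im (w a g t s)%C) t s.
  move=> tg.
  apply: (@W_cont2 a g z mx (fun t s => time z + - t) (fun t s => E0 * (s * phi (- t))) t s tg).
    by apply: continuity_2d_ex => u; auto_derive.
  apply: continuity_2d_pt_mult; first exact: continuity_2d_pt_const.
  apply: continuity_2d_pt_mult; first exact: continuity_2d_pt_id2.
  by apply: continuity_2d_ex => u; rewrite /phi; auto_derive.
have c_e t s : continuity_2d_pt (fun t _ => - (E0 * exp t)) t s by apply: continuity_2d_ex => u; auto_derive.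
have c_r t s : continuity_2d_pt (fun t s => E0 * (s * phi (- t))) t s.
  apply: continuity_2d_pt_mult; first exact: continuity_2d_pt_const.
  apply: continuity_2d_pt_mult; first exact: continuity_2d_pt_id2.
  by apply: continuity_2d_ex => u; rewrite /phi; auto_derive.
have c_k (k : R) t s : continuity_2d_pt (fun _ _ => k) t s by exact: continuity_2d_pt_const.
have phiN t : RtoC (phi (- t)) = (- (RtoC (phi t) * RtoC (exp t)))%C.
  by rewrite -RtoC_mult -RtoC_opp /phi Ropp_involutive exp_Ropp; congr RtoC; field; apply: Rgt_not_eq; exact: exp_pos.
have expN t : (RtoC (exp (- t)) * RtoC (exp t) = 1)%C.
  by rewrite -RtoC_mult -exp_plus Rplus_opp_l exp_0.
(* In terms of [rho = s * phi t] the radius is [- E0 * e^t * rho], that is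
   [- e^(-(time z - t)) * rho]. Apex time and [t] thus enter only through their difference once
   [rho] is fixed, so two derivatives in the apex time are two derivatives in [tau], collected in
   [A22]. The factor [e^(2 t)] of [A11] cancels the coefficient in the identity. *)
pose A0 t s := w false f t s.
pose A1 t s := (RtoC (- (E0 * exp t)) * w true f t s)%C.
pose A11 t s := (RtoC (E0 * exp t * (E0 * exp t)) * w false (lap j f) t s)%C.
pose A2 t s := (RtoC (E0 * (s * phi (- t))) * w true f t s + RtoC (-1) * w false (pd mx f) t s)%C.
pose A12 t s := (RtoC (- (E0 * exp t)) * (w true f t s + (RtoC (E0 * (s * phi (- t))) * w false (lap j f) t s
   + RtoC (-1) * w true (pd mx f) t s)))%C.
pose A22 t s := ((w false (pd mx (pd mx f)) t s +
    RtoC (- (E0 * (s * phi (- t)))) * w true (pd mx f) t s) +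
    (RtoC (E0 * (s * phi (- t))) * w true f t s + RtoC (- (E0 * (s * phi (- t)))) *
      (w true (pd mx f) t s + RtoC (- (E0 * (s * phi (- t)))) * w false (lap j f) t s)))%C.
have N1 : RtoC (-1) = (- RtoC 1)%C by rewrite -RtoC_opp.
have q1 : forall t s, isD (A0 t) s (RtoC (phi t) * A1 t s)%C.
  move=> t s; apply: isD_eq (w_s false f t s tf).
  by rewrite /A1 /dr /= !RtoC_opp !RtoC_mult phiN; ring.
have q2 : forall t s, isD (fun t => A0 t s) t (RtoC (s * exp (- t)) * A1 t s + A2 t s)%C.
  move=> t s; apply: isD_eq (w_t false f t s tf).
  cbv beta iota delta [dr negb]; rewrite /A1 /A2 N1 !RtoC_opp !RtoC_mult.
  have -> : RtoC (phi (- t)) = (1 - RtoC (exp t))%C by rewrite /phi Ropp_involutive RtoC_minus.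
  have -> : (RtoC s * RtoC (exp (- t)) * (- (RtoC E0 * RtoC (exp t)) * w true f t s) =
    - (RtoC s * RtoC E0 * (RtoC (exp (- t)) * RtoC (exp t)) * w true f t s))%C by ring.
  by rewrite expN; ring.
have q3 : forall t s, isD (A1 t) s (RtoC (phi t) * A11 t s)%C.
  move=> t s; apply: isD_eq (isD_scal (RtoC (- (E0 * exp t))) (w_s true f t s tf)).
  cbv beta iota delta [dr negb]; rewrite /A11 !RtoC_opp !RtoC_mult phiN; ring.
have dlin t s : is_derive (fun s => E0 * (s * phi (- t))) s (E0 * phi (- t)) by auto_derive => //; ring.
have q4 : forall t s, isD (A2 t) s (RtoC (phi t) * A12 t s)%C.
  move=> t s.
  apply: isD_eq (isD_plus (isD_mult (isD_RtoC (dlin t s)) (w_s true f t s tf)) (isD_scal (RtoC (-1)) (w_s false _ t s tm))).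
  cbv beta iota delta [dr negb]; rewrite /A12 N1 !RtoC_opp !RtoC_mult phiN; ring.
have dlint t s : is_derive (fun t => E0 * (s * phi (- t))) t (- (E0 * (s * exp t))).
  by rewrite /phi; auto_derive => //; rewrite ?Ropp_involutive; ring.
have q5 : forall t s, isD (fun t => A2 t s) t (RtoC (s * exp (- t)) * A12 t s + A22 t s)%C.
  move=> t s.
  apply: isD_eq (isD_plus (isD_mult (isD_RtoC (dlint t s)) (w_t true f t s tf)) (isD_scal (RtoC (-1)) (w_t false _ t s tm))).
  cbv beta iota delta [dr negb]; rewrite /A12 /A22 N1 !RtoC_opp !RtoC_mult.
  have -> : RtoC (exp t) = (1 - RtoC (phi (- t)))%C by rewrite /phi Ropp_involutive RtoC_minus; ring.
  have -> : (RtoC s * RtoC (exp (- t)) * (- (RtoC E0 * (1 - RtoC (phi (- t)))) * (w true f t s + (RtoC E0 * (RtoC s * RtoC (phi (- t))) * w false (lap j f) t s + - RtoC 1 * w true (pd mx f) t s))) =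
    - (RtoC s * RtoC E0 * (RtoC (exp (- t)) * (1 - RtoC (phi (- t)))) * (w true f t s + (RtoC E0 * (RtoC s * RtoC (phi (- t))) * w false (lap j f) t s + - RtoC 1 * w true (pd mx f) t s))))%C by ring.
  have -> : (RtoC (exp (- t)) * (1 - RtoC (phi (- t))) = 1)%C.
    have -> : (1 - RtoC (phi (- t)) = RtoC (exp t))%C by rewrite /phi Ropp_involutive RtoC_minus; ring.
    exact: expN.
  by ring.
have c_n t s : continuity_2d_pt (fun t s => - (E0 * (s * phi (- t)))) t s by apply: continuity_2d_pt_opp; exact: c_r.
have wc a g : test_fun g -> cont2 (w a g) by move=> tg t s; exact: w_c.
have kA0 : cont2 A0 by exact: wc.
have kA1 : cont2 A1 by apply: (cont2_RtoC (c := fun t _ => - (E0 * exp t))) => //; exact: wc.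
have kA2 : cont2 A2.
  by apply: cont2_plus; [apply: (cont2_RtoC c_r) | apply: (cont2_RtoC (c_k (-1)))]; exact: wc.
have kA11 : cont2 A11.
  apply: (cont2_RtoC (c := fun t _ => E0 * exp t * (E0 * exp t))) => [t s|]; last exact: wc.
  by apply: continuity_2d_ex => u; auto_derive.
have kA12 : cont2 A12.
  apply: (cont2_RtoC (c := fun t _ => - (E0 * exp t))) => //; apply: cont2_plus; first exact: wc.
  by apply: cont2_plus; [apply: (cont2_RtoC c_r) | apply: (cont2_RtoC (c_k (-1)))]; exact: wc.
have kA22 : cont2 A22.
  apply: cont2_plus; first by apply: cont2_plus; [exact: wc | apply: (cont2_RtoC c_n); exact: wc].
  apply: cont2_plus; first by apply: (cont2_RtoC c_r); exact: wc.
  by apply: (cont2_RtoC c_n); apply: cont2_plus; [exact: wc | apply: (cont2_RtoC c_n); exact: wc].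
have q6 : forall t, A1 t 0 = 0.
  by move=> t; rewrite /A1 /w Rmult_0_l Rmult_0_r (W1_0 hEw he) //; ring.
have q7 : forall s, A0 (- T) s = 0.
  move=> s; rewrite /A0 /w (@W_slice_zero false f (upd z mx (time z + - - T))) //.
  by move=> v hv; apply: f0; rewrite hv time_upd_max Ropp_involutive.
have q8 : forall s, A2 (- T) s = 0.
  move=> s; rewrite /A2 /w (@W_slice_zero false (pd mx f) (upd z mx (time z + - - T))); last first.
    by move=> v hv; apply: df0; rewrite hv time_upd_max Ropp_involutive.
  rewrite (@W_slice_zero true f (upd z mx (time z + - - T))); first by ring.
  by move=> v hv; apply: f0; rewrite hv time_upd_max Ropp_involutive.
have H := @riemannC M A0 A1 A2 A11 A12 A22 q1 q2 q3 q4 q5 kA0 kA1 kA2 kA11 kA12 kA22 q6 (- T) q7 q8.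
transitivity (A0 0 1); last first.
  rewrite /A0 /w /phi Ropp_0 Ropp_0 exp_0 (_ : E0 * (1 * (1 - 1)) = 0); last by ring.
  by rewrite (W_0 hEw he) // Rplus_0_r upd_id.
rewrite -H.
transitivity (I2 (Ropp T) (fun t s => -(1) * (v2 z (Ropp t) s + (RtoC (- exp (- 2 * time z)) * gen (kap M) 0 false (lap j f) z (Ropp t) s +
   RtoC (M ^ 2) * gen (kap M) 0 false f z (Ropp t) s))))%C.
  rewrite I2_scal; first by ring.
  have cN (u : R -> R -> C) : cont_strip u -> cont_strip (fun t s => u (Ropp t) s).
    move=> hu t s hs; have [a1 a2] := hu (- t) s hs; split => eps.
      have [d hd] := a1 eps; exists d => x y hx hy; apply: hd => //.
      by rewrite (_ : - x - - t = - (x - t)); [rewrite Rabs_Ropp | ring].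
    have [d hd] := a2 eps; exists d => x y hx hy; apply: hd => //.
    by rewrite (_ : - x - - t = - (x - t)); [rewrite Rabs_Ropp | ring].
  apply: (cN (fun t s => v2 z t s + (RtoC (- exp (- 2 * time z)) * gen (kap M) 0 false (lap j f) z t s +
   RtoC (M ^ 2) * gen (kap M) 0 false f z t s))%C).
  by apply: cont_strip_plus; [exact: class_cont_strip | apply: cont_strip_plus; apply: cont_strip_scal; exact: class_cont_strip].
apply: I2_ext => t s _ _.
have -> : v2 z (- t) s = v2 (upd z mx (time z)) (- t) s by rewrite /time upd_id.
rewrite v2E !Xw -/E0 -/(A22 t s) /gen kap_opp (_ : INR 0 = 0) // Ropp_0 Rmult_0_l exp_0 !Cmult_1_l -/E0.
rewrite -/(w false f t s) -/(w false (lap j f) t s) -/(A0 t s) /A11.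
have -> : exp (- 2 * time z) = E0 * E0 by rewrite /E0 -exp_plus; congr exp; ring.
have -> : (RtoC (exp (- t) ^ 2) * (RtoC (E0 * exp t * (E0 * exp t)) * w false (lap j f) t s) =
   RtoC (E0 * E0) * w false (lap j f) t s)%C.
  rewrite Cmult_assoc -RtoC_mult; congr (RtoC _ * _)%C.
  rewrite exp_Ropp; field; apply: Rgt_not_eq; exact: exp_pos.
by rewrite RtoC_opp; ring.
Qed.

End Parametrix.

(** * Smooth cutoffs and supports of distributions *)

(** From [exp (u / m) >= u / m], raised to the power [m]. *)
Lemma pow_le_exp m u : 0 <= u -> u ^ m <= INR m ^ m * exp u.
Proof.
move=> u0; case: m => [|m]; first by rewrite /= Rmult_1_l -exp_0; case: (Rle_lt_or_eq_dec 0 u u0) => [h|<-];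
  [apply: Rlt_le; exact: exp_increasing | exact: Rle_refl].
have m0 : 0 < INR m.+1 by apply: lt_0_INR; apply/ltP.
have e1 x k : exp (INR k * x) = exp x ^ k.
  elim: k => [|k IH]; first by rewrite Rmult_0_l exp_0.
  by rewrite S_INR Rmult_plus_distr_r exp_plus IH Rmult_1_l /=; ring.
have e2 : u = INR m.+1 * (u / INR m.+1) by field; apply: Rgt_not_eq.
rewrite {2}e2 e1 {1}e2 Rpow_mult_distr; apply: Rmult_le_compat_l; first by apply: pow_le; lra.
have v0 : 0 <= u / INR m.+1 by apply: Rdiv_le_0_compat.
apply: pow_incr; split => //.
by have := exp_ineq1_le (u / INR m.+1); lra.
Qed.

(** The functions [x^(-k) e^(-1/x)], extended by 0: their linear span contains all derivatives of
    [e^(-1/x)]. *)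
Definition flat (k : nat) (x : R) : R := if Rle_dec x 0 then 0 else (/ x) ^ k * exp (- / x).

Lemma flat_neg k x : x <= 0 -> flat k x = 0.
Proof. by rewrite /flat; case: Rle_dec. Qed.

Lemma flat_pos k x : 0 < x -> flat k x = (/ x) ^ k * exp (- / x).
Proof. by rewrite /flat; case: Rle_dec => // h h2; lra. Qed.

(** With [u = / h], the function [u^(k + 2) e^(-u)] is bounded; the estimate is the quadratic
    remainder that gives derivative 0 at 0. *)
Lemma flat_quad k h : Rabs (flat k h) <= INR k.+2 ^ k.+2 * h ^ 2.
Proof.
have c0 : 0 <= INR k.+2 ^ k.+2 by apply: pow_le; exact: pos_INR.
case: (Rle_lt_dec h 0) => h0.
  by rewrite flat_neg // Rabs_R0; apply: Rmult_le_pos => //; exact: pow2_ge_0.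
rewrite flat_pos //.
have u0 : 0 < / h by exact: Rinv_0_lt_compat.
rewrite Rabs_pos_eq; last by apply: Rmult_le_pos; [apply: pow_le; lra | apply: Rlt_le; exact: exp_pos].
have := @pow_le_exp k.+2 (/ h) (Rlt_le _ _ u0).
have e1 : (/ h) ^ k * exp (- / h) = (/ h) ^ k.+2 * h ^ 2 * exp (- / h).
  by rewrite /=; field; apply: Rgt_not_eq.
have e2 : exp (/ h) * exp (- / h) = 1 by rewrite -exp_plus Rplus_opp_r exp_0.
have p1 := exp_pos (- / h); have p2 := pow2_ge_0 h => H.
rewrite e1; have := Rmult_le_compat_r _ _ _ (Rmult_le_pos _ _ p2 (Rlt_le _ _ p1)) H.
have -> : INR k.+2 ^ k.+2 * exp (/ h) * (h ^ 2 * exp (- / h)) = INR k.+2 ^ k.+2 * h ^ 2 * (exp (/ h) * exp (- / h)) by ring.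
by rewrite e2 Rmult_1_r (Rmult_assoc _ (h ^ 2)).
Qed.

Lemma flat_derive k x : is_derive (flat k) x (- INR k * flat k.+1 x + flat k.+2 x).
Proof.
case: (Rtotal_order x 0) => [x0|[->|x0]].
- rewrite !flat_neg; try lra.
  have -> : - INR k * 0 + 0 = 0 by ring.
  apply: (is_derive_ext_loc (fun _ => 0)); last exact: is_derive_const.
  have e0 : 0 < - x by lra.
  exists (mkposreal _ e0) => y hy; rewrite flat_neg //.
  have : Rabs (y - x) < - x := hy; move=> /Rabs_def2; lra.
- rewrite !flat_neg; try lra.
  have -> : - INR k * 0 + 0 = 0 by ring.
  apply: (@is_derive_quad _ 0 0 (INR k.+2 ^ k.+2) 1) => [|h _]; first lra.
  rewrite Rplus_0_l (flat_neg k (Rle_refl 0)) Rmult_0_r !Rminus_0_r; exact: flat_quad.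
- rewrite !flat_pos //.
  apply: (is_derive_ext_loc (fun y => (/ y) ^ k * exp (- / y))).
    exists (mkposreal _ x0) => y hy; rewrite flat_pos //.
    have : Rabs (y - x) < x := hy; move=> /Rabs_def2; lra.
  auto_derive; first by repeat split => //; apply: Rgt_not_eq.
  case: k => [|k]; first by rewrite /=; field; apply: Rgt_not_eq.
  rewrite -pred_Sn S_INR /=; field; apply: Rgt_not_eq; exact: x0.
Qed.

(** The linear span of products flat at 0 and at 1, closed under differentiation and zero outside
    (0, 1). *)
Inductive bumps : (R -> R) -> Prop :=
| bumps_base i k : bumps (fun x => flat i x * flat k (1 - x))
| bumps_scal c f : bumps f -> bumps (fun x => c * f x)
| bumps_plus f g : bumps f -> bumps g -> bumps (fun x => f x + g x).

Lemma bumps_derive f : bumps f -> exists2 g, bumps g & forall x, is_derive f x (g x).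
Proof.
elim=> [i k|c u hu [g hg h]|u v hu [g hg h1] hv [g' hg' h2]].
- exists (fun x => (- INR i * (flat i.+1 x * flat k (1 - x)) + flat i.+2 x * flat k (1 - x)) +
     (INR k * (flat i x * flat k.+1 (1 - x)) + -1 * (flat i x * flat k.+2 (1 - x)))).
    by do ! first [apply: bumps_plus | apply: bumps_base | apply: bumps_scal].
  move=> x; have h1 := flat_derive i x; have h2 := flat_derive k (1 - x).
  auto_derive; first by split; [eexists; exact: h1 | split => //; eexists; exact: h2].
  rewrite (_ : Derive (fun x0 => flat i x0) x = - INR i * flat i.+1 x + flat i.+2 x); last exact: is_derive_unique.
  rewrite (_ : Derive (fun x0 => flat k x0) (1 + - x) = - INR k * flat k.+1 (1 - x) + flat k.+2 (1 - x)); last exact: is_derive_unique.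
  by rewrite -/(1 - x); ring.
- exists (fun x => c * g x); first exact: bumps_scal.
  by move=> x; apply: is_derive_scal.
- exists (fun x => g x + g' x); first exact: bumps_plus.
  by move=> x; apply: @is_derive_plus.
Qed.

(** The normalised primitive of the bump [flat 0 x * flat 0 (1 - x)], with all its derivatives as
    the sequence [h]. *)
Lemma exists_step : exists h : nat -> R -> R,
  [/\ forall k x, is_derive (h k) x (h k.+1 x), forall x, x <= 0 -> h 0%N x = 0 & forall x, 1 <= x -> h 0%N x = 1].
Proof.
pose b x := flat 0 x * flat 0 (1 - x).
have hb : bumps b := bumps_base 0 0.
have cb x : continuous b x.
  have [g _ h] := bumps_derive hb; apply: (@ex_derive_continuous R_AbsRing R_NormedModule); eexists; exact: h.
have exb u v : ex_RInt b u v by apply: ex_RInt_continuous => z _; exact: cb.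
have bpos x : 0 < x < 1 -> 0 < b x.
  move=> hx; rewrite /b !flat_pos; try lra.
  by apply: Rmult_lt_0_compat; rewrite /= Rmult_1_l; exact: exp_pos.
have bneg x : x <= 0 -> b x = 0 by move=> hx; rewrite /b flat_neg //; ring.
have bone x : 1 <= x -> b x = 0.
  by move=> hx; rewrite /b [flat 0 (1 - x)]flat_neg; [ring | lra].
pose c := RInt b 0 1.
have c0 : 0 < c.
  apply: RInt_gt_0 => [|x hx|x _]; [lra | exact: bpos | exact: cb].
pose eta x := RInt b 0 x / c.
have deta x : is_derive eta x (/ c * b x).
  have h1 : is_derive (fun x => RInt b 0 x) x (b x).
    apply: (@is_derive_RInt R_NormedModule _ _ 0); last exact: cb.
    by apply: filter_forall => t; apply: RInt_correct; exact: exb.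
  apply: (is_derive_ext (fun x => / c * RInt b 0 x)); first by move=> t; rewrite /eta /Rdiv Rmult_comm.
  exact: is_derive_scal.
pose P f := f = eta \/ bumps f.
have hP f : P f -> exists2 g, P g & forall x, is_derive f x (g x).
  case=> [->|/bumps_derive [g hg h]]; last by exists g => //; right.
  by exists (fun x => / c * b x) => //; right; apply: bumps_scal.
pose h k := iter k (fun f => Derive f) eta.
have hh k : P (h k).
  elim: k => [|k IH]; first by left.
  have [g hg dg] := hP _ IH.
  by rewrite /h /= (_ : Derive _ = g) //; apply: functional_extensionality => x; apply: is_derive_unique; exact: dg.
exists h; split.
- by move=> k x; have [g _ dg] := hP _ (hh k); rewrite /h /=; apply: Derive_correct; eexists; exact: dg.
- move=> x hx; rewrite /h /= /eta (_ : RInt b 0 x = 0); first by rewrite /Rdiv Rmult_0_l.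
  transitivity (RInt (fun _ => 0) 0 x); last by rewrite RInt_const; exact: Rmult_0_r.
  apply: RInt_ext => t; rewrite Rmin_right ?Rmax_left // => ht; apply: bneg; lra.
- move=> x hx; rewrite /h /= /eta.
  have := @RInt_Chasles R_CompleteNormedModule b 0 1 x (exb _ _) (exb _ _).
  rewrite (_ : RInt b 1 x = 0); last first.
    transitivity (RInt (fun _ => 0) 1 x); last by rewrite RInt_const; exact: Rmult_0_r.
    apply: RInt_ext => t; rewrite Rmin_left ?Rmax_right // => ht; apply: bone; lra.
  rewrite /plus /= Rplus_0_r -/c => <-; field; exact: Rgt_not_eq.
Qed.

Lemma exists_cutoff m (i : 'I_m) a b : a < b -> exists2 chi : vec m -> C, smooth chi &
  (forall x, x i <= a -> chi x = 0) /\ (forall x, b <= x i -> chi x = 1).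
Proof.
move=> ab; have [h [h1 h2 h3]] := exists_step.
pose l := / (b - a); have l0 : 0 < l by apply: Rinv_0_lt_compat; lra.
pose g k x := l ^ k * h k (l * (x - a)).
have hg k x : is_derive (g k) x (g k.+1 x).
  have d := h1 k (l * (x - a)).
  rewrite /g; auto_derive; first by eexists; exact: d.
  by rewrite (is_derive_unique _ _ _ d) /=; ring.
exists (fun x => RtoC (g 0%N (x i))); first exact: (smooth_coord i hg).
split=> x hx; rewrite /g /= Rmult_1_l.
  by rewrite h2 //; nra.
rewrite h3 //; have -> : 1 = l * (b - a) by rewrite /l Rinv_l //; apply: Rgt_not_eq; lra.
by apply: Rmult_le_compat_l; lra.
Qed.

Lemma testA_mult m A (chi f : vec m -> C) : smooth chi -> testA A f -> testA A (fun x => chi x * f x)%C.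
Proof.
move=> sc [sf hf]; split; first exact: smooth_mult.
by move=> x hx; rewrite hf //; ring.
Qed.

Lemma test_mult m (chi f : vec m -> C) : smooth chi -> test_fun f -> test_fun (fun x => chi x * f x)%C.
Proof. by move=> sc /test_testA [A _ hA]; apply: testA_test (testA_mult sc hA). Qed.

(* Bisection with smooth cutoffs, in place of a partition of unity. *)
Lemma dist_zero_off_support m (T : functional m) g : distribution T -> test_fun g ->
  (forall x, Defs.support g x -> ~ dist_support T x) -> T g = 0.
Proof.
move=> hT tg hs; have [A A0 hA] := test_testA tg.
(* The functions allowed on a box vanish wherever [g] does, a condition that multiplication by
   cutoffs preserves. *)
pose P (lo hi : vec m) := forall g', test_fun g' -> (forall x, g' x <> 0 -> g x <> 0) ->
  (forall x, g' x <> 0 -> forall j, lo j <= x j <= hi j) -> T g' = 0.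
have H : P (fun _ => - (A + 1)) (fun _ => A + 1); last first.
  apply: H => // x gx j; apply/Rabs_le_between.
  have : enorm x <= A by apply: Rnot_lt_le => h; apply: gx; exact: hA.2.
  by have := enorm_ge x j; lra.
apply: (@box_ind m P) => [lo hi i hlt h1 h2 g' tg' s1 s2|x|k].
- have wi := hlt i.
  (* The cutoff rises within the middle third, which belongs to both pieces. *)
  have [chi sc [c0 c1]] := @exists_cutoff m i (lo i + 1 / 3 * (hi i - lo i)) (lo i + 2 / 3 * (hi i - lo i)) ltac:(lra).
  have sc' : smooth (fun x => 1 + -(1) * chi x)%C.
    by apply: smooth_plus; [exact: smooth_const | exact: smooth_scal].
  have -> : g' = fun x => ((1 + -(1) * chi x) * g' x + chi x * g' x)%C.
    by apply: functional_extensionality => x; ring.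
  rewrite (dist_add hT (test_mult sc' tg') (test_mult sc tg')).
  have nz (a b : C) : (a * b)%C <> 0 -> a <> 0 /\ b <> 0.
    by move=> hab; split => hh; apply: hab; rewrite hh; ring.
  rewrite h1 ?h2; first by ring.
  + exact: test_mult.
  + by move=> x /nz [_ /s1].
  + move=> x /nz [hx /s2 hb] k; have := hb k; rewrite /upd; case: eqP => [->|//] hk.
    by case: (Rle_lt_dec (x i) (lo i + 1 / 3 * (hi i - lo i))) => hl; [case: hx; exact: c0 | lra].
  + exact: test_mult.
  + by move=> x /nz [_ /s1].
  + move=> x /nz [hx /s2 hb] k; have := hb k; rewrite /upd; case: eqP => [->|//] hk.
    case: (Rle_lt_dec (lo i + 2 / 3 * (hi i - lo i)) (x i)) => hl; [case: hx; rewrite c1 //; ring | lra].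
- have inbox lo hi d y : (forall k, x k - d < lo k < hi k /\ hi k < x k + d) ->
      (forall k, lo k <= y k <= hi k) -> near_vec x d y.
    by move=> h1 h2 k; apply: Rabs_def1; have := h1 k; have := h2 k; lra.
  (* Off the support of [g] small boxes carry only the zero function; on it [x] has a neighbourhood
     where [T] vanishes. *)
  case: (classic (Defs.support g x)) => hx; last first.
    have [d d0 hd] := not_support hx; exists d => // lo hi hb g' tg' s1 s2.
    have -> : g' = fun _ => RtoC 0; last exact: dist_0.
    apply: functional_extensionality => y; apply: NNPP => gy.
    by apply: (s1 y gy); apply: hd; apply: inbox hb _ => k; exact: s2.
  have /NNPP [U [oU [Ux hU]]] := hs x hx.
  have [d hd] := oU x Ux.
  exists d; first exact: cond_pos.
  move=> lo hi hb g' tg' s1 s2; apply: hU => // y hy.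
  apply: hd => k; apply: (inbox lo hi d y hb) => i.
  have out (p : R -> Prop) eps : 0 < eps -> (forall s, Rabs (s - y i) < eps -> ~ (lo i <= s <= hi i)) -> False.
    move=> e0 he; have [v [hv gv]] := hy (mkposreal _ e0).
    by apply: (he (v i)); [exact: (hv i) | exact: s2].
  split; apply: Rnot_lt_le => hlt.
    apply: (out (fun _ => True) (lo i - y i)) => [|s /Rabs_def2]; lra.
  by apply: (out (fun _ => True) (y i - hi i)) => [|s /Rabs_def2]; lra.
- by lra.
Qed.

(** * The fundamental solution *)

Lemma exp_le a b : a <= b -> exp a <= exp b.
Proof. by case=> [h|->]; [apply: Rlt_le; exact: exp_increasing | exact: Rle_refl]. Qed.

Lemma I2_ext_open T u v : (forall t s, Rmin 0 T < t < Rmax 0 T -> 0 < s < 1 -> u t s = v t s) -> I2 T u = I2 T v.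
Proof.
move=> h.
by congr (_, _); apply: RInt_ext => t ht; apply: RInt_ext => s; rewrite Rmin_left ?Rmax_right; try lra; move=> hs; rewrite h.
Qed.

Lemma I2_0 T : I2 T (fun _ _ => RtoC 0) = 0.
Proof.
apply: C_eq; rewrite /I2 /Re /Im /=;
  (transitivity (RInt (fun _ => 0) 0 T); last by rewrite RInt_const; exact: Rmult_0_r);
  by apply: RInt_ext => t _; rewrite RInt_const; exact: Rmult_0_r.
Qed.

Lemma I2_stable u T T' : cont_strip u -> (forall t s, Rmin T T' <= t <= Rmax T T' -> u t s = 0) -> I2 T u = I2 T' u.
Proof.
move=> hu h.
have H (p : C -> R) : p (RtoC 0) = 0 -> (forall t s, 0 <= s <= 1 -> continuity_2d_pt (fun t s => p (u t s)) t s) ->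
    RInt (fun t => RInt (fun s => p (u t s)) 0 1) 0 T = RInt (fun t => RInt (fun s => p (u t s)) 0 1) 0 T'.
  move=> p0 cp.
  have := @RInt_Chasles R_CompleteNormedModule _ 0 T T' (ex_RInt_outer cp 0 T) (ex_RInt_outer cp T T').
  rewrite (_ : RInt _ T T' = 0); first by rewrite /plus /= Rplus_0_r.
  transitivity (RInt (fun _ => 0) T T'); last by rewrite RInt_const; exact: Rmult_0_r.
  apply: RInt_ext => t ht; transitivity (RInt (fun _ => 0) 0 1); last by rewrite RInt_const; exact: Rmult_0_r.
  by apply: RInt_ext => s' _; rewrite h //; lra.
by congr (_, _); apply: H => // t s' hs; case: (hu t s' hs).
Qed.

Lemma time_test n A (f : vec n.+1 -> C) w : testA A f -> A < Rabs (time w) -> f w = 0.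
Proof. by move=> [_ h] hw; apply: h; apply: Rlt_le_trans hw _; exact: enorm_ge. Qed.

Lemma sign_le_abs s x : s = 1 \/ s = -1 -> s * x <= Rabs x.
Proof. by case=> ->; have := Rle_abs x; have := Rle_abs (- x); rewrite Rabs_Ropp; lra. Qed.

Lemma sign_seg s x T : s = 1 \/ s = -1 -> 0 <= s * T -> Rmin 0 T <= x <= Rmax 0 T -> 0 <= s * x <= s * T.
Proof.
case=> -> hT; [rewrite Rmin_left ?Rmax_right | rewrite Rmin_right ?Rmax_left]; lra.
Qed.

Lemma sign_between s x T T' c : s = 1 \/ s = -1 -> c < s * T -> c < s * T' -> Rmin T T' <= x <= Rmax T T' -> c < s * x.
Proof.
move=> hs h1 h2; unfold Rmin, Rmax; destruct (Rle_dec T T'); case: hs => hs; subst s; lra.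
Qed.

Section Cone.
Variables (n : nat) (Ew : R -> functional n).
Hypothesis hEw : wave_fundamental_solution Ew.
Variables (M : R) (s : R).
Hypothesis hs : s = 1 \/ s = -1.

Local Notation mx := (@ord_max n).
Local Notation kop := (Kop Ew M).
Local Notation kgt := (KGt (n:=n) M).

Let s2 : s * s = 1.
Proof. by case: hs => ->; ring. Qed.

Let gen_cont_strip f z : test_fun f -> cont_strip (gen Ew (kap M) 0 false f z).
Proof. by move=> tf; apply: (class_cont_strip hEw z (v := gen Ew (kap M) 0 false f)); apply: class_gen => //; exact: kap_cont_strip. Qed.

Let gen_0 (f : vec n.+1 -> C) z t u : (forall w, time w = time z + t -> f w = 0) -> gen Ew (kap M) 0 false f z t u = 0.
Proof.
move=> h; rewrite /gen (W_slice_zero hEw); first by rewrite !Cmult_0_r.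
by move=> w; rewrite time_upd_max; exact: h.
Qed.

(** Past the time [A] every slice of the test function is 0, so the integral between [T] and [T']
    contributes nothing. *)
Lemma Kop_stable A f z T T' : testA A f -> A + Rabs (time z) < s * T -> A + Rabs (time z) < s * T' ->
  kop T f z = kop T' f z.
Proof.
move=> hf h1 h2; apply: I2_stable; first by apply: gen_cont_strip; exact: testA_test hf.
move=> t u ht; apply: gen_0 => w hw; apply: (time_test hf); rewrite hw.
have := sign_between hs h1 h2 ht; have := sign_le_abs t hs.
have := Rabs_triang (time z + t) (- time z); rewrite Rabs_Ropp (_ : time z + t + - time z = t); [lra | ring].
Qed.

(* The value at [z] of the operator [Kop T] for [s * T] large. *)
Definition Kinf (z : vec n.+1) : functional n.+1 := fun f =>
  epsilon (inhabits (RtoC 0)) (fun c => exists T0, forall T, T0 < s * T -> kop T f z = c).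

Lemma Kinf_Kop A f z T : testA A f -> A + Rabs (time z) < s * T -> Kinf z f = kop T f z.
Proof.
move=> hf hT.
have hex : exists c, exists T0, forall T, T0 < s * T -> kop T f z = c.
  by exists (kop T f z), (A + Rabs (time z)) => T' hT'; exact: (Kop_stable hf).
have [T0 h0] := epsilon_spec (inhabits (RtoC 0)) _ hex.
pose T1 := s * (Rmax T0 (A + Rabs (time z)) + 1).
have e1 : s * T1 = Rmax T0 (A + Rabs (time z)) + 1 by rewrite /T1 -Rmult_assoc s2; ring.
have m1 := Rmax_l T0 (A + Rabs (time z)); have m2 := Rmax_r T0 (A + Rabs (time z)).
rewrite -/(Kinf z f) in h0; rewrite -(h0 T1); last lra.
by apply: (Kop_stable hf); lra.
Qed.

Lemma gen_plus f g z t u : test_fun f -> test_fun g ->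
  gen Ew (kap M) 0 false (fun x => f x + g x)%C z t u = (gen Ew (kap M) 0 false f z t u + gen Ew (kap M) 0 false g z t u)%C.
Proof. by move=> tf tg; rewrite /gen (W_add hEw (emb_st n)) //; ring. Qed.

Lemma gen_scal c f z t u : test_fun f ->
  gen Ew (kap M) 0 false (fun x => c * f x)%C z t u = (c * gen Ew (kap M) 0 false f z t u)%C.
Proof. by move=> tf; rewrite /gen (W_scal hEw (emb_st n)) //; ring. Qed.

Lemma Kop_bound A z T : exists K N, forall f B, testA A f -> pbd N B f -> Cmod (kop T f z) <= K * B.
Proof.
have [Z [Z0 hZ]] := finite_bound (fun i => Rabs (z i)).
have [Bk hBk] := cont_strip_bounded (Rabs T) (kap_cont_strip M).
pose r0 := exp (- time z) * (1 + exp (Rabs T)).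
have [K [N [K0 hK]]] := Tw_bound hEw (INR n * Rabs (A + (Z + Rabs T))) r0.
exists (2 * Rabs T * (Bk * K)), N => f B hf hB.
rewrite Rmult_assoc; apply: I2_bound; first by apply: gen_cont_strip; exact: testA_test hf.
move=> t u ht hu.
rewrite /gen /INR Ropp_0 Rmult_0_l exp_0 Cmult_1_l Cmod_mult Rmult_assoc.
apply: Rmult_le_compat; try exact: Cmod_ge_0; first exact: hBk.
apply: (hK false).
- rewrite Rabs_mult (Rabs_pos_eq (exp _)); last by apply: Rlt_le; exact: exp_pos.
  apply: Rmult_le_compat_l; first by apply: Rlt_le; exact: exp_pos.
  rewrite Rabs_mult (Rabs_pos_eq u); last lra.
  have : Rabs (phi t) <= 1 + exp (Rabs T).
    rewrite /phi; apply: Rle_trans (Rabs_triang _ _) _.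
    rewrite Rabs_R1 Rabs_Ropp (Rabs_pos_eq (exp _)); last by apply: Rlt_le; exact: exp_pos.
    apply: Rplus_le_compat_l; apply: exp_le.
    by apply: Rle_trans ht; rewrite -Rabs_Ropp; exact: Rle_abs.
  by have := Rabs_pos (phi t); nra.
- apply: (testA_slice (emb_st n)) => // k; rewrite /upd; case: eqP => _; last by have := hZ k; have := Rabs_pos T; lra.
  by apply: Rle_trans (Rabs_triang _ _) _; have := hZ mx; rewrite -/(time z); lra.
- by apply: (pbd_slice (emb_st n)) => //; case: hf.
Qed.

Let big c : exists T, c < s * T.
Proof. by exists (s * (c + 1)); rewrite -Rmult_assoc s2; lra. Qed.

Lemma Kinf_dist z : distribution (Kinf z).
Proof.
split; [|split].
- move=> f g tf tg; have [A A0 hA] := test_testA tf; have [B B0 hB] := test_testA tg.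
  have hA' := testA_le (Rmax_l A B) hA; have hB' := testA_le (Rmax_r A B) hB.
  have [T hT] := big (Rmax A B + Rabs (time z)).
  rewrite (Kinf_Kop hA' hT) (Kinf_Kop hB' hT) (Kinf_Kop (testA_plus hA' hB') hT).
  rewrite /Kop -I2_plus; try exact: gen_cont_strip.
  by apply: I2_ext => t u _ _; exact: gen_plus.
- move=> c f tf; have [A A0 hA] := test_testA tf; have [T hT] := big (A + Rabs (time z)).
  rewrite (Kinf_Kop hA hT) (Kinf_Kop (testA_scal c hA) hT).
  rewrite /Kop -I2_scal; last exact: gen_cont_strip.
  by apply: I2_ext => t u _ _; exact: gen_scal.
- move=> A; have [T hT] := big (A + Rabs (time z)).
  have [K [N h]] := Kop_bound A z T; exists K, N => f [sf _] /supp_ballE hf B hB.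
  by rewrite (Kinf_Kop (conj sf hf) hT); apply: h.
Qed.

Lemma testA_exp_time A f : testA A f -> testA A (fun z : vec n.+1 => RtoC (exp (- 2 * time z)) * f z)%C.
Proof.
apply: testA_mult; pose h k x := (- 2) ^ k * exp (- 2 * x).
have -> : (fun z : vec n.+1 => RtoC (exp (- 2 * time z))) = fun z => RtoC (h 0%N (z mx)).
  by apply: functional_extensionality => z; rewrite /h /= Rmult_1_l.
by apply: smooth_coord => k x; rewrite /h; auto_derive => //=; ring.
Qed.

Let KGt_split f : kgt f = fun z => (pd mx (pd mx f) z + (-(1) * \big[Cplus/RtoC 0]_(i < n)
    pd (lift mx i) (pd (lift mx i) (fun z => RtoC (exp (- 2 * time z)) * f z)) z + RtoC (M ^ 2) * f z))%C.
Proof. by apply: functional_extensionality => z; rewrite /KGt /sumC; ring. Qed.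

Let tF A f i : testA A f ->
  testA A (pd (lift mx i) (pd (lift mx i) (fun z => RtoC (exp (- 2 * time z)) * f z)%C)).
Proof. by move=> hf; apply: (testA_pds [:: lift mx i; lift mx i]); exact: testA_exp_time. Qed.

Lemma testA_KGt A f : testA A f -> testA A (kgt f).
Proof.
move=> hf; rewrite KGt_split; apply: testA_plus; first exact: (testA_pds [:: mx; mx] hf).
apply: testA_plus; apply: testA_scal => //; apply: testA_sum => i; exact: tF.
Qed.

(** The signs of the two distributional derivatives cancel; the coefficient multiplies the test
    function before it is differentiated, which is the order in [KGt]. *)
Lemma KG_op_KGt E f : distribution E -> test_fun f -> KG_op M E f = E (kgt f).
Proof.
move=> hE /test_testA [A _ hf].
have t1 := testA_pds [:: mx; mx] hf.
have t2 := testA_sum (index_enum 'I_n) (fun i => tF i hf).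
rewrite KGt_split (dist_add hE (testA_test t1) (testA_test (testA_plus (testA_scal _ t2) (testA_scal _ hf)))).
rewrite (dist_add hE (testA_test (testA_scal _ t2)) (testA_test (testA_scal _ hf))).
rewrite (dist_scal _ hE (testA_test t2)) (dist_scal _ hE (testA_test hf)).
rewrite (dist_sum (index_enum 'I_n) hE (fun i => tF i hf)).
rewrite /KG_op /dist_mul /dist_laplacian_x /dist_diff.
have -> : \big[Cplus/RtoC 0]_(i < n) (- - E (pd (lift mx i) (pd (lift mx i) (fun z => RtoC (exp (- 2 * time z)) * f z))))%C =
  \big[Cplus/RtoC 0]_(i < n) E (pd (lift mx i) (pd (lift mx i) (fun z => RtoC (exp (- 2 * time z)) * f z)%C)).
  by apply: eq_bigr => i _; ring.
rewrite -[pds _ f]/(pd mx (pd mx f)); set S := bigop _ _ _; ring.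
Qed.

Lemma Kinf_fundamental z : dist_eq (KG_op M (Kinf z)) (dirac z).
Proof.
move=> f tf; have [A A0 hA] := test_testA tf; have [T hT] := big (A + Rabs (time z)).
rewrite (KG_op_KGt (Kinf_dist z) tf) (Kinf_Kop (testA_KGt hA) hT) /dirac.
have out (g : vec n.+1 -> C) w : testA A g -> time w = time z + T -> g w = 0.
  move=> hg hw; apply: (time_test hg); rewrite hw.
  have := sign_le_abs T hs; have := Rabs_triang (time z + T) (- time z).
  by rewrite Rabs_Ropp (_ : time z + T + - time z = T); [lra | ring].
apply: (Kop_KGt hEw) => // w hw; first exact: out hA hw.
exact: out (testA_pds [:: mx] hA) hw.
Qed.

(* [s = 1] is the forward cone and [s = -1] the backward one. *)
Definition cone (x0 : vec n) (t0 : R) (z : vec n.+1) : Prop :=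
  enorm (fun i => space z i - x0 i) <= s * (exp (- t0) - exp (- time z)).

(** At time [t0 + t] the cone contains the ball of radius [rad] about [x0], where [f] is 0, while
    the wave family is taken at radius [u * rad] in absolute value. Finite propagation needs
    [u < 1], hence the comparison of integrands over the open rectangle. *)
Lemma Kinf_vanish x0 t0 f : test_fun f -> (forall w, cone x0 t0 w -> f w = 0) -> Kinf (st x0 t0) f = 0.
Proof.
move=> tf h; have [A A0 hA] := test_testA tf; have [T hT] := big (A + Rabs (time (st x0 t0))).
have T0 : 0 <= s * T by have := Rabs_pos (time (st x0 t0)); lra.
rewrite (Kinf_Kop hA hT) /Kop -(I2_0 T); apply: I2_ext_open => t u ht hu.
have tE : time (st x0 t0) = t0 by rewrite /time st_max.
have st0 : 0 < s * t.
  move: ht; case: hs T0 => -> T0; [rewrite Rmin_left ?Rmax_right | rewrite Rmin_right ?Rmax_left]; lra.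
pose rad := s * (exp (- t0) * phi t).
have radE : rad = s * (exp (- t0) - exp (- (t0 + t))).
  by rewrite /rad /phi Ropp_plus_distr exp_plus; ring.
have rad0 : 0 < rad.
  rewrite radE; case: hs st0 => -> st0.
    by have := exp_increasing (- (t0 + t)) (- t0); lra.
  by have := exp_increasing (- t0) (- (t0 + t)); lra.
rewrite /gen (@finite_propagation n Ew hEw _ _ _ (emb_st n) _ rad) //; first by rewrite !Cmult_0_r.
  move=> y hy; apply: h; rewrite /cone.
  have -> : time (fun k => upd (st x0 t0) mx (time (st x0 t0) + t) k + st y 0 k) = t0 + t.
    by rewrite /time upd_same !st_max; ring.
  rewrite -radE (_ : (fun i => _) = y); first exact: Rlt_le.
  apply: functional_extensionality => i; rewrite /space upd_neq; last by rewrite eq_sym neq_lift.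
  by rewrite !st_lift; ring.
rewrite tE; have -> : exp (- t0) * (u * phi t) = u * (s * rad).
  by rewrite /rad; transitivity (s * s * (exp (- t0) * (u * phi t))); [rewrite s2 | ]; ring.
clearbody rad; rewrite !Rabs_mult (Rabs_pos_eq u) ?(Rabs_pos_eq rad); try lra.
have -> : Rabs s = 1 by case: hs => ->; [exact: Rabs_R1 | rewrite Rabs_Ropp; exact: Rabs_R1].
nra.
Qed.

Lemma cone_closed x0 t0 z : ~ cone x0 t0 z -> exists2 d, 0 < d & forall w, near_vec z d w -> ~ cone x0 t0 w.
Proof.
move=> /Rnot_le_lt hz.
pose g u := s * (exp (- t0) - exp (- u)).
pose c := (g (time z) + enorm (fun i => space z i - x0 i)) / 2.
have c1 : g (time z) < c by rewrite /c /g; lra.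
have cont_strip : c < enorm (fun i => space z i - x0 i) by rewrite /c /g; lra.
have [d d0 hd] := enorm_gt_open cont_strip.
have cg : continuity_pt g (time z).
  by apply/continuity_pt_filterlim; apply: (@ex_derive_continuous R_AbsRing R_NormedModule); rewrite /g; auto_derive.
have [d' [d0' hd']] := cg (c - g (time z)) ltac:(lra).
exists (Rmin d d'); first exact: Rmin_pos.
move=> w hw; rewrite /cone; apply: Rlt_not_le.
have h1 : c < enorm (fun i => space w i - x0 i).
  apply: hd => i; have -> : space w i - x0 i - (space z i - x0 i) = space w i - space z i by ring.
  exact: Rlt_le_trans (hw _) (Rmin_l _ _).
apply: Rlt_trans h1; rewrite -/(g (time w)).
case: (Req_dec (time w) (time z)) => [->//|neq].
have : Rabs (g (time w) - g (time z)) < c - g (time z).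
  apply: (hd' (time w)); split; first by split => //; apply: not_eq_sym.
  exact: Rlt_le_trans (hw _) (Rmin_r _ _).
by move=> /Rabs_def2; lra.
Qed.

Lemma Kinf_support x0 t0 z : dist_support (Kinf (st x0 t0)) z -> cone x0 t0 z.
Proof.
move=> h; apply: NNPP => hz; apply: h; exists (fun w => ~ cone x0 t0 w); split; [|split] => //.
  move=> w /cone_closed [d d0 hd]; exists (mkposreal _ d0) => y hy; apply: hd => i; exact: (hy i).
move=> f tf hf; apply: Kinf_vanish => // w hw; apply: NNPP => fw.
by apply: (hf w) => // eps; exists w; split => //; exact: ball_center.
Qed.

Lemma Kinf_is_fundamental x0 t0 : fundamental_solution M x0 t0 (cone x0 t0) (Kinf (st x0 t0)).
Proof.
split; [exact: Kinf_dist | split; [exact: Kinf_fundamental | exact: Kinf_support]].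
Qed.

End Cone.

(** * Uniqueness *)

Lemma box_cutoff m (c : vec m) L : exists2 chi : vec m -> C, smooth chi &
  (forall x, (forall k, Rabs (x k - c k) <= L) -> chi x = 1) /\
  (forall x k, L + 1 <= Rabs (x k - c k) -> chi x = 0).
Proof.
have H (l : seq 'I_m) : exists2 chi : vec m -> C, smooth chi &
    (forall x, (forall k, Rabs (x k - c k) <= L) -> chi x = 1) /\
    (forall x k, k \in l -> L + 1 <= Rabs (x k - c k) -> chi x = 0).
  elim: l => [|i l [chi sc [c1 c0]]]; first by exists (fun _ => RtoC 1); first exact: smooth_const.
  have [a sa [a0 a1]] := @exists_cutoff m i (c i - L - 1) (c i - L) ltac:(lra).
  have [b sb [b0 b1]] := @exists_cutoff m i (c i + L) (c i + L + 1) ltac:(lra).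
  exists (fun x => chi x * (a x * (1 + -(1) * b x)))%C.
    apply: smooth_mult => //; apply: smooth_mult => //; apply: smooth_plus; first exact: smooth_const.
    exact: smooth_scal.
  split=> [x hx|x k].
    have /Rabs_le_between hi := hx i.
    by rewrite c1 // a1 ?b0; [ring | lra | lra].
  rewrite inE => /orP [/eqP ->|hk] hx; last by rewrite (c0 x k) //; ring.
  case: (Rle_lt_dec (x i) (c i)) => hi.
    rewrite a0; first by ring.
    by move: hx; rewrite Rabs_left1; lra.
  rewrite b1; first by ring.
  by move: hx; rewrite Rabs_pos_eq; lra.
have [chi sc [c1 c0]] := H (enum 'I_m); exists chi => //; split => // x k; apply: c0; exact: mem_enum.
Qed.

Section Uniqueness.
Variables (n : nat) (Ew : R -> functional n).
Hypothesis hEw : wave_fundamental_solution Ew.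
Variables (M : R) (s : R).
Hypothesis hs : s = 1 \/ s = -1.

Local Notation mx := (@ord_max n).
Local Notation kop := (Kop Ew M).
Local Notation kgt := (KGt (n:=n) M).

Lemma KGt_near f g x d : 0 < d -> (forall y, near_vec x d y -> f y = g y) -> kgt f x = kgt g x.
Proof.
move=> d0 h; rewrite /KGt.
rewrite -![pd mx (pd mx _) x]/(pds [:: mx; mx] _ x) (pds_near _ d0 h) (h x (near_vec_refl _ d0)).
congr (_ - _ + _)%C; apply: eq_bigr => i _.
rewrite -![pd _ (pd _ _) x]/(pds [:: lift ord_max i; lift ord_max i] _ x).
by apply: (pds_near _ d0) => y hy; rewrite h.
Qed.

Lemma KGt_0 : kgt (fun _ => RtoC 0) = fun _ => RtoC 0.
Proof.
apply: functional_extensionality => x; rewrite /KGt -[pd mx (pd mx _)]/(pds [:: mx; mx] _) pds_0.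
have -> : (fun z : vec n.+1 => RtoC (exp (-2 * time z)) * RtoC 0)%C = fun _ => RtoC 0.
  by apply: functional_extensionality => z; rewrite Cmult_0_r.
have -> : sumC (fun i : 'I_n => pd (lift ord_max i) (pd (lift ord_max i) (fun _ : vec n.+1 => RtoC 0)) x) = RtoC 0.
  rewrite /sumC; elim: (index_enum 'I_n) => [|i l IH]; first by rewrite big_nil.
  rewrite big_cons IH -[pd _ (pd _ _)]/(pds [:: lift ord_max i; lift ord_max i] _) pds_0; ring.
by ring.
Qed.

(** From an apex beyond time [A] the integral only looks further away, where [f] is 0. *)
Lemma Kop_beyond A f w T : testA A f -> 0 <= s * T -> A < s * time w -> kop T f w = 0.
Proof.
move=> hf hT hw; rewrite /Kop -(I2_0 T); apply: I2_ext_open => t u ht hu.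
rewrite /gen (W_slice_zero hEw); first by rewrite !Cmult_0_r.
move=> v; rewrite time_upd_max => hv; apply: (time_test hf); rewrite hv.
apply: Rlt_le_trans (sign_le_abs _ hs); rewrite Rmult_plus_distr_l.
have := sign_seg hs hT (conj (Rlt_le _ _ ht.1) (Rlt_le _ _ ht.2)); lra.
Qed.

(** The forward cone has radius below [exp (- t0)] at all times. The backward cone widens without
    bound, but where [- time x <= A] its radius is below [exp A]. *)
Lemma cone_bounded (x0 : vec n) t0 A (x : vec n.+1) : 0 <= A -> cone s x0 t0 x -> s * time x <= A ->
  forall k, Rabs (x k - st x0 t0 k) <= exp (- t0) + exp A + A + Rabs t0.
Proof.
move=> A0 hc hx k.
have e1 := exp_pos (- t0); have e2 := exp_pos A; have e3 := exp_pos (- time x).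
have t1 := Rle_abs t0; have t2 := Rle_abs (- t0); rewrite Rabs_Ropp in t2.
have hge : 0 <= s * (exp (- t0) - exp (- time x)) by apply: Rle_trans hc; exact: enorm_ge0.
case: (unliftP ord_max k) => [i ->|->].
  rewrite st_lift; apply: Rle_trans (enorm_ge (fun i => space x i - x0 i) i) _.
  apply: Rle_trans hc _; have := Rabs_pos t0.
  case: hs hx => ->; first by lra.
  move=> hx; have : exp (- time x) <= exp A by apply: exp_le; lra.
  by lra.
rewrite st_max -/(time x).
have expI a b : exp a <= exp b -> a <= b by move=> h; apply: Rnot_lt_le => /exp_increasing; lra.
apply: Rabs_le; case: hs hx hge => -> hx hge.
  by have := @expI (- time x) (- t0) ltac:(lra); lra.
by have := @expI (- t0) (- time x) ltac:(lra); lra.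
Qed.

(* Both sides equal [psi (st x0 t0)] for a test function [psi] equal to
   [kop T f] on the part of the cone where that function does not vanish. *)
Lemma fundamental_unique (x0 : vec n) t0 E1 E2 : fundamental_solution M x0 t0 (cone s x0 t0) E1 ->
  fundamental_solution M x0 t0 (cone s x0 t0) E2 -> dist_eq E1 E2.
Proof.
move=> h1 h2 f tf; have [A A0 hA] := test_testA tf.
(* The bound of [cone_bounded] with margin 1, so that a unit neighbourhood of the truncated cone
   stays in the box. *)
pose L := exp (- t0) + exp A + A + Rabs t0 + 1.
pose z0 := st x0 t0.
have L0 : 0 < L by have := exp_pos (- t0); have := exp_pos A; have := Rabs_pos t0; rewrite /L; lra.
(* Large enough for every apex whose time is within [L] of [t0], so that [KGt_Kop] holds throughout
   the box. *)
pose T := s * (A + Rabs t0 + L + 1).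
have sT : s * T = A + Rabs t0 + L + 1 by rewrite /T -Rmult_assoc; case: hs => ->; ring.
have sT0 : 0 <= s * T by rewrite sT; have := Rabs_pos t0; lra.
have sf : smooth (kop T f) := Kop_smooth hEw M T tf.
have [chi sc [c1 c0]] := box_cutoff z0 L.
pose psi := fun x => (chi x * kop T f x)%C.
have [Z [Z0 hZ]] := finite_bound (fun i => Rabs (z0 i)).
have tpsi : testA (INR n.+1 * Rabs (Z + L + 1)) psi.
  split; first exact: smooth_mult.
  move=> x hx; apply: NNPP => hp; apply: (Rlt_not_le _ _ hx); apply: enorm_le => k.
  have : Rabs (x k - z0 k) < L + 1.
    by apply: Rnot_le_lt => h; apply: hp; rewrite /psi (c0 x k) //; ring.
  have := Rabs_triang (x k - z0 k) (z0 k); rewrite (_ : x k - z0 k + z0 k = x k); last by ring.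
  by have := hZ k; lra.
have in_box y : (forall k, Rabs (y k - z0 k) <= L) -> kgt (kop T f) y = f y.
  move=> hy; have /(_ mx) := hy; rewrite /z0 st_max -/(time y) => ht.
  have out (g : vec n.+1 -> C) w : testA A g -> time w = time y + T -> g w = 0.
    move=> hg hw; apply: (time_test hg); rewrite hw.
    have := sign_le_abs T hs; have := Rabs_triang (time y + T) (- (time y - t0) - t0).
    have := Rabs_triang (- (time y - t0)) (- t0).
    rewrite !Rabs_Ropp (_ : time y + T + (- (time y - t0) - t0) = T); last by ring.
    by rewrite -/(Rminus (- (time y - t0)) t0); lra.
  apply: (KGt_Kop hEw) => // w hw; first exact: out hA hw.
  exact: out (testA_pds [:: mx] hA) hw.
pose g := fun x => (f x + -(1) * kgt psi x)%C.
have tkp := testA_KGt M tpsi.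
have tg : test_fun g.
  have h := testA_plus (testA_le (Rmax_l _ _) hA) (testA_le (Rmax_r A _) (testA_scal (-(1)) tkp)).
  exact: testA_test h.
(* Where [s * time x <= A], a neighbourhood of [x] lies in the box, [psi] is locally [kop T f], and
   [KGt] returns [f]. Beyond [A] both [f] and [kop T f] are 0. *)
have g0 x : cone s x0 t0 x -> exists2 d, 0 < d & forall y, near_vec x d y -> g y = 0.
  move=> hx; case: (Rle_lt_dec (s * time x) A) => hA1.
    exists 1; first lra; move=> y hy.
    have hb k : Rabs (x k - z0 k) <= L - 1.
      by have := cone_bounded A0 hx hA1 k; rewrite /L /z0; lra.
    have hyL k : Rabs (y k - z0 k) < L.
      have := Rabs_triang (y k - x k) (x k - z0 k); rewrite (_ : y k - x k + (x k - z0 k) = y k - z0 k); last by ring.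
      by have := hy k; have := hb k; lra.
    have [d [d0 hd]] : exists d, 0 < d /\ forall k, Rabs (y k - z0 k) + d <= L.
      have [w [w0 hw]] := finite_bound (fun k => / (L - Rabs (y k - z0 k))).
      exists (/ w); split; first exact: Rinv_0_lt_compat.
      move=> k; have hk := hyL k; have := Rinv_le_contravar _ _ (Rinv_0_lt_compat _ (Rlt_Rminus _ _ hk)) (hw k).
      by rewrite Rinv_inv; lra.
    rewrite /g (@KGt_near psi (kop T f) y d d0) ?in_box; first by ring.
    + by move=> k; apply: Rlt_le.
    + move=> v hv; rewrite /psi c1; first by ring.
      move=> k; have := Rabs_triang (v k - y k) (y k - z0 k); rewrite (_ : v k - y k + (y k - z0 k) = v k - z0 k); last by ring.
      by have := hv k; have := hd k; lra.
  pose d := (s * time x - A) / 2; have d0 : 0 < d by rewrite /d; lra.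
  have hbig v : near_vec x (2 * d) v -> A < s * time v.
    move=> /(_ mx) /Rabs_def2; rewrite -/(time v) -/(time x) /d; case: hs => ->; lra.
  exists d => // y hy.
  have hy2 : near_vec x (2 * d) y by move=> k; have := hy k; lra.
  rewrite /g (time_test hA); last by apply: Rlt_le_trans (hbig _ hy2) (sign_le_abs _ hs).
  rewrite (@KGt_near psi (fun _ => RtoC 0) y d d0) => [|v hv].
    by rewrite /g KGt_0; ring.
  rewrite /psi (Kop_beyond hA sT0) ?Cmult_0_r //; apply: hbig => k.
  have := Rabs_triang (v k - y k) (y k - x k); rewrite (_ : v k - y k + (y k - x k) = v k - x k); last by ring.
  by have := hv k; have := hy k; lra.
have H E : fundamental_solution M x0 t0 (cone s x0 t0) E -> E f = psi z0.
  move=> [dE [fE sE]].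
  have -> : f = fun x => (g x + kgt psi x)%C.
    by apply: functional_extensionality => x; rewrite /g; ring.
  rewrite (dist_add dE tg (testA_test tkp)) -(KG_op_KGt M dE (testA_test tpsi)) fE; last exact: testA_test tpsi.
  rewrite (dist_zero_off_support dE tg); first by rewrite Cplus_0_l.
  move=> x hsx hdx; have [d d0 hd] := g0 x (sE x hdx); exact: support_zero d0 hd hsx.
by rewrite (H E1) // (H E2).
Qed.
End Uniqueness.

(** * The fundamental solution as a family of distributions in space *)

Local Notation CR := (prod_NormedModule R_AbsRing R_NormedModule R_NormedModule).

Lemma I2_1 (v : R -> C) : I2 1 (fun _ => v) = I1 v.
Proof. by rewrite /I2 /I1 !RInt_const; congr (_, _); rewrite /scal /= /mult /= Rminus_0_r Rmult_1_l. Qed.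

Lemma is_RInt_I1 (v : R -> R -> C) t : cont_strip v -> @is_RInt CR (v t) 0 1 (I1 (v t)).
Proof.
move=> hv; apply: (is_RInt_fct_extend_pair (v t)); apply: RInt_correct.
  by apply: (ex_RInt_inner (u := fun t u => Re (v t u))) => x y hy; case: (hv x y hy).
by apply: (ex_RInt_inner (u := fun t u => Im (v t u))) => x y hy; case: (hv x y hy).
Qed.

Lemma is_RInt_I2 (v : R -> R -> C) t0 T : cont_strip v -> @is_RInt CR (fun t => I1 (v (t - t0))) t0 (t0 + T) (I2 T v).
Proof.
move=> hv.
have h : @is_RInt CR (fun t => I1 (v t)) (1 * t0 + - t0) (1 * (t0 + T) + - t0) (I2 T v).
  have -> : 1 * t0 + - t0 = 0 by ring.
  have -> : 1 * (t0 + T) + - t0 = T by ring.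
  apply: (is_RInt_fct_extend_pair (fun t => I1 (v t))); apply: RInt_correct.
    by apply: (ex_RInt_outer (u := fun t u => Re (v t u))) => x y hy; case: (hv x y hy).
  by apply: (ex_RInt_outer (u := fun t u => Im (v t u))) => x y hy; case: (hv x y hy).
apply: is_RInt_ext (is_RInt_comp_lin _ _ _ _ _ _ h) => t _.
by rewrite (_ : 1 * t + - t0 = t - t0); [exact: (@scal_one R_AbsRing CR) | ring].
Qed.

Section Family.
Variables (n : nat) (Ew : R -> functional n).
Hypothesis hEw : wave_fundamental_solution Ew.
Variables (M : R) (s : R).
Hypothesis hs : s = 1 \/ s = -1.
Variables (x0 : vec n) (t0 : R).

Local Notation mx := (@ord_max n).

(** The counterpart of [gen] at a frozen time: the wave family acts on a function of [x] alone, with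
    the identity as embedding. *)
Definition ufun (t : R) (f : vec n -> C) (u : R) : C :=
  (kap M (t - t0) u * W Ew (fun y => y) false f x0 (exp (- t0) * (u * phi (t - t0))))%C.

(** The factor [s] corrects the orientation: for the backward cone the integral in [Kop] runs from
    [t0] down to [t0 + T]. *)
Definition Ufam (t : R) : functional n := fun f =>
  if Rlt_dec 0 (s * (t - t0)) then (RtoC s * I1 (ufun t f))%C else RtoC 0.

Let ufun_cont_strip t f : test_fun f -> cont_strip (fun _ => ufun t f).
Proof.
move=> tf; apply: (@cont_strip_mult (fun _ u => kap M (t - t0) u)).
  move=> x u hu; have [h1 h2] := kap_cont_strip M (t - t0) hu.
  have H (g : R -> R -> R) : continuity_2d_pt g (t - t0) u -> continuity_2d_pt (fun _ u => g (t - t0) u) x u.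
    move=> h eps; have [d hd] := h eps; exists d => y v hy hv; apply: hd => //.
    by rewrite Rminus_diag Rabs_R0; exact: cond_pos.
  by split; [exact: (H (fun t u => Re (kap M t u))) | exact: (H (fun t u => Im (kap M t u)))].
move=> x u hu.
have cr : continuity_2d_pt (fun _ u => exp (- t0) * (u * phi (t - t0))) x u.
  apply: continuity_2d_pt_mult; first exact: continuity_2d_pt_const.
  by apply: continuity_2d_pt_mult; [exact: continuity_2d_pt_id2 | exact: continuity_2d_pt_const].
have [h1 h2] := W_isD_r hEw (emb_id n) false x0 (exp (- t0) * (u * phi (t - t0))) tf.
split; [apply: (continuity_1d_2d_pt_comp (fun r => Re (W Ew (fun y => y) false f x0 r))) |
        apply: (continuity_1d_2d_pt_comp (fun r => Im (W Ew (fun y => y) false f x0 r)))];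
  try exact: cr; apply/continuity_pt_filterlim; apply: (@ex_derive_continuous R_AbsRing R_NormedModule); eexists;
  [exact: h1 | exact: h2].
Qed.

Lemma Ufam_dist t : distribution (Ufam t).
Proof.
rewrite /Ufam; case: (Rlt_dec 0 (s * (t - t0))) => h /=; last first.
  split; [|split].
  - by move=> f g _ _; ring.
  - by move=> a f _; ring.
  - move=> A; exists 0, 0%N => f _ _ B _; rewrite Cmod_0; lra.
split; [|split].
- move=> f g tf tg; rewrite -!I2_1 -Cmult_plus_distr_l -I2_plus; try exact: ufun_cont_strip.
  congr (_ * _)%C; apply: I2_ext => x u _ _.
  by rewrite /ufun (W_add hEw (emb_id n)) //; ring.
- move=> a f tf; rewrite -!I2_1.
  have -> : (a * (RtoC s * I2 1 (fun _ => ufun t f)) = RtoC s * (a * I2 1 (fun _ => ufun t f)))%C by ring.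
  rewrite -(I2_scal _ a); last exact: ufun_cont_strip.
  congr (_ * _)%C; apply: I2_ext => x u _ _.
  by rewrite /ufun (W_scal hEw (emb_id n)) //; ring.
- move=> A; have [Z [Z0 hZ]] := finite_bound (fun i => Rabs (x0 i)).
  have [Bk hBk] := cont_strip_bounded (Rabs (t - t0)) (kap_cont_strip M).
  pose r0 := exp (- t0) * Rabs (phi (t - t0)).
  have [K [N [K0 hK]]] := Tw_bound hEw (INR n * Rabs (A + Z)) r0.
  exists (2 * (Bk * K)), N => f tf /supp_ballE hf B hB.
  have sf : smooth f by case: tf.
  rewrite Cmod_mult Cmod_R; have -> : Rabs s = 1 by case: hs => ->; [exact: Rabs_R1 | rewrite Rabs_Ropp; exact: Rabs_R1].
  rewrite Rmult_1_l -I2_1.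
  have -> : 2 * (Bk * K) * B = 2 * Rabs 1 * (Bk * (K * B)) by rewrite Rabs_R1; ring.
  apply: I2_bound; first exact: ufun_cont_strip.
  move=> x u _ hu; rewrite /ufun Cmod_mult; apply: Rmult_le_compat; try exact: Cmod_ge_0.
    by apply: hBk => //; exact: Rle_refl.
  apply: (hK false); last by apply: (pbd_slice (emb_id n)).
    rewrite /r0 !Rabs_mult (Rabs_pos_eq (exp _)) ?(Rabs_pos_eq u); try lra.
      apply: Rmult_le_compat_l; first by apply: Rlt_le; exact: exp_pos.
      by have := Rabs_pos (phi (t - t0)); nra.
    by apply: Rlt_le; exact: exp_pos.
  by apply: (testA_slice (emb_id n)).
Qed.

Lemma Ufam_0 t : s * (t - t0) <= 0 -> dist_eq (Ufam t) (fun _ => RtoC 0).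
Proof. by move=> h f _; rewrite /Ufam; case: (Rlt_dec 0 (s * (t - t0))) => // h'; lra. Qed.

Let c t := exp (- t0) - exp (- t).

Let cE t : exp (- t0) * phi (t - t0) = c t.
Proof.
rewrite /c /phi Rmult_minus_distr_l -exp_plus Rmult_1_r; congr (_ - exp _); ring.
Qed.

(** The substitution [r = c t * u], where [c t] is negative in the backward case. The Jacobian
    [c t = e^(-t0) * phi (t - t0)] and the factor [2 * (1/2) * e^((t0 + t)/2)] of the kernel combine
    to the prefactor of [kap]. *)
Lemma is_RInt_integrand t f : 0 < s * (t - t0) -> test_fun f ->
  @is_RInt CR (fun r => integrand M Ew x0 t t0 r f) 0 (c t) (I1 (ufun t f)).
Proof.
move=> ht tf.
have c0 : c t <> 0.
  move=> h; have e0 : exp (- t0) = exp (- t) by move: h; rewrite /c; lra.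
  by have := exp_inv _ _ e0; case: hs ht => ->; lra.
have h : @is_RInt CR (ufun t f) (/ c t * 0 + 0) (/ c t * c t + 0) (I1 (ufun t f)).
  have -> : / c t * 0 + 0 = 0 by ring.
  have -> : / c t * c t + 0 = 1 by field.
  by have h0 := @is_RInt_I1 (fun _ => ufun t f) 0 (ufun_cont_strip t tf).
apply: is_RInt_ext (is_RInt_comp_lin _ _ _ _ _ _ h) => r hr.
set u := / c t * r + 0.
have ru : r = c t * u by rewrite /u; field.
have hu : 0 < u < 1.
  move: hr; rewrite /u; unfold Rmin, Rmax; destruct (Rle_dec 0 (c t)) => hr.
    have cp : 0 < c t by lra.
    have i0 := Rinv_0_lt_compat _ cp; have i1 : / c t * c t = 1 by field.
    by nra.
  have cp : c t < 0 by lra.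
  have i0 := Rinv_lt_0_compat _ cp; have i1 : / c t * c t = 1 by field.
  by nra.
have Y : ((exp (- t0) - exp (- t)) ^ 2 - r ^ 2) / (4 * exp (- t0 - t)) = yc (t - t0) u.
  rewrite -/(c t) {1}ru /yc -(cE t).
  have -> : exp (- t0 - t) = exp (- t0) * exp (- t0) * / exp (t - t0).
    by rewrite -exp_Ropp -!exp_plus; congr exp; ring.
  have := exp_pos (- t0); have := exp_pos (t - t0) => p1 p2.
  by field; split; apply: Rgt_not_eq.
have hY : -1 < ((exp (- t0) - exp (- t)) ^ 2 - r ^ 2) / (4 * exp (- t0 - t)).
  by rewrite Y; have := @yc_ge0 (t - t0) u ltac:(lra); lra.
rewrite /integrand (Gkernel_Hf M hY) Y /ufun /kap.
have -> : exp (- t0) * (u * phi (t - t0)) = r by rewrite ru -cE; ring.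
rewrite /W /Tw -[dist_translate x0 (Ew r) f]/(Ew r (fun x => f (fun i => x i + x0 i))).
have -> : slice (fun y => y) f x0 = fun x => f (fun i => x i + x0 i).
  apply: functional_extensionality => x; congr f; apply: functional_extensionality => i; exact: Rplus_comm.
have k1 : / c t * (phi (t - t0) * exp ((t - t0) / 2)) = exp ((t0 + t) / 2).
  have e1 : exp ((t0 + t) / 2) = exp t0 * exp ((t - t0) / 2) by rewrite -exp_plus; congr exp; field.
  rewrite e1 -(cE t); have e2 : exp (- t0) = / exp t0 by exact: exp_Ropp.
  have p1 := exp_pos t0; rewrite e2; field; split; first by apply: Rgt_not_eq.
  by move=> h0; apply: c0; rewrite -cE h0; ring.
set X := Ew r _; set H := Hf _ _.
have half : (RtoC 2 * (X * (RtoC (1 / 2 * exp ((t0 + t) / 2)) * H)) = RtoC (exp ((t0 + t) / 2)) * (H * X))%C.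
  by apply: C_eq; rewrite /Re /Im /=; field.
rewrite half -k1.
by apply: C_eq; rewrite /scal /= /prod_scal /= /scal /= /mult /= /Re /Im /=; ring.
Qed.
Lemma Ufam_slice t f : 0 < s * (t - t0) ->
  Ufam t (fun x => f (st x t)) = (RtoC s * I1 (gen Ew (kap M) 0 false f (st x0 t0) (t - t0)))%C.
Proof.
move=> ht; rewrite /Ufam; case: (Rlt_dec 0 (s * (t - t0))) => // h /=.
congr (_ * I1 _)%C; apply: functional_extensionality => u.
have tE : time (st x0 t0) = t0 by rewrite /time st_max.
rewrite /ufun /gen tE /INR Ropp_0 Rmult_0_l exp_0 Cmult_1_l /W; congr (_ * Tw _ _ _ _)%C.
apply: functional_extensionality => y; rewrite /slice; congr f; apply: functional_extensionality => k.
case: (unliftP ord_max k) => [i ->|->]; first by rewrite upd_neq ?st_lift // eq_sym neq_lift.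
by rewrite upd_same !st_max; ring.
Qed.

Lemma Ufam_RInt f T : test_fun f -> 0 <= s * T ->
  @is_RInt CR (fun t => Ufam t (fun x => f (st x t))) (Rmin t0 (t0 + T)) (Rmax t0 (t0 + T)) (Kop Ew M T f (st x0 t0)).
Proof.
move=> tf hT.
have h : @is_RInt CR _ t0 (t0 + T) (Kop Ew M T f (st x0 t0)) :=
  @is_RInt_I2 _ t0 T (class_cont_strip hEw (st x0 t0) (class_gen Ew 0 false (@kap_cont_strip M) tf)).
case: (hs) => e; have {}hT := hT; rewrite e in hT.
  rewrite Rmin_left ?Rmax_right; try lra.
  apply: is_RInt_ext h; rewrite Rmin_left ?Rmax_right; try lra.
  move=> t ht; rewrite Ufam_slice; last by rewrite e; lra.
  by rewrite e Cmult_1_l.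
rewrite Rmin_right ?Rmax_left; try lra.
have h2 := is_RInt_opp _ _ _ _ (is_RInt_swap _ _ _ _ h).
rewrite (@opp_opp CR) in h2.
apply: is_RInt_ext h2; rewrite Rmin_left ?Rmax_right; try lra.
move=> t ht; rewrite Ufam_slice; last by rewrite e; lra.
by rewrite e; apply: C_eq; rewrite /opp /= /prod_opp /= /opp /= /Re /Im /=; ring.
Qed.

Lemma Ufam_RInt_0 f a b : (forall t, Rmin a b < t < Rmax a b -> s * (t - t0) <= 0) ->
  @is_RInt CR (fun t => Ufam t (fun x => f (st x t))) a b zero.
Proof.
move=> h; have := @is_RInt_const CR a b zero; rewrite (@scal_zero_r R_AbsRing CR).
apply: is_RInt_ext => t /h ht; rewrite /Ufam; case: (Rlt_dec 0 (s * (t - t0))) => // h1 /=; exfalso; lra.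
Qed.

Lemma Ufam_family : is_dist_of_family Ufam (Kinf Ew M s (st x0 t0)).
Proof.
move=> f tf P hP; have {}hP := locally_singleton _ _ hP.
have [A A0 hA] := test_testA tf.
have tE : time (st x0 t0) = t0 by rewrite /time st_max.
have p0 := Rabs_pos t0; have p1 := Rle_abs t0; have p2 := Rle_abs (- t0); rewrite Rabs_Ropp in p2.
(* Once the interval contains [[- B, B]] its end lies further than [A + Rabs t0] from [t0], as
   [Kinf_Kop] requires; the integral is then constant and no limit has to be taken. *)
pose B := A + 2 * Rabs t0 + 1.
apply: (Filter_prod _ _ _ (fun a => a < - B) (fun b => B < b)); [by exists (- B) | by exists B|].
rewrite /B => a b ha hb /=; exists (Kinf Ew M s (st x0 t0) f); split => //.
have fwd T : A + Rabs t0 < s * T -> @is_RInt CR (fun t => Ufam t (fun x => f (st x t)))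
    (Rmin t0 (t0 + T)) (Rmax t0 (t0 + T)) (Kinf Ew M s (st x0 t0) f).
  move=> hT; rewrite (Kinf_Kop hEw M hs hA (T := T)) ?tE //; apply: Ufam_RInt => //; lra.
case: (hs) => e.
  have := fwd (b - t0); rewrite e (_ : t0 + (b - t0) = b); last by ring.
  rewrite Rmin_left ?Rmax_right; try lra; move=> h; have {}h := h ltac:(lra).
  have z : @is_RInt CR (fun t => Ufam t (fun x => f (st x t))) a t0 zero.
    apply: Ufam_RInt_0 => t; rewrite Rmin_left ?Rmax_right; try lra; rewrite e; lra.
  by have := is_RInt_Chasles _ _ _ _ _ _ z h; rewrite plus_zero_l.
have := fwd (a - t0); rewrite e (_ : t0 + (a - t0) = a); last by ring.
rewrite Rmin_right ?Rmax_left; try lra; move=> h; have {}h := h ltac:(lra).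
have z : @is_RInt CR (fun t => Ufam t (fun x => f (st x t))) t0 b zero.
  apply: Ufam_RInt_0 => t; rewrite Rmin_left ?Rmax_right; try lra; rewrite e; lra.
by have := is_RInt_Chasles _ _ _ _ _ _ h z; rewrite plus_zero_r.
Qed.

(** The values of [Kop] agree for every [T], so [epsilon] chooses from the same predicate and the
    two functionals are equal outright. *)
Lemma Kinf_translate : dist_translate (st x0 0) (Kinf Ew M s (st (@vzero n) t0)) = Kinf Ew M s (st x0 t0).
Proof.
apply: functional_extensionality => f; rewrite /dist_translate /Kinf; congr epsilon.
have E T : Kop Ew M T (fun x => f (fun i => x i + st x0 0 i)) (st (@vzero n) t0) = Kop Ew M T f (st x0 t0).
  apply: I2_ext_open => t u _ _; rewrite /gen.
  have -> : time (st (@vzero n) t0) = time (st x0 t0) by rewrite /time !st_max.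
  rewrite /W; congr (_ * (_ * Tw _ _ _ _))%C.
  apply: functional_extensionality => y; rewrite /slice; congr f; apply: functional_extensionality => k.
  case: (unliftP ord_max k) => [i ->|->]; last by rewrite !upd_same !st_max; ring.
  by rewrite !upd_neq ?st_lift; [rewrite /vzero; ring | rewrite eq_sym neq_lift | rewrite eq_sym neq_lift].
apply: functional_extensionality => c'; congr ex; apply: functional_extensionality => T0.
by apply: propositional_extensionality; split=> h T hT; rewrite -(h T hT) E.
Qed.
End Family.

Lemma Kinf_the (n : nat) (Ew : R -> functional n) (hEw : wave_fundamental_solution Ew) M s
  (hs : s = 1 \/ s = -1) x0 t0 : the_fundamental_solution M x0 t0 (cone s x0 t0) (Kinf Ew M s (st x0 t0)).
Proof.
have h := Kinf_is_fundamental hEw M hs x0 t0.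
by split=> // E' hE'; exact: (fundamental_unique hEw hs hE' h).
Qed.

Theorem theorem0p2 (n : nat) (hn : (2 <= n)%N) (M : R) (hM : 0 <= M)
  (x0 : vec n) (t0 : R) (Ew : R -> functional n)
  (hEw : wave_fundamental_solution Ew) :
  (exists E E0 : functional n.+1,
     the_fundamental_solution M x0 t0 (forward_cone x0 t0) E /\
     the_fundamental_solution M (@vzero n) t0 (forward_cone (@vzero n) t0) E0 /\
     dist_eq E (dist_translate (st x0 0) E0) /\
     exists U : R -> functional n,
       is_dist_of_family U (dist_translate (st x0 0) E0) /\
       (forall t : R, distribution (U t)) /\
       (forall t : R, t < t0 -> dist_eq (U t) (fun _ => RtoC 0)) /\
       (forall t : R, t0 < t ->
          is_dist_RInt (integrand M Ew x0 t t0)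
            0 (exp (- t0) - exp (- t)) (U t))) /\
  (exists E E0 : functional n.+1,
     the_fundamental_solution M x0 t0 (backward_cone x0 t0) E /\
     the_fundamental_solution M (@vzero n) t0 (backward_cone (@vzero n) t0) E0 /\
     dist_eq E (dist_translate (st x0 0) E0) /\
     exists U : R -> functional n,
       is_dist_of_family U (dist_translate (st x0 0) E0) /\
       (forall t : R, distribution (U t)) /\
       (forall t : R, t0 < t -> dist_eq (U t) (fun _ => RtoC 0)) /\
       (forall t : R, t < t0 ->
          is_dist_RInt (integrand M Ew x0 t t0)
            (exp (- t0) - exp (- t)) 0 (U t))).
Proof.
have hf : 1 = 1 \/ 1 = -1 by left.
have hb : -1 = 1 \/ -1 = -1 by right.
have cf (x : vec n) : forward_cone x t0 = cone 1 x t0.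
  by apply: functional_extensionality => z; rewrite /forward_cone /cone Rmult_1_l.
have cb (x : vec n) : backward_cone x t0 = cone (-1) x t0.
  apply: functional_extensionality => z; rewrite /backward_cone /cone; congr (_ <= _); ring.
split.
- exists (Kinf Ew M 1 (st x0 t0)), (Kinf Ew M 1 (st (@vzero n) t0)).
  rewrite !cf (Kinf_translate Ew M 1 x0 t0); split; first exact: Kinf_the.
  split; first exact: Kinf_the.
  split=> //; exists (Ufam Ew M 1 x0 t0); split; first exact: Ufam_family.
  split; first exact: Ufam_dist.
  split=> t ht; first by apply: Ufam_0; lra.
  move=> f tf; rewrite /Ufam; case: (Rlt_dec 0 (1 * (t - t0))) => [h|h]; last by exfalso; lra.
  by rewrite /= Cmult_1_l; have := @is_RInt_integrand n Ew hEw M _ hf x0 t0 t f h tf.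
exists (Kinf Ew M (-1) (st x0 t0)), (Kinf Ew M (-1) (st (@vzero n) t0)).
rewrite !cb (Kinf_translate Ew M (-1) x0 t0); split; first exact: Kinf_the.
split; first exact: Kinf_the.
split=> //; exists (Ufam Ew M (-1) x0 t0); split; first exact: Ufam_family.
split; first exact: Ufam_dist.
split=> t ht; first by apply: Ufam_0; lra.
move=> f tf; rewrite /Ufam; case: (Rlt_dec 0 (-1 * (t - t0))) => [h|h]; last by exfalso; lra.
(* The sign reverses the integral from 0 to [exp (- t0) - exp (- t)] obtained by the
   substitution. *)
rewrite /= (_ : (RtoC (-1) * I1 (ufun Ew M x0 t0 t f) = - I1 (ufun Ew M x0 t0 t f))%C); last first.
  by apply: C_eq; rewrite /Re /Im /=; ring.
by have := is_RInt_swap _ _ _ _ (@is_RInt_integrand n Ew hEw M _ hb x0 t0 t f h tf).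
Qed.
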